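(* Let $(G,R)$ be a quadratic pair, $\mathfrak g=\mathfrak r\oplus\mathfrak p$ with $\mathfrak p=\mathfrak r^\perp$, and let $M^o$ be the one point manifold. Then $\operatorname{Ind}_{G/R}(\Omega(M^o))$ can canonically be identified with the super-algebra $(U(\mathfrak g)\otimes\operatorname{Cl}(\mathfrak p))^R$ (under the tensor product algebra structure). Moreover, under this identification the differential $d$ on $\operatorname{Ind}_{G/R}(\Omega(M^o))$ is given by $$d(x)=\operatorname{ad}\mathcal D^{\mathfrak p}(x),\qquad \mathcal D^{\mathfrak p}:=\sum_\ell u_{p_\ell}\otimes c_{q_\ell}-1\otimes\gamma_{\mathfrak p},$$ where $\{p_\ell\}_\ell$ is any basis of $\mathfrak p$, $\{q_\ell\}_\ell$ is the dual basis with respect to the nondegenerate form $B_{\mathfrak g}|_{\mathfrak p}$, and $\gamma_{\mathfrak p}\in\wedge^3(\mathfrak p)\simeq\wedge^3(\mathfrak p^* )$ is the Cartan form $\gamma_{\mathfrak p}(x,y,z)=\langle x,[y,z]\rangle$ for $x,y,z\in\mathfrak p$. The element $\mathcal D^{\mathfrak p}$ is $R$-invariant, i.e. $\mathcal D^{\mathfrak p}\in(U(\mathfrak g)\otimes\operatorname{Cl}(\mathfrak p))^R$.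
   Context: Vector spaces are complex; ''super'' means $\mathbb Z/2$-graded. Quadratic pair: $G$ is a (not necessarily connected) real Lie group with complexified Lie algebra $\mathfrak g$, $R\subset G$ is a closed subgroup with complexified Lie algebra $\mathfrak r$, and $\mathfrak g$ is equipped with a $G$-invariant nondegenerate symmetric bilinear form $B_{\mathfrak g}=\langle\ ,\ \rangle$ whose restriction to $\mathfrak r$ is nondegenerate. Then $\mathfrak g=\mathfrak r\oplus\mathfrak p$ with $\mathfrak p:=\mathfrak r^\perp$, which is $R$-stable, and $B_{\mathfrak g}|_{\mathfrak p}$ is nondegenerate. Noncommutative Weil algebra: $\mathcal W(\mathfrak g)=U(\mathfrak g)\otimes\operatorname{Cl}(\mathfrak g)$ (tensor product algebra), where $U(\mathfrak g)$ is the enveloping algebra, in even degree, and $\operatorname{Cl}(\mathfrak g)$ is the quotient of the tensor algebra $T(\mathfrak g)$ by the two-sided ideal generated by $2x\otimes x-\langle x,x\rangle$, $x\in\mathfrak g$, with its standard $\mathbb Z/2$-grading. $\operatorname{Cl}(\mathfrak p)$ is defined similarly from $B_{\mathfrak g}|_{\mathfrak p}$. $\operatorname{Cl}(\mathfrak g)$ is identified as a vector space with $\wedge(\mathfrak g)$ via $\wedge(\mathfrak g)\simeq\{\text{skew-symmetric tensors}\}\subset T(\mathfrak g)\to\operatorname{Cl}(\mathfrak g)$, and similarly $\operatorname{Cl}(\mathfrak p)$ with $\wedge(\mathfrak p)$. For $a\in\mathfrak g$, $u_a\in U(\mathfrak g)$ and $c_a$ in the Clifford algebra are the corresponding elements.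 $G$ acts by the adjoint action; $i_a=I_{U(\mathfrak g)}\otimes\bar i_a$, where $\bar i_a$ is the super-derivation of $\wedge(\mathfrak g)$ with $\bar i_ab=\langle a,b\rangle$. The differential is $d=\operatorname{ad}\mathcal D$, where $\operatorname{ad}$ is the super-commutator ($\operatorname{ad}\mathcal D(x)=\mathcal Dx-x\mathcal D$ for $x$ even, $\mathcal Dx+x\mathcal D$ for $x$ odd) and $\mathcal D=\sum_k u_{a_k}c_{b_k}-1\otimes\gamma$, with $\{a_k\},\{b_k\}$ dual bases of $\mathfrak g$ and $\gamma\in\wedge^3(\mathfrak g)$ the element corresponding to the 3-form $\gamma(a,b,c)=\langle a,[b,c]\rangle$ under $\wedge(\mathfrak g)\simeq\wedge(\mathfrak g^* )$, i.e. $\gamma=\frac16\sum\langle a_i,[a_j,a_k]\rangle\, b_i\wedge b_j\wedge b_k$. The same convention is used for $\gamma_{\mathfrak p}$, with $\wedge(\mathfrak p)\simeq\wedge(\mathfrak p^* )$ via $B_{\mathfrak g}|_{\mathfrak p}$. Induction: for an $R$-manifold $M$ with complexified de Rham algebra $\Omega(M)$, $\operatorname{Ind}_{G/R}(\Omega(M))=(\mathcal W(\mathfrak g)\otimes\Omega(M))_R$, the subspace of $R$-invariant elements annihilated by the contractions $i_a$, $a\in\mathfrak r$, with the tensor product differential and product. For $M=M^o$ a point, $\Omega(M^o)=\mathbb C$, so $\operatorname{Ind}_{G/R}(\Omega(M^o))=\mathcal W(\mathfrak g)_R$ with differential the restriction of $d=\operatorname{ad}\mathcal D$. *)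

(* Defs.v *)
From HB Require Import structures.
From mathcomp Require Import all_boot all_order all_algebra.
From mathcomp Require Import perm complex finmap.
From mathcomp Require Import all_classical all_reals all_analysis.
From mathcomp.multinomials Require monalg.
(* The notations of [monalg] clash with those of MathComp-Analysis. *)
Import -(notations) monalg.
Import numFieldNormedType.Exports.

Set Implicit Arguments.
Unset Strict Implicit.
Unset Printing Implicit Defensive.

Import Order.TTheory GRing.Theory Num.Theory.

Local Open Scope classical_set_scope.
Local Open Scope quotient_scope.
Local Open Scope ring_scope.

(* The algebra K<X> of noncommutative polynomials, i.e. of finitely supported
   functions on the words in X.  It is a copy of [malg (fmonom X) K] with locked
   operations, since unifying those of [malg] is prohibitively slow; it is not
   declared an [lalgType] because the quotients below may be zero rings. *)
Definition free_algebra (K : comNzRingType) (X : choiceType) :=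
  malg (fmonom X) K.

HB.lock Definition word (K : comNzRingType) (X : choiceType) (s : seq X) :
  free_algebra K X := mkmalgU (FMonom s) 1.

HB.lock Definition free_opp (K : comNzRingType) (X : choiceType)
  (x : malg (fmonom X) K) := - x.
HB.lock Definition free_add (K : comNzRingType) (X : choiceType)
  (x y : malg (fmonom X) K) := x + y.
HB.lock Definition free_mul (K : comNzRingType) (X : choiceType)
  (x y : malg (fmonom X) K) := x * y.
HB.lock Definition free_scale (K : comNzRingType) (X : choiceType)
  (k : K) (x : malg (fmonom X) K) := k *: x.

Section FreeAlgebra.
Variables (K : comNzRingType) (X : choiceType).
Local Notation free_algebra := (free_algebra K X).

HB.instance Definition _ := Choice.on free_algebra.

Local Notation M := (malg (fmonom X) K).
Let faE := (free_opp.unlock, free_add.unlock, free_mul.unlock, free_scale.unlock).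

Let faddA : associative (@free_add K X).
Proof. by move=> x y z; rewrite !faE addrA. Qed.
Let faddC : commutative (@free_add K X).
Proof. by move=> x y; rewrite !faE addrC. Qed.
Let fadd0 : left_id (0 : M) (@free_add K X).
Proof. by move=> x; rewrite !faE add0r. Qed.
Let faddN : left_inverse (0 : M) (@free_opp K X) (@free_add K X).
Proof. by move=> x; rewrite !faE addNr. Qed.

HB.instance Definition _ :=
  GRing.isZmodule.Build free_algebra faddA faddC fadd0 faddN.

Let fmulA : associative (@free_mul K X).
Proof. by move=> x y z; rewrite !faE mulrA. Qed.
Let fmul1 : left_id (1 : M) (@free_mul K X).
Proof. by move=> x; rewrite !faE mul1r. Qed.
Let fmulr1 : right_id (1 : M) (@free_mul K X).
Proof. by move=> x; rewrite !faE mulr1. Qed.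
Let fmulDl : left_distributive (@free_mul K X) (@free_add K X).
Proof. by move=> x y z; rewrite !faE mulrDl. Qed.
Let fmulDr : right_distributive (@free_mul K X) (@free_add K X).
Proof. by move=> x y z; rewrite !faE mulrDr. Qed.

HB.instance Definition _ := GRing.Zmodule_isPzRing.Build free_algebra
  fmulA fmul1 fmulr1 fmulDl fmulDr.

Let fscaleA a b (x : M) :
  free_scale a (free_scale b x) = free_scale (a * b) x.
Proof. by rewrite !faE scalerA. Qed.
Let fscale1 : left_id (1 : K) (@free_scale K X).
Proof. by move=> x; rewrite !faE scale1r. Qed.
Let fscaleDr : right_distributive (@free_scale K X) (@free_add K X).
Proof. by move=> k x y; rewrite !faE scalerDr. Qed.
Let fscaleDl (x : M) : {morph (@free_scale K X)^~ x : a b / a + b >-> free_add a b}.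
Proof. by move=> a b; rewrite !faE scalerDl. Qed.

HB.instance Definition _ := GRing.Zmodule_isLmodule.Build K free_algebra
  fscaleA fscale1 fscaleDr fscaleDl.

Implicit Types (k : K) (x y : free_algebra).

Lemma free_addE x y : x + y = ((x : M) + (y : M) : M).
Proof. by change (free_add x y = ((x : M) + (y : M) : M)); rewrite free_add.unlock. Qed.

Lemma free_mulE x y : x * y = ((x : M) * (y : M) : M).
Proof. by change (free_mul x y = ((x : M) * (y : M) : M)); rewrite free_mul.unlock. Qed.

Lemma free_scaleE k x : k *: x = (k *: (x : M) : M).
Proof. by change (free_scale k x = (k *: (x : M) : M)); rewrite free_scale.unlock. Qed.

Lemma free_algebra_scaleAl k x y : k *: (x * y) = (k *: x) * y.
Proof. by rewrite !free_mulE !free_scaleE; exact: (@fgscaleAl _ _ k x y). Qed.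

Lemma free_algebra_scaleAr k x y : k *: (x * y) = x * (k *: y).
Proof.
rewrite !free_mulE !free_scaleE; apply/malgP => w; rewrite mcoeffZ.
have xy := mcoeffMlw w (fsubset_refl (msupp x)) (fsubset_refl (msupp y)).
have xky := mcoeffMlw w (fsubset_refl (msupp x)) (msuppZ_le k y).
apply: etrans (etrans (congr1 (GRing.mul k) xy) _) (esym xky).
rewrite mulr_sumr; apply: eq_bigr => u _.
rewrite mulr_sumr; apply: eq_bigr => v _.
by rewrite mcoeffZ mulrnAr mulrCA.
Qed.

(* Linear extension to K<X> of a function on words. *)
Definition free_ext (V : lmodType K) (f : seq X -> V) (x : free_algebra) : V :=
  \sum_(w <- msupp x) mcoeff w x *: f (w : seq X).


Lemma word_nil : word K [::] = 1.
Proof. by rewrite word.unlock -fmoneE. Qed.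

Lemma word_cat (s t : seq X) : word K (s ++ t) = word K s * word K t.
Proof.
rewrite free_mulE !word.unlock malgM_def fgmulUU mulr1; congr mkmalgU.
by rewrite [RHS]fmmulE.
Qed.

Lemma free_ext_word (V : lmodType K) (f : seq X -> V) s :
  free_ext f (word K s) = f s.
Proof.
by rewrite /free_ext word.unlock msuppU1 big_seq_fset1 mcoeffUU scale1r.
Qed.

Lemma free_ext_linear (V : lmodType K) (f : seq X -> V) : linear (free_ext f).
Proof.
have wide (d : {fset fmonom X}) x : (msupp x `<=` d)%fset ->
    free_ext f x = \sum_(w <- d) mcoeff w x *: f (w : seq X).
  move=> le_xd; apply: big_fset_incl => // w _ /mcoeff_outdom ->.
  by rewrite scale0r.
move=> k x y; set d := (msupp x `|` msupp y)%fset.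
have le_d : (msupp (k *: x + y) `<=` d)%fset.
  rewrite free_addE free_scaleE; apply: fsubset_trans (msuppD_le _ _) _.
  by apply: fsetSU; exact: msuppZ_le.
rewrite (wide _ _ le_d) (wide d x) ?fsubsetUl // (wide d y) ?fsubsetUr //.
rewrite scaler_sumr -big_split /=; apply: eq_bigr => w _.
by rewrite free_addE free_scaleE mcoeffD mcoeffZ scalerDl scalerA.
Qed.
HB.instance Definition _ (V : lmodType K) (f : seq X -> V) :=
  GRing.isLinear.Build K free_algebra V _ (free_ext f) (free_ext_linear f).

Lemma free_ind (P : free_algebra -> Prop) :
  P 0 -> (forall k s x, P x -> P (k *: word K s + x)) -> forall x, P x.
Proof.
move=> P0 PD x; rewrite (monalgE x).
elim/big_rec: _ => // -[w] y _ Py; set c := mcoeff _ _.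
have -> : mkmalgU (FMonom w) c = c *: (word K w : M).
  by apply/malgP => v; rewrite mcoeffZ word.unlock !mcoeffU mulr_natr.
by have := PD c w y Py; rewrite free_addE free_scaleE.
Qed.

End FreeAlgebra.


Section Presented.
Variables (K : comNzRingType) (X : choiceType).
Local Notation A := (free_algebra K X).
Variable S : set A.

Inductive ideal_gen : set A :=
| IdealGen x : S x -> ideal_gen x
| Ideal0 : ideal_gen 0
| IdealD x y : ideal_gen x -> ideal_gen y -> ideal_gen (x + y)
| IdealMl a x : ideal_gen x -> ideal_gen (a * x)
| IdealMr x a : ideal_gen x -> ideal_gen (x * a).

Definition ideal_rel (x y : A) := `[< ideal_gen (x - y) >].

Lemma ideal_genN x : ideal_gen x -> ideal_gen (- x).
Proof. by move=> Ix; rewrite -mulN1r; apply: IdealMl. Qed.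

Lemma ideal_genZ k x : ideal_gen x -> ideal_gen (k *: x).
Proof. by move=> Ix; rewrite -[x]mul1r free_algebra_scaleAl; apply: IdealMl. Qed.

Lemma ideal_rel_equiv : equiv_class_of ideal_rel.
Proof.
split=> [x|x y|y x z].
- by apply/asboolP; rewrite subrr; apply: Ideal0.
- by apply/asboolP/asboolP => /ideal_genN; rewrite opprB.
- move=> /asboolP xy /asboolP yz; apply/asboolP.
  by rewrite -(subrKA y); apply: IdealD.
Qed.

Canonical ideal_equiv := EquivRelPack ideal_rel_equiv.

Definition presented := {eq_quot ideal_equiv}.

HB.instance Definition _ := Choice.on presented.
HB.instance Definition _ := EqQuotient.on presented.

Definition pproj (x : A) : presented := \pi_presented x.

Lemma pprojP x y : pproj x = pproj y <-> ideal_gen (x - y).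
Proof. by split=> [/eqmodP/asboolP|xy]; last exact/eqmodP/asboolP. Qed.

Lemma pproj_repr u : pproj (repr u) = u.
Proof. exact: reprK. Qed.

Lemma ideal_gen_repr x : ideal_gen (repr (pproj x) - x).
Proof. by apply/pprojP; rewrite pproj_repr. Qed.

Implicit Types u v : presented.

Let qzero := pproj 0.
Let qone := pproj 1.
Let qopp u := pproj (- repr u).
Let qadd u v := pproj (repr u + repr v).
Let qmul u v := pproj (repr u * repr v).
Let qscale k u := pproj (k *: repr u).

Let qprojN x : qopp (pproj x) = pproj (- x).
Proof. by apply/pprojP; rewrite -opprD; apply/ideal_genN/ideal_gen_repr. Qed.

Let qprojD x y : qadd (pproj x) (pproj y) = pproj (x + y).
Proof.
by apply/pprojP; rewrite opprD addrACA; apply: IdealD; apply: ideal_gen_repr.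
Qed.

Let qprojM x y : qmul (pproj x) (pproj y) = pproj (x * y).
Proof.
have dist (a b c d : A) : a * b - c * d = (a - c) * b + c * (b - d).
  by rewrite mulrBl mulrBr subrKA.
apply/pprojP; rewrite dist.
apply: IdealD; first exact/IdealMr/ideal_gen_repr.
exact/IdealMl/ideal_gen_repr.
Qed.

Let qprojZ k x : qscale k (pproj x) = pproj (k *: x).
Proof. by apply/pprojP; rewrite -scalerBr; apply/ideal_genZ/ideal_gen_repr. Qed.

Let qind (P : presented -> Prop) : (forall x, P (pproj x)) -> forall u, P u.
Proof. by move=> Pq u; rewrite -(pproj_repr u). Qed.

Let qaddA : associative qadd.
Proof. by do 3!elim/qind=> ?; rewrite !qprojD addrA. Qed.
Let qaddC : commutative qadd.
Proof. by do 2!elim/qind=> ?; rewrite !qprojD addrC. Qed.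
Let qadd0 : left_id qzero qadd.
Proof. by elim/qind=> ?; rewrite !qprojD add0r. Qed.
Let qaddN : left_inverse qzero qopp qadd.
Proof. by elim/qind=> ?; rewrite qprojN qprojD addNr. Qed.

HB.instance Definition _ :=
  GRing.isZmodule.Build presented qaddA qaddC qadd0 qaddN.

Lemma pprojD x y : pproj (x + y) = pproj x + pproj y.
Proof. exact/esym/qprojD. Qed.

Let qmulA : associative qmul.
Proof. by do 3!elim/qind=> ?; rewrite !qprojM mulrA. Qed.
Let qmul1 : left_id qone qmul.
Proof. by elim/qind=> ?; rewrite !qprojM mul1r. Qed.
Let qmulr1 : right_id qone qmul.
Proof. by elim/qind=> ?; rewrite !qprojM mulr1. Qed.
Let qmulDl : left_distributive qmul +%R.
Proof. by do 3!elim/qind=> ?; rewrite -pprojD !qprojM -pprojD mulrDl. Qed.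
Let qmulDr : right_distributive qmul +%R.
Proof. by do 3!elim/qind=> ?; rewrite -pprojD !qprojM -pprojD mulrDr. Qed.

HB.instance Definition _ := GRing.Zmodule_isPzRing.Build presented
  qmulA qmul1 qmulr1 qmulDl qmulDr.

Lemma pprojM x y : pproj (x * y) = pproj x * pproj y.
Proof. exact/esym/qprojM. Qed.

Let qscaleA a b u : qscale a (qscale b u) = qscale (a * b) u.
Proof. by elim/qind: u => x; rewrite !qprojZ scalerA. Qed.
Let qscale1 : left_id 1 qscale.
Proof. by elim/qind=> x; rewrite !qprojZ scale1r. Qed.
Let qscaleDr : right_distributive qscale +%R.
Proof. by move=> k; do 2!elim/qind=> ?; rewrite -pprojD !qprojZ -pprojD scalerDr. Qed.
Let qscaleDl u : {morph qscale^~ u : a b / a + b}.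
Proof. by elim/qind: u => x a b; rewrite !qprojZ -pprojD scalerDl. Qed.

HB.instance Definition _ := GRing.Zmodule_isLmodule.Build K presented
  qscaleA qscale1 qscaleDr qscaleDl.

Lemma pprojZ k x : pproj (k *: x) = k *: pproj x.
Proof. exact/esym/qprojZ. Qed.

Lemma presented_scaleAl k u v : k *: (u * v) = (k *: u) * v.
Proof.
elim/qind: u => x; elim/qind: v => y.
by have := congr1 pproj (free_algebra_scaleAl k x y); rewrite pprojZ !pprojM pprojZ.
Qed.

Lemma presented_scaleAr k u v : k *: (u * v) = u * (k *: v).
Proof.
elim/qind: u => x; elim/qind: v => y.
by have := congr1 pproj (free_algebra_scaleAr k x y); rewrite pprojZ !pprojM pprojZ.
Qed.

Lemma pproj_linear : linear pproj.
Proof. by move=> k x y; rewrite pprojD pprojZ. Qed.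
HB.instance Definition _ :=
  GRing.isLinear.Build K A presented _ pproj pproj_linear.

Lemma pproj_monoid_morphism : monoid_morphism pproj.
Proof. by split=> // x y; exact: pprojM. Qed.
HB.instance Definition _ :=
  GRing.isMonoidMorphism.Build A presented pproj pproj_monoid_morphism.

(* A linear map on the quotient, given by its values on words.  It is meaningful
   when its extension to K<X> kills the ideal generated by S. *)
Definition presented_ext (V : lmodType K) (f : seq X -> V) u : V :=
  free_ext f (repr u).

Lemma presented_extE (V : lmodType K) (f : seq X -> V) x :
  (forall s r t, S r -> free_ext f (word K s * r * word K t) = 0) ->
  presented_ext f (pproj x) = free_ext f x.
Proof.
move=> fS.
have fS' a r b : S r -> free_ext f (a * r * b) = 0.
  move=> Sr; elim/free_ind: a => [|k s a IHa].
    by rewrite !mul0r linear0.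
  rewrite !mulrDl linearD /= {}IHa addr0 -!free_algebra_scaleAl linearZ /=.
  rewrite -[RHS](scaler0 _ k); congr (_ *: _).
  elim/free_ind: b => [|l t b IHb]; first by rewrite mulr0 linear0.
  rewrite mulrDr linearD /= {}IHb addr0 -free_algebra_scaleAr linearZ /=.
  by rewrite fS // scaler0.
have fI y : ideal_gen y -> forall a b, free_ext f (a * y * b) = 0.
  elim=> {y} [y /fS'//|a b|y z _ IHy _ IHz a b|c y _ IHy a b|y c _ IHy a b].
  - by rewrite mulr0 mul0r linear0.
  - by rewrite mulrDr mulrDl linearD /= IHy IHz addr0.
  - by rewrite mulrA.
  - by rewrite mulrA -mulrA.
have /fI/(_ 1 1) := ideal_gen_repr x.
by rewrite mul1r mulr1 linearB /= => /eqP; rewrite subr_eq0 => /eqP.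
Qed.

Definition generator (x : X) : presented := pproj (word K [:: x]).

End Presented.

Definition presented_map (K : comNzRingType) (X Y : choiceType)
    (S : set (free_algebra K X)) (S' : set (free_algebra K Y)) (f : X -> Y) :
    presented S -> presented S' :=
  presented_ext (fun s => pproj S' (word K [seq f x | x <- s])).

(* The tensor product of two algebras: the symbols a (x) b are bilinear, multiply
   componentwise, and 1 (x) 1 is the unit.  Words in the symbols thus reduce to
   single symbols, so that this is the tensor product of the underlying spaces. *)
Section TensorProduct.
Variables (K : comNzRingType) (X Y : choiceType).
Variables (S : set (free_algebra K X)) (T : set (free_algebra K Y)).
Local Notation A := (presented S).
Local Notation B := (presented T).
Local Notation sym a b := (word K [:: (a, b)]).

Variant tensor_product_rel : set (free_algebra K (A * B)%type) :=
| TensorDl k a a' b :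
    tensor_product_rel (sym (k *: a + a') b - (k *: sym a b + sym a' b))
| TensorDr k a b b' :
    tensor_product_rel (sym a (k *: b + b') - (k *: sym a b + sym a b'))
| TensorM a a' b b' :
    tensor_product_rel (sym a b * sym a' b' - sym (a * a') (b * b'))
| Tensor1 : tensor_product_rel (sym 1 1 - 1).

Definition tensor_product := presented tensor_product_rel.

Definition tensor (a : A) (b : B) : tensor_product :=
  generator tensor_product_rel (a, b).

End TensorProduct.

Section TensorMap.
Variables (K : comNzRingType) (X Y X' Y' : choiceType).
Variables (S : set (free_algebra K X)) (T : set (free_algebra K Y)).
Variables (S' : set (free_algebra K X')) (T' : set (free_algebra K Y')).

(* The linear map f (x) g, for linear f and g. *)
Definition tensor_map (f : presented S -> presented S')
    (g : presented T -> presented T') :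
    tensor_product S T -> tensor_product S' T' :=
  presented_ext
    (fun s => tensor (f (\prod_(ab <- s) ab.1)) (g (\prod_(ab <- s) ab.2))).

End TensorMap.

(* The algebras U(V), Cl(V) and /\V, being quotients of T(V) = K<V> / (linearity),
   are presented by the generators x \in V, the linearity relations, and their own
   relations. *)
Section TensorAlgebra.
Variables (K : fieldType) (V : lmodType K).
Local Notation w := (word K).

Definition linear_rel : set (free_algebra K V) :=
  [set t | exists k x y, t = w [:: k *: x + y] - (k *: w [:: x] + w [:: y])].

Definition tensor_algebra := presented linear_rel.

Definition enveloping_rel (br : V -> V -> V) : set (free_algebra K V) :=
  linear_rel `|`
  [set t | exists x y, t = w [:: x; y] - w [:: y; x] - w [:: br x y]].

Definition enveloping (br : V -> V -> V) := presented (enveloping_rel br).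

Definition clifford_rel (B : V -> V -> K) : set (free_algebra K V) :=
  linear_rel `|` [set t | exists x, t = 2 *: w [:: x; x] - B x x *: w [::]].

Definition clifford (B : V -> V -> K) := presented (clifford_rel B).

Definition exterior_rel : set (free_algebra K V) :=
  linear_rel `|` [set t | exists x, t = w [:: x; x]].

Definition exterior := presented exterior_rel.

(* The projection from T(V), when S contains the linearity relations. *)
Definition of_tensor (S : set (free_algebra K V)) : tensor_algebra -> presented S :=
  fun t => pproj S (repr t).

Inductive skew_tensor : set tensor_algebra :=
| SkewAlt k (x : 'I_k -> V) :
    skew_tensor (\sum_(s : 'S_k) (-1) ^+ s *:
                   \prod_(i < k) generator linear_rel (x (s i)))
| Skew0 : skew_tensor 0
| SkewL c t t' : skew_tensor t -> skew_tensor t' -> skew_tensor (c *: t + t').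

Section Chevalley.
Variable B : V -> V -> K.

(* The identification of /\V with Cl(V), both being the image of the space of
   skew-symmetric tensors. *)
Definition chevalley_rel (omega : exterior) (c : clifford B) :=
  exists2 t, skew_tensor t &
    of_tensor exterior_rel t = omega /\ of_tensor (clifford_rel B) t = c.

Definition chevalley (omega : exterior) : clifford B :=
  xget 0 [set c | chevalley_rel omega c].

Definition symbol (c : clifford B) : exterior :=
  xget 0 [set omega | chevalley_rel omega c].

(* The superderivation of /\V with value B a x at x \in V. *)
Fixpoint contract_word (a : V) (s : seq V) : exterior :=
  if s is x :: s' then
    B a x *: pproj exterior_rel (w s')
    - generator exterior_rel x * contract_word a s'
  else 0.

Definition contract (a : V) : exterior -> exterior :=
  presented_ext (contract_word a).

Definition clifford_contract (a : V) (c : clifford B) : clifford B :=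
  chevalley (contract a (symbol c)).

(* The grading involution: 1 on the even part, -1 on the odd part. *)
Definition clifford_parity : clifford B -> clifford B :=
  presented_map (clifford_rel B) -%R.

End Chevalley.

End TensorAlgebra.

(* U(g) (x) Cl(W), where W is a space with a linear map j : W -> g and carries the
   form induced by B.  For j = idfun this is the noncommutative Weil algebra of g;
   for the inclusion of a subspace p of g it is U(g) (x) Cl(p). *)
Section Weil.
Variables (K : fieldType) (g W : lmodType K).
Variables (br : g -> g -> g) (B : g -> g -> K) (j : W -> g).

Definition pullback_form (x y : W) := B (j x) (j y).

Definition weil :=
  tensor_product (enveloping_rel br) (clifford_rel pullback_form).

Definition weil_tensor (u : enveloping br) (c : clifford pullback_form) : weil :=
  tensor u c.

Definition weil_parity : weil -> weil :=
  tensor_map idfun (@clifford_parity K W pullback_form).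

Definition weil_map (f : g -> g) (h : W -> W) : weil -> weil :=
  tensor_map (presented_map (enveloping_rel br) f)
             (presented_map (clifford_rel pullback_form) h).

Definition weil_contract (a : W) : weil -> weil :=
  tensor_map idfun (clifford_contract (B := pullback_form) a).

(* The supercommutator with an odd element D. *)
Definition odd_ad (D x : weil) : weil := D * x - weil_parity x * D.

Section Dirac.
Variables (m : nat) (p q : m.-tuple W).

Definition cartan_form : exterior W :=
  6^-1 *: \sum_(i < m) \sum_(k < m) \sum_(l < m)
    B (j (tnth p i)) (br (j (tnth p k)) (j (tnth p l))) *:
    (generator _ (tnth q i) * generator _ (tnth q k) * generator _ (tnth q l)).

Definition cubic_dirac : weil :=
  \sum_(i < m) weil_tensor (generator _ (j (tnth p i))) (generator _ (tnth q i))
  - weil_tensor 1 (chevalley pullback_form cartan_form).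

End Dirac.

End Weil.

Definition dual_bases (K : fieldType) (W : vectType K) (B : W -> W -> K) m
    (p q : m.-tuple W) :=
  basis_of fullv p /\ forall i k, B (tnth p i) (tnth q k) = (i == k)%:R.

(* Maps of class C^k on an open subset U of a finite-dimensional space, by
   iterated directional derivatives. *)
Fixpoint Ck_on (R : realType) (V W : normedModType R) (k : nat) (U : set V)
    (f : V -> W) : Prop :=
  (forall x, U x -> {for x, continuous f}) /\
  (if k is k'.+1 then
     forall v, (forall x, U x -> derivable f x v) /\ Ck_on k' U ('D_v f)
   else True).

Definition smooth_on (R : realType) (V W : normedModType R) (U : set V)
    (f : V -> W) := forall k, Ck_on k U f.

(* A homeomorphism from an open subset of G to an open subset of R^n; the values
   of both functions outside these sets are irrelevant. *)
Record chart (R : realType) (n : nat) (G : topologicalType) := Chart {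
  chart_dom : set G;
  chart_fun :> G -> 'rV[R]_n;
  chart_inv : 'rV[R]_n -> G;
  chart_dom_open : open chart_dom;
  chart_img_open : open (chart_fun @` chart_dom);
  chart_funK : forall x, chart_dom x -> chart_inv (chart_fun x) = x;
  chart_fun_continuous : forall x, chart_dom x -> {for x, continuous chart_fun};
  chart_inv_continuous : forall y, (chart_fun @` chart_dom) y ->
    {for y, continuous chart_inv}
}.

Definition chart_img R n G (phi : chart R n G) := phi @` chart_dom phi.

HB.mixin Record isLieGroup (R : realType) (n : nat) G of Group G & Topological G := {
  lie_hausdorff : hausdorff_space G;
  lie_second_countable : @second_countable G;
  lie_atlas : set (chart R n G);
  lie_atlas_cover : forall x, exists2 phi, lie_atlas phi & chart_dom phi x;
  lie_atlas_smooth : forall phi psi, lie_atlas phi -> lie_atlas psi ->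
    smooth_on (phi @` (chart_dom phi `&` chart_dom psi)) (psi \o chart_inv phi);
  lie_mul_continuous : continuous (fun xy : G * G => (xy.1 * xy.2)%g);
  lie_mul_smooth : forall phi psi chi,
    lie_atlas phi -> lie_atlas psi -> lie_atlas chi ->
    let mul (uv : 'rV[R]_n * 'rV[R]_n) :=
      (chart_inv phi uv.1 * chart_inv psi uv.2)%g in
    smooth_on [set uv | [/\ chart_img phi uv.1, chart_img psi uv.2
                           & chart_dom chi (mul uv)]] (chi \o mul);
  lie_inv_continuous : continuous (fun x : G => x^-1%g);
  lie_inv_smooth : forall phi psi, lie_atlas phi -> lie_atlas psi ->
    let inv (u : 'rV[R]_n) := (chart_inv phi u)^-1%g in
    smooth_on [set u | chart_img phi u /\ chart_dom psi (inv u)] (psi \o inv)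
}.

#[short(type="lieGroupType")]
HB.structure Definition LieGroup (R : realType) (n : nat) :=
  {G of Group G & Topological G & isLieGroup R n G}.

(* The tangent space of G at 1 is identified with R^n by a chart phi of the atlas
   at 1; Ad x is the derivative at 1 of the conjugation by x, and the bracket is the
   derivative at 1 of Ad.  The complexified Lie algebra g is then C^n, with the
   C-linear extensions of these maps. *)
Section LieAlgebra.
Variables (R : realType) (n : nat) (G : lieGroupType R n) (phi : chart R n G).

Definition real_Ad (x : G) (v : 'rV[R]_n) : 'rV[R]_n :=
  'D_v (fun y => phi (x * chart_inv phi y * x^-1)%g) (phi 1%g).

Definition real_bracket (v w : 'rV[R]_n) : 'rV[R]_n :=
  'D_v (fun y => real_Ad (chart_inv phi y) w) (phi 1%g).

(* The Lie algebra of a closed subgroup H: the velocities of the one-parameter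
   subgroups of G that lie in H. *)
Definition real_Lie (H : set G) : set 'rV[R]_n :=
  [set v | exists c : R -> G,
    [/\ continuous c, forall s t, c (s + t) = (c s * c t)%g,
        forall t, H (c t) & is_derive (0 : R) (1 : R) (phi \o c) v]].

Local Notation C := R[i].

Definition cplx (v : 'rV[R]_n) : 'rV[C]_n := map_mx (real_complex R) v.
Definition re_part (z : 'rV[C]_n) : 'rV[R]_n := map_mx (@complex.Re R) z.
Definition im_part (z : 'rV[C]_n) : 'rV[R]_n := map_mx (@complex.Im R) z.

Definition Ad (x : G) (z : 'rV[C]_n) : 'rV[C]_n :=
  cplx (real_Ad x (re_part z)) + 'i%C *: cplx (real_Ad x (im_part z)).

Definition bracket (z z' : 'rV[C]_n) : 'rV[C]_n :=
  cplx (real_bracket (re_part z) (re_part z') - real_bracket (im_part z) (im_part z'))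
  + 'i%C *: cplx (real_bracket (re_part z) (im_part z')
                  + real_bracket (im_part z) (re_part z')).

Definition is_subgroup (H : set G) :=
  [/\ H 1%g, forall x y, H x -> H y -> H (x * y)%g & forall x, H x -> H x^-1%g].

(* r is the C-span of the Lie algebra of H in g. *)
Definition is_complex_Lie (H : set G) (r : {vspace 'rV[C]_n}) :=
  forall z, z \in r <->
    exists2 s : seq 'rV[R]_n, {in s, forall v, real_Lie H v} &
      z \in <<[seq cplx v | v <- s]>>%VS.

Record quadratic_pair (H : set G) (B : {symmetric 'rV[C]_n})
    (r : {vspace 'rV[C]_n}) : Prop := {
  qp_closed : closed H;
  qp_subgroup : is_subgroup H;
  qp_Lie : is_complex_Lie H r;
  qp_nondegenerate : nondegenerate B;
  qp_invariant : forall x z z', B (Ad x z) (Ad x z') = B z z';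
  qp_nondegenerate_r : (r :&: orthov B r = 0)%VS
}.

End LieAlgebra.

Section Induction.
Variables (R : realType) (n : nat) (G : lieGroupType R n) (phi : chart R n G).
Variables (H : set G) (B : {symmetric 'rV[R[i]]_n}) (r : {vspace 'rV[R[i]]_n}).

Definition weil_algebra := weil (bracket phi) B idfun.

(* W(g)_R, which is Ind_{G/R}(Omega(M)) for M a point. *)
Definition ind_point : set weil_algebra :=
  [set w | (forall x, H x -> weil_map (Ad phi x) (Ad phi x) w = w) /\
           (forall a, a \in r -> weil_contract a w = 0)].

Definition complement := orthov B r.

Definition relative_weil := weil (bracket phi) B (@vsval _ _ complement).

Definition complement_Ad (x : G) (y : subvs_of complement) : subvs_of complement :=
  vsproj complement (Ad phi x (vsval y)).

Definition relative_invariants : set relative_weil :=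
  [set w | forall x, H x -> weil_map (Ad phi x) (complement_Ad x) w = w].

End Induction.

Arguments ind_point {R n G} phi H B r.
Arguments relative_invariants {R n G} phi H B r.

(* Main.v *)
Require Import Defs.
From HB Require Import structures.
From mathcomp Require Import all_boot all_order all_algebra.
From mathcomp Require Import perm complex ring.
From mathcomp Require Import all_classical all_reals all_analysis.

Set Implicit Arguments.
Unset Strict Implicit.
Unset Printing Implicit Defensive.

Import Order.TTheory GRing.Theory Num.Theory.
Import numFieldNormedType.Exports.
Local Open Scope classical_set_scope.
Local Open Scope ring_scope.

(** The identification is induced by the inclusion of Cl(p) into Cl(g). What
    needs proof is that its image is the horizontal part of W(g), and that the
    two Dirac operators act in the same way on invariant elements.

    Image. Under the Chevalley map, contraction by x becomes the supercommutator
    with c_x ([clifford_contractE]), so contractions along r kill U(g) (x) Cl(p).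
    Conversely, if <a,b> = 1, the algebra endomorphism of /\g induced by
    x |-> x - <a,x>b is 1 - b/\i_a ([ext_map_drop]); hence it fixes the kernel of
    i_a. For dual bases of r, these maps compose to the endomorphism induced by
    the orthogonal projection onto p, so an element killed by all i_a, a in r,
    lies in the image of U(g) (x) Cl(p) ([horizontal_image]). The same projection,
    transported by the Chevalley maps, gives a linear left inverse of
    Cl(p) -> Cl(g), whence injectivity. The inclusion commutes with R.

    Differential. The quantisation of the Cartan form is the same sum with
    Clifford products in place of exterior ones ([cartan_quantize]), and both
    Dirac operators depend on the form only, not on the dual bases
    ([dual_sum], [cubic_sum_dual]). In bases adapted to g = r + p, with dual bases
    r_i, s_i of r, and since [r,p] lies in p,
      D = D^p + sum_i c_(s_i) (u_(r_i) + spin(r_i)) - gamma_r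
    ([dirac_decomposition]). An R-invariant w in U(g) (x) Cl(p) commutes with
    u_a + spin(a) for a in r, because the commutator is the derivative of the
    action along one-parameter subgroups ([infinitesimal_invariance]), and Cl(r)
    supercommutes with U(g) (x) Cl(p). So D - D^p contributes nothing to the
    supercommutator with w ([odd_ad_restrict]).

    Derivatives in infinite-dimensional algebras. The orbit of an element stays
    in the span of finitely many vectors, with differentiable coefficients
    ([has_tangent]). Products of such curves obey the Leibniz rule, and a constant
    curve has zero tangent whatever the expansion ([tangent_const]).

    Lie theory. The bracket is read off in a chart as the derivative of Ad at the
    identity. Its properties come from differential calculus on the product
    m(y,z) of the group in that chart: the mean value theorem turns continuous
    directional derivatives into Frechet differentiability
    ([differentiable_coords]) and gives the symmetry of mixed derivatives
    ([derive_swap]); with these the bracket is the antisymmetrised mixed second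
    derivative of m ([real_bracketE]), and Ad preserves it ([real_Ad_bracket]).
    Differentiating the invariance of the form gives its invariance under the
    bracket, and differentiating Ad(R)p = p gives that [r,p] lies in p. *)

(** * Linear maps on presented algebras *)

Section Linear.
Variables (K : nzRingType) (U V : lmodType K) (f : U -> V).
Hypothesis f_lin : linear f.
Lemma lin0 : f 0 = 0.
Proof. by have := f_lin (-1) 0 0; rewrite scaler0 addr0 scaleN1r addNr. Qed.
Lemma linD u v : f (u + v) = f u + f v.
Proof. by have := f_lin 1 u v; rewrite !scale1r. Qed.
Lemma linZ k u : f (k *: u) = k *: f u.
Proof. by have := f_lin k u 0; rewrite lin0 !addr0. Qed.
Lemma linN u : f (- u) = - f u.
Proof. by rewrite -!scaleN1r linZ. Qed.
Lemma linB u v : f (u - v) = f u - f v.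
Proof. by rewrite linD linN. Qed.
Lemma lin_sum I (s : seq I) (P : pred I) (F : I -> U) :
  f (\sum_(i <- s | P i) F i) = \sum_(i <- s | P i) f (F i).
Proof. by apply: (big_morph f); [exact: linD | exact: lin0]. Qed.
End Linear.

Section FreeAction.
Variables (K : comNzRingType) (X : choiceType) (V : lmodType K).
Variable op : X -> V -> V.
Hypothesis op_lin : forall x, linear (op x).

(** Maps out of a presented algebra are obtained by letting it act: operators
    that satisfy the relations define an action of the quotient
    ([presented_act]), and the map sends an element to its action on a fixed
    vector. Parity, quantisation and symbol arise this way; contractions are a
    component of such a map. *)
Definition free_act (a : free_algebra K X) (v : V) : V :=
  free_ext (fun s => foldr op v s) a.

Lemma free_act_linl v : linear (free_act^~ v).
Proof. by move=> k x y; rewrite /free_act linearP. Qed.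

Lemma free_act_word s v : free_act (word K s) v = foldr op v s.
Proof. by rewrite /free_act free_ext_word. Qed.

Lemma foldr_linear s : linear (fun v => foldr op v s).
Proof. by elim: s => [|x s IHs] k u v //=; rewrite IHs op_lin. Qed.

Lemma free_act_linr a : linear (free_act a).
Proof.
move=> k u v; elim/free_ind: a => [|l s a IHa].
  by rewrite /free_act !linear0 addr0.
rewrite !free_act_linl IHa !free_act_word foldr_linear.
by rewrite !scalerDr !scalerA mulrC addrACA.
Qed.

Lemma free_actM a b v : free_act (a * b) v = free_act a (free_act b v).
Proof.
elim/free_ind: a => [|l s a IHa]; first by rewrite mul0r /free_act !linear0.
rewrite mulrDl -free_algebra_scaleAl !free_act_linl IHa; congr (_ *: _ + _) => {IHa}.
elim/free_ind: b => [|m t b IHb].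
  by rewrite mulr0 (lin0 (free_act_linl v)) (lin0 (free_act_linr _)).
rewrite mulrDr -free_algebra_scaleAr !free_act_linl IHb free_act_linr.
by congr (_ *: _ + _); rewrite -word_cat !free_act_word foldr_cat.
Qed.

Variable S : set (free_algebra K X).
Hypothesis op_rel : forall r, S r -> forall v, free_act r v = 0.

Lemma free_act_kills v s r t : S r ->
  free_ext (fun w => foldr op v w) (word K s * r * word K t) = 0.
Proof.
move=> Sr; rewrite -/(free_act _ v) !free_actM (op_rel Sr).
by rewrite (lin0 (free_act_linr _)).
Qed.

Definition presented_act (a : presented S) (v : V) : V :=
  presented_ext (fun s => foldr op v s) a.

Lemma presented_actE a v : presented_act (pproj S a) v = free_act a v.
Proof. by rewrite /presented_act presented_extE // => *; apply: free_act_kills. Qed.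

Lemma presented_act_linl v : linear (presented_act^~ v).
Proof.
move=> k x y; rewrite -(pproj_repr x) -(pproj_repr y) -pproj_linear.
by rewrite !presented_actE free_act_linl.
Qed.

Lemma presented_actM a b v :
  presented_act (a * b) v = presented_act a (presented_act b v).
Proof.
by rewrite -(pproj_repr a) -(pproj_repr b) -pprojM !presented_actE free_actM.
Qed.

Lemma presented_act1 v : presented_act 1 v = v.
Proof. by rewrite presented_actE -word_nil free_act_word. Qed.

Lemma presented_act_gen x v : presented_act (generator S x) v = op x v.
Proof. by rewrite presented_actE free_act_word. Qed.

End FreeAction.

Section PresentedInduction.
Variables (K : comNzRingType) (X : choiceType) (S : set (free_algebra K X)).
Implicit Type P : presented S -> Prop.

Lemma presented_word_ind P :
  P 0 -> (forall k u v, P u -> P v -> P (k *: u + v)) ->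
  (forall s, P (pproj S (word K s))) -> forall u, P u.
Proof.
move=> P0 Plin Pw u; rewrite -(pproj_repr u).
elim/free_ind: (repr u) => [|k s x IHx]; first exact: P0.
by rewrite pproj_linear; apply: Plin.
Qed.

Lemma pproj_cons x s :
  pproj S (word K (x :: s)) = generator S x * pproj S (word K s).
Proof. by rewrite -cat1s word_cat pprojM. Qed.

Lemma pproj_nil : pproj S (word K [::]) = 1.
Proof. by rewrite word_nil. Qed.

Lemma pproj_word s : pproj S (word K s) = \prod_(x <- s) generator S x.
Proof.
by elim: s => [|x s IHs]; rewrite ?pproj_nil ?big_nil // pproj_cons IHs big_cons.
Qed.

Lemma presented_ind P :
  P 1 -> (forall k u v, P u -> P v -> P (k *: u + v)) ->
  (forall x u, P u -> P (generator S x * u)) -> forall u, P u.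
Proof.
move=> P1 Plin Pg; apply: presented_word_ind => //.
  by have := Plin (-1) _ _ P1 P1; rewrite scaleN1r addNr.
by elim=> [|x s IHs]; rewrite ?pproj_nil // pproj_cons; apply: Pg.
Qed.

Lemma mull_linear (u : presented S) : linear (fun v : presented S => (u * v : presented S)).
Proof. by move=> k v w; rewrite mulrDr presented_scaleAr. Qed.
Lemma mulr_linear (u : presented S) : linear (fun v : presented S => (v * u : presented S)).
Proof. by move=> k v w; rewrite mulrDl presented_scaleAl. Qed.

Lemma presented_lin_eq (V : lmodType K) (f h : presented S -> V)
    (op : X -> presented S -> V -> V) : linear f -> linear h ->
  f 1 = h 1 ->
  (forall x u, f (generator S x * u) = op x u (f u)) ->
  (forall x u, h (generator S x * u) = op x u (h u)) -> f =1 h.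
Proof.
move=> f_lin h_lin fh1 fE hE; apply: presented_ind => // [k u v|x u IHu].
  by move=> fu fv; rewrite f_lin h_lin fu fv.
by rewrite fE hE IHu.
Qed.
End PresentedInduction.

Section PresentedMap.
Variables (K : comNzRingType) (X Y : choiceType).
Variables (S : set (free_algebra K X)) (S' : set (free_algebra K Y)).
Variable f : X -> Y.
Local Notation lmap := (fun x (u : presented S') => generator S' (f x) * u).

Lemma presented_map_op_lin x : linear (lmap x).
Proof. exact: mull_linear. Qed.

Hypothesis f_rel : forall r, S r -> forall u, free_act lmap r u = 0.

Lemma presented_mapE (u : presented S) : presented_map S' f u = presented_act lmap u 1.
Proof.
rewrite /presented_map /presented_act; congr (presented_ext _ u).
apply: funext; elim=> [|x s IHs] /=; first exact: pproj_nil.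
by rewrite -IHs pproj_cons.
Qed.

Lemma presented_map_lin : linear (presented_map S' f : presented S -> _).
Proof.
move=> k u v; rewrite !presented_mapE presented_act_linl //.
exact: presented_map_op_lin.
Qed.

Lemma presented_map1 : presented_map S' f (1 : presented S) = 1.
Proof.
by rewrite presented_mapE presented_act1 //; exact: presented_map_op_lin.
Qed.

Lemma presented_map_gen x :
  presented_map S' f (generator S x) = generator S' (f x).
Proof.
rewrite presented_mapE presented_act_gen ?mulr1 //; exact: presented_map_op_lin.
Qed.

Lemma presented_map_genM x (u : presented S) :
  presented_map S' f (generator S x * u) = generator S' (f x) * presented_map S' f u.
Proof.
rewrite !presented_mapE presented_actM ?presented_act_gen //;
  exact: presented_map_op_lin.
Qed.

Lemma presented_mapM (u v : presented S) :
  presented_map S' f (u * v) = presented_map S' f u * presented_map S' f v.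
Proof.
elim/presented_ind: u => [|k u w IHu IHw|x u IHu].
- by rewrite presented_map1 !mul1r.
- by rewrite mulr_linear !presented_map_lin mulr_linear IHu IHw.
- by rewrite -mulrA !presented_map_genM IHu mulrA.
Qed.

End PresentedMap.

(** * Tensor products of presented algebras *)

Section Tensor.
Variables (K : comNzRingType) (X Y : choiceType).
Variables (S : set (free_algebra K X)) (T : set (free_algebra K Y)).
Local Notation A := (presented S).
Local Notation B := (presented T).
Local Notation AB := (tensor_product S T).
Local Notation rel := (@tensor_product_rel K X Y S T).

Lemma eq_pproj (Z : choiceType) (Q : set (free_algebra K Z)) x y :
  Q (x - y) -> pproj Q x = pproj Q y.
Proof. by move=> Qxy; apply/pprojP/IdealGen. Qed.

Lemma tensor_linl b : linear (fun a : A => tensor a b : AB).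
Proof.
move=> k a a'; rewrite /tensor /generator.
by rewrite (eq_pproj (TensorDl k a a' b)) pproj_linear.
Qed.

Lemma tensor_linr a : linear (fun b : B => tensor a b : AB).
Proof.
move=> k b b'; rewrite /tensor /generator.
by rewrite (eq_pproj (TensorDr k a b b')) pproj_linear.
Qed.

Lemma tensorM a a' b b' :
  tensor a b * tensor a' b' = tensor (a * a') (b * b') :> AB.
Proof. by rewrite /tensor /generator -pprojM (eq_pproj (TensorM a a' b b')). Qed.

Lemma tensor11 : tensor 1 1 = 1 :> AB.
Proof. by rewrite /tensor /generator (eq_pproj (Tensor1 S T)). Qed.

Lemma tensor_word s : pproj rel (word K s) =
  tensor (\prod_(ab <- s) ab.1) (\prod_(ab <- s) ab.2) :> AB.
Proof.
elim: s => [|[a b] s IHs]; first by rewrite pproj_nil !big_nil tensor11.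
by rewrite pproj_cons IHs !big_cons -tensorM.
Qed.

Lemma tensor_ind (P : AB -> Prop) :
  (forall k u v, P u -> P v -> P (k *: u + v)) ->
  (forall a b, P (tensor a b)) -> forall w, P w.
Proof.
move=> Plin Pt; apply: presented_word_ind => // [|s].
  by have := Plin (-1) _ _ (Pt 0 0) (Pt 0 0); rewrite scaleN1r addNr.
by rewrite tensor_word.
Qed.

Section Ext.
Variables (V : lmodType K) (F : A -> B -> V).
Hypothesis Fl : forall b, linear (F^~ b).
Hypothesis Fr : forall a, linear (F a).

(** A word of symbols of pure tensors multiplies to the pure tensor of the two
    products, so F is applied to the products of the components. *)
Definition tensor_ext : AB -> V :=
  presented_ext (fun s => F (\prod_(ab <- s) ab.1) (\prod_(ab <- s) ab.2)).

Let Fw (s : seq (A * B)) := F (\prod_(ab <- s) ab.1) (\prod_(ab <- s) ab.2).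

Let Fkills s r t : rel r -> free_ext Fw (word K s * r * word K t) = 0.
Proof.
have D3 c (a b : free_algebra K (A * B)%type) : free_ext Fw (word K s *
    (c - (a + b)) * word K t) = free_ext Fw (word K s * c * word K t)
  - (free_ext Fw (word K s * a * word K t) + free_ext Fw (word K s * b * word K t)).
  by rewrite mulrBr mulrDr mulrBl mulrDl linearB linearD.
have Z k (a : free_algebra K (A * B)%type) :
    free_ext Fw (word K s * (k *: a) * word K t)
  = k *: free_ext Fw (word K s * a * word K t).
  by rewrite -free_algebra_scaleAr -free_algebra_scaleAl linearZ.
case=> [k a a' b|k a b b'|a a' b b'|]; rewrite ?D3 ?Z.
- rewrite -!word_cat !free_ext_word /Fw !big_cat !big_cons !big_nil /= !mulr1.
  set a0 := \prod_(_ <- s) _; set a1 := \prod_(_ <- t) _.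
by rewrite mull_linear mulr_linear Fl subrr.
- rewrite -!word_cat !free_ext_word /Fw !big_cat !big_cons !big_nil /= !mulr1.
  by rewrite mull_linear mulr_linear Fr subrr.
- rewrite mulrBr mulrBl linearB /= -!word_cat !free_ext_word /Fw.
  by rewrite !big_cat !big_cons !big_nil /= !mulr1 subrr.
- rewrite mulrBr mulrBl linearB /= mulr1 -!word_cat !free_ext_word /Fw.
  by rewrite !big_cat !big_cons !big_nil /= !mulr1 subrr.
Qed.

Lemma tensor_ext_lin : linear tensor_ext.
Proof.
move=> k x y; rewrite -(pproj_repr x) -(pproj_repr y) -pproj_linear.
by rewrite /tensor_ext !presented_extE //; apply: free_ext_linear.
Qed.

Lemma tensor_extE a b : tensor_ext (tensor a b) = F a b.
Proof.
by rewrite /tensor_ext presented_extE // free_ext_word !big_seq1.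
Qed.
End Ext.

Lemma tensor_lin_eq (V : lmodType K) (f h : AB -> V) : linear f -> linear h ->
  (forall a b, f (tensor a b) = h (tensor a b)) -> f =1 h.
Proof.
move=> f_lin h_lin fh; apply: tensor_ind => // k u v fu fv.
by rewrite f_lin h_lin fu fv.
Qed.

End Tensor.

Section TensorMap.
Variables (K : comNzRingType) (X Y X' Y' : choiceType).
Variables (S : set (free_algebra K X)) (T : set (free_algebra K Y)).
Variables (S' : set (free_algebra K X')) (T' : set (free_algebra K Y')).
Variables (f : presented S -> presented S') (g : presented T -> presented T').
Hypotheses (f_lin : linear f) (g_lin : linear g).

Let Fl b : linear (fun a => tensor (f a) (g b)).
Proof. by move=> k u v; rewrite f_lin tensor_linl. Qed.
Let Fr a : linear (fun b => tensor (f a) (g b)).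
Proof. by move=> k u v; rewrite g_lin tensor_linr. Qed.

Lemma tensor_map_lin : linear (tensor_map f g).
Proof. exact: (tensor_ext_lin Fl Fr). Qed.

Lemma tensor_mapE a b : tensor_map f g (tensor a b) = tensor (f a) (g b).
Proof. exact: (tensor_extE Fl Fr). Qed.

Lemma tensor_mapM : (forall a a', f (a * a') = f a * f a') ->
  (forall b b', g (b * b') = g b * g b') ->
  forall w w', tensor_map f g (w * w') = tensor_map f g w * tensor_map f g w'.
Proof.
move=> fM gM w w'; have lin := tensor_map_lin.
elim/tensor_ind: w => [k u v IHu IHv|a b].
  by rewrite mulr_linear !lin IHu IHv mulr_linear.
elim/tensor_ind: w' => [k u v IHu IHv|a' b'].
  by rewrite mull_linear !lin IHu IHv mull_linear.
by rewrite tensorM !tensor_mapE tensorM fM gM.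
Qed.

Lemma tensor_map1 : f 1 = 1 -> g 1 = 1 -> tensor_map f g 1 = 1.
Proof. by move=> f1 g1; rewrite -tensor11 tensor_mapE f1 g1 tensor11. Qed.

End TensorMap.

Section TensorMapComp.
Variables (K : comNzRingType) (X Y X1 Y1 X2 Y2 : choiceType).
Variables (S : set (free_algebra K X)) (T : set (free_algebra K Y)).
Variables (S1 : set (free_algebra K X1)) (T1 : set (free_algebra K Y1)).
Variables (S2 : set (free_algebra K X2)) (T2 : set (free_algebra K Y2)).

Lemma tensor_map_comp (f : presented S -> presented S1)
    (g : presented T -> presented T1) (f' : presented S1 -> presented S2)
    (g' : presented T1 -> presented T2) :
  linear f -> linear g -> linear f' -> linear g' ->
  tensor_map f' g' \o tensor_map f g =1 tensor_map (f' \o f) (g' \o g).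
Proof.
move=> lf lg lf' lg'.
have lff : linear (f' \o f) by move=> k u v; rewrite /= lf lf'.
have lgg : linear (g' \o g) by move=> k u v; rewrite /= lg lg'.
apply: tensor_lin_eq => [k u v||a b] /=.
- by rewrite !tensor_map_lin.
- exact: tensor_map_lin.
- by rewrite !tensor_mapE.
Qed.

Lemma tensor_map_id w : tensor_map idfun idfun w = w :> tensor_product S T.
Proof.
have lf : linear (idfun : presented S -> presented S) by [].
have lg : linear (idfun : presented T -> presented T) by [].
move: w; apply: tensor_lin_eq => [||a b]; first exact: tensor_map_lin.
  by [].
by rewrite tensor_mapE.
Qed.

End TensorMapComp.

(** * Enveloping and exterior algebras *)

Lemma pproj_eq0 (K : comNzRingType) (X : choiceType) (S : set (free_algebra K X)) x :
  S x -> pproj S x = 0.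
Proof. by move=> Sx; rewrite -(linear0 (pproj S)); apply: eq_pproj; rewrite subr0. Qed.

Section LinearGenerators.
Variables (K : fieldType) (V : lmodType K).
Implicit Type S : set (free_algebra K V).

Lemma gen_linear S : linear_rel (V := V) `<=` S -> linear (generator S).
Proof.
move=> SS k x y; rewrite /generator -pproj_linear; apply: eq_pproj.
by apply: SS; exists k, x, y.
Qed.

Lemma free_act_linear_rel (U : lmodType K) (op : V -> U -> U) r u :
  (forall v, linear (op^~ v)) -> linear_rel r -> free_act op r u = 0.
Proof.
move=> op_lin [k [x [y ->]]].
by rewrite /free_act linearB linearD linearZ /= !free_ext_word /= op_lin subrr.
Qed.

End LinearGenerators.

Section LinearGeneratorsMap.
Variables (K : fieldType) (V : lmodType K).

Lemma gen_linear_map (W : lmodType K) (S' : set (free_algebra K W)) (f : V -> W) :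
  linear_rel (V := W) `<=` S' -> linear f ->
  forall r u, linear_rel r ->
  free_act (fun x (v : presented S') => generator S' (f x) * v) r u = 0.
Proof.
move=> SS' lf r u; apply: free_act_linear_rel => v k x y.
by rewrite lf (gen_linear SS') mulr_linear.
Qed.

End LinearGeneratorsMap.

Section Enveloping.
Variables (K : fieldType) (g : lmodType K) (br : g -> g -> g).
Local Notation u := (generator (enveloping_rel br)).

Lemma env_linear : linear u.
Proof. by apply: gen_linear => r; left. Qed.

Lemma env_comm x y : u x * u y - u y * u x = u (br x y).
Proof.
have /pproj_eq0/eqP : enveloping_rel br
    (word K [:: x; y] - word K [:: y; x] - word K [:: br x y]).
  by right; exists x, y.
by rewrite !linearB /= subr_eq0 !pproj_cons pproj_nil !mulr1 => /eqP.
Qed.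

Lemma env_map_rel (f : g -> g) : linear f ->
  (forall x y, f (br x y) = br (f x) (f y)) ->
  forall r, enveloping_rel br r -> forall v,
  free_act (fun x (w : enveloping br) => u (f x) * w) r v = 0.
Proof.
move=> lf fbr r [rl|[x [y ->]]] v.
  by apply: gen_linear_map => // s; left.
rewrite /free_act !linearB /= !free_ext_word /= !mulrA fbr -env_comm.
by rewrite mulrBl subrr.
Qed.

End Enveloping.

Section Exterior.
Variables (K : fieldType) (V : lmodType K).
Local Notation e := (generator (exterior_rel (V := V))).
Local Notation Lam := (exterior V).

Lemma ext_linear : linear e.
Proof. by apply: gen_linear => r; left. Qed.

Lemma ext_sq x : e x * e x = 0.
Proof.
have /pproj_eq0 : exterior_rel (V := V) (word K [:: x; x]) by right; exists x.
by rewrite !pproj_cons pproj_nil mulr1.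
Qed.

Lemma ext_anticomm x y : e x * e y = - (e y * e x).
Proof.
apply/eqP; rewrite -addr_eq0; apply/eqP; have := ext_sq (x + y).
rewrite (linD ext_linear) mulrDl !mulrDr !ext_sq add0r addr0.
by rewrite addrC => <-; rewrite addrC.
Qed.

Section Act.
Variables (U : lmodType K) (op : V -> U -> U).
Hypotheses (op_lin : forall x, linear (op x)) (op_linV : forall u, linear (op^~ u)).
Hypothesis op_sq : forall x u, op x (op x u) = 0.

Lemma ext_act_rel r : exterior_rel r -> forall u, free_act op r u = 0.
Proof.
move=> [rl|[x ->]] u; first exact: free_act_linear_rel.
by rewrite /free_act free_ext_word /= op_sq.
Qed.
End Act.

Section Contract.
Local Notation contract := Defs.contract.
Variable B : V -> V -> K.
Hypothesis Bl : forall y, linear_for *%R (B^~ y).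
Hypothesis Br : forall x, linear_for *%R (B x).

(* The rule i_a (x u) = <a,x> u - x i_a u involves u as well as i_a u, so letters
   do not act on i_a u alone; they do act on the pair (u, i_a u). *)
Let op a x (ud : Lam * Lam) : Lam * Lam :=
  (e x * ud.1, B a x *: ud.1 - e x * ud.2).

Let op_lin a x : linear (op a x).
Proof.
move=> k [u d] [u' d']; apply/pair_equal_spec; split=> /=.
  exact: mull_linear.
rewrite scalerDr mull_linear opprD addrACA; congr (_ + _).
by rewrite scalerBr !scalerA mulrC.
Qed.

Let op_rel a r : exterior_rel r -> forall ud, free_act (op a) r ud = 0.
Proof.
apply: ext_act_rel => [[u d] k x y|x [u d]]; apply/pair_equal_spec; split=> /=.
- by rewrite ext_linear mulr_linear.
- rewrite Br ext_linear mulr_linear scalerDl opprD addrACA; congr (_ + _).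
  by rewrite scalerBr !scalerA.
- by rewrite mulrA ext_sq mul0r.
- by rewrite mulrBr -presented_scaleAr mulrA ext_sq mul0r subr0 subrr.
Qed.

Let contract_wordE a s : foldr (op a) (1, 0) s =
  (pproj (exterior_rel (V := V)) (word K s), contract_word B a s).
Proof.
by elim: s => [|x s /= ->] //=; rewrite ?pproj_nil // /op /= -pproj_cons.
Qed.

Let act1 a := presented_act1 (op_lin a) (@op_rel a).
Let actM a := presented_actM (op_lin a) (@op_rel a).
Let act_gen a := presented_act_gen (op_lin a) (@op_rel a).
Let act_linl a := presented_act_linl (op_lin a) (@op_rel a).

Let contractE a u : contract B a u = (presented_act (op a) u (1, 0)).2.
Proof.
rewrite -(pproj_repr u) presented_actE //; last exact: op_rel.
set x := repr u.
have E y : free_ext (contract_word B a) y = (free_act (op a) y (1, 0)).2.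
  elim/free_ind: y => [|k s y IHy]; first by rewrite /free_act !linear0.
  rewrite free_act_linl free_act_word // contract_wordE.
  rewrite free_ext_linear free_ext_word IHy //.
rewrite /contract presented_extE ?E // => s r t Sr.
by rewrite E [free_act _ _ _](free_act_kills _ (@op_rel a)).
Qed.

Let contract_fst a u : (presented_act (op a) u (1, 0)).1 = u.
Proof.
move: u; apply: presented_ind => [|k u v IHu IHv|x u IHu].
- by rewrite act1.
- by rewrite act_linl //= IHu IHv.
- by rewrite actM // act_gen //= IHu.
Qed.

Lemma contract_lin a : linear (contract B a).
Proof. by move=> k u v; rewrite !contractE act_linl. Qed.

Lemma contract1 a : contract B a 1 = 0.
Proof. by rewrite contractE act1. Qed.

Lemma contractM a x u :
  contract B a (e x * u) = B a x *: u - e x * contract B a u.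
Proof.
rewrite !contractE actM // act_gen //=.
by rewrite contract_fst.
Qed.

Lemma contract_linl u : linear (fun a => contract B a u).
Proof.
move=> k a b; move: u.
apply: (@presented_lin_eq _ _ _ _ _ _ (fun x u d => B (k *: a + b) x *: u - e x * d)).
- exact: contract_lin.
- move=> l u v; rewrite !contract_lin.
  by rewrite !scalerDr !scalerA mulrC addrACA.
- by rewrite !contract1 scaler0 addr0.
- exact: contractM.
move=> x u; rewrite !contractM Bl scalerDl mull_linear opprD addrACA.
by rewrite scalerBr !scalerA.
Qed.

Lemma contract_anticomm a b u :
  contract B a (contract B b u) = - contract B b (contract B a u).
Proof.
apply/eqP; rewrite -addr_eq0; apply/eqP; move: u.
apply: (@presented_lin_eq _ _ _ _ _ _ (fun x u d => e x * d)).
- by move=> k u v; rewrite !contract_lin scalerDr addrACA.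
- by move=> k u v; rewrite scaler0 addr0.
- by rewrite !contract1 !(lin0 (contract_lin _)) addr0.
- move=> x u; rewrite !contractM !(linB (contract_lin _)) !(linZ (contract_lin _)).
  rewrite !contractM !opprB mulrDr.
  by rewrite [_ + (_ - B a x *: _)]addrCA [_ + (_ - B b x *: _)]addrCA addrACA subrKA
    subrr addr0.
- by move=> x u; rewrite mulr0.
Qed.

Lemma contract_sq (two : 2%:R != 0 :> K) a u : contract B a (contract B a u) = 0.
Proof.
have /eqP := contract_anticomm a a u; rewrite -addr_eq0 -mulr2n => /eqP E.
have : 2%:R *: contract B a (contract B a u) = 0 by rewrite scaler_nat.
by move/(congr1 (fun w => 2%:R^-1 *: w)); rewrite scalerA mulVf // scale1r scaler0.
Qed.

End Contract.
End Exterior.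

(** * Clifford algebras and the Chevalley map *)

(** This supercommutator turns out to be the contraction of Cl(V)
    ([clifford_contractE]). It is locked so that unification does not identify it
    with unrelated differences of products. *)
HB.lock Definition cl_contract (K : fieldType) (V : lmodType K) (B : V -> V -> K)
    (a : V) (u : clifford B) : clifford B :=
  generator _ a * u - clifford_parity u * generator _ a.

Section Clifford.
Variables (K : fieldType) (V : lmodType K) (B : V -> V -> K).
Local Notation c := (generator (clifford_rel B)).
Local Notation e := (generator (exterior_rel (V := V))).
Local Notation Cl := (clifford B).
Local Notation Lam := (exterior V).
Local Notation contract := (Defs.contract B).
Local Notation cl_contract := (@cl_contract K V B).
Local Notation par := (@clifford_parity K V B).

Hypothesis two : 2%:R != 0 :> K.
Hypothesis Bl : forall y, linear_for *%R (B^~ y).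
Hypothesis Br : forall x, linear_for *%R (B x).
Hypothesis Bsym : forall x y, B x y = B y x.

Local Notation half := (2%:R^-1 : K).

Lemma half_half (U : lmodType K) (u : U) : half *: u + half *: u = u.
Proof. by rewrite -mulr2n -scaler_nat scalerA mulfV // scale1r. Qed.

Lemma cliff_linear : linear c.
Proof. by apply: gen_linear => r; left. Qed.

Lemma cliff_sq x : c x * c x = (half * B x x) *: (1 : Cl).
Proof.
have /pproj_eq0/eqP : clifford_rel B (2 *: word K [:: x; x] - B x x *: word K [::]).
  by right; exists x.
have lin := @pproj_linear _ _ (clifford_rel B).
rewrite (linB lin) !(linZ lin) subr_eq0 !pproj_cons pproj_nil mulr1 => /eqP E.
by rewrite -scalerA -E scalerA mulVf // scale1r.
Qed.

Lemma cliff_anticomm x y : c x * c y + c y * c x = B x y *: (1 : Cl).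
Proof.
have E := cliff_sq (x + y); rewrite (linD cliff_linear) mulrDl !mulrDr in E.
have Bxy : B (x + y) (x + y) = B x x + (B x y + B x y) + B y y.
  have D1 u v w : B (u + v) w = B u w + B v w by have := Bl w 1 u v; rewrite scale1r mul1r.
  have D2 u v w : B w (u + v) = B w u + B w v by rewrite Bsym D1 !(Bsym w).
  by rewrite D1 !D2 (Bsym y x) !addrA.
rewrite {}Bxy !mulrDr !scalerDl -!cliff_sq in E.
move: E; rewrite -[RHS]addrA -[LHS]addrA => /addrI; rewrite addrA => /addIr ->.
by rewrite -!scalerA half_half.
Qed.

Section Act.
Variables (U : lmodType K) (op : V -> U -> U).
Hypotheses (op_linV : forall u, linear (op^~ u)).
Hypothesis op_sq : forall x u, op x (op x u) = (half * B x x) *: u.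

Lemma cliff_act_rel r : clifford_rel B r -> forall u, free_act op r u = 0.
Proof.
move=> [rl|[x ->]] u; first exact: free_act_linear_rel.
have lin := @free_ext_linear K V U.
rewrite /free_act (linB (lin _)) !(linZ (lin _)) !free_ext_word /= op_sq scalerA mulrA.
by rewrite mulfV // mul1r subrr.
Qed.
End Act.

Lemma parity_rel r : clifford_rel B r ->
  forall u, free_act (fun x (u : Cl) => c (- x) * u) r u = 0.
Proof.
apply: cliff_act_rel => [u k x y|x u].
  rewrite -mulr_linear; congr (_ * _).
  by rewrite !(linN cliff_linear) cliff_linear opprD scalerN.
rewrite mulrA !(linN cliff_linear) mulrNN cliff_sq -presented_scaleAl.
by rewrite mul1r.
Qed.

Lemma parity_lin : linear par.
Proof. exact: presented_map_lin parity_rel. Qed.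
Lemma parity1 : par 1 = 1.
Proof. exact: presented_map1 parity_rel. Qed.
Lemma parity_gen x : par (c x) = - c x.
Proof. by rewrite /clifford_parity (presented_map_gen parity_rel) (linN cliff_linear). Qed.
Lemma parityM u v : par (u * v) = par u * par v.
Proof. exact: presented_mapM parity_rel u v. Qed.
Lemma parity_genM x u : par (c x * u) = - (c x * par u).
Proof. by rewrite parityM parity_gen mulNr. Qed.

Lemma parityK u : par (par u) = u.
Proof.
move: u; apply: presented_ind => [|k u v IHu IHv|x u IHu].
- by rewrite !parity1.
- by rewrite !parity_lin IHu IHv.
- by rewrite parity_genM (linN parity_lin) parity_genM opprK IHu.
Qed.

Lemma cl_contract_lin a : linear (cl_contract a).
Proof.
move=> k u v; rewrite !cl_contract.unlock parity_lin mull_linear mulr_linear.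
by rewrite opprD addrACA scalerBr.
Qed.

Lemma cl_contract_linl u : linear (cl_contract^~ u).
Proof.
move=> k a b; rewrite !cl_contract.unlock cliff_linear mull_linear mulr_linear.
by rewrite opprD addrACA scalerBr.
Qed.

Lemma cl_contract1 a : cl_contract a 1 = 0.
Proof. by rewrite !cl_contract.unlock parity1 mulr1 mul1r subrr. Qed.

Lemma cl_contractM a x u :
  cl_contract a (c x * u) = B a x *: u - c x * cl_contract a u.
Proof.
rewrite !cl_contract.unlock parity_genM mulNr opprK mulrBr !mulrA opprB.
rewrite [X in _ = _ + X]addrC [RHS]addrA; congr (_ + _).
apply/eqP; rewrite eq_sym subr_eq -mulrDl cliff_anticomm.
by rewrite -presented_scaleAl mul1r.
Qed.

Lemma cl_contract_anticomm a b u :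
  cl_contract a (cl_contract b u) = - cl_contract b (cl_contract a u).
Proof.
apply/eqP; rewrite -addr_eq0; apply/eqP; move: u.
apply: (@presented_lin_eq _ _ _ _ _ _ (fun x u d => c x * d)).
- by move=> k u v; rewrite !cl_contract_lin scalerDr addrACA.
- by move=> k u v; rewrite scaler0 addr0.
- by rewrite !cl_contract1 !(lin0 (cl_contract_lin _)) addr0.
- move=> x u; rewrite !cl_contractM !(linB (cl_contract_lin _)).
  rewrite !(linZ (cl_contract_lin _)) !cl_contractM !opprB mulrDr.
  by rewrite [_ + (_ - B a x *: _)]addrCA [_ + (_ - B b x *: _)]addrCA addrACA subrKA
    subrr addr0.
- by move=> x u; rewrite mulr0.
Qed.

Lemma eqN_eq0 (U : lmodType K) (u : U) : u = - u -> u = 0.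
Proof. by move=> E; rewrite -[u]half_half -scalerDr {1}E addNr scaler0. Qed.

Lemma cl_contract_sq a u : cl_contract a (cl_contract a u) = 0.
Proof. by apply: eqN_eq0; rewrite -cl_contract_anticomm. Qed.

(* Exterior multiplication by x, transported to Cl(V): the Clifford product minus
   half the contraction. *)
Let wedge x (u : Cl) : Cl := c x * u - half *: cl_contract x u.
Let wedge_lin x : linear (wedge x).
Proof.
move=> k u v; rewrite /wedge mull_linear cl_contract_lin scalerDr opprD addrACA.
by rewrite scalerBr !scalerA mulrC.
Qed.
Let wedge_linV u : linear (wedge^~ u).
Proof.
move=> k x y; rewrite /wedge cliff_linear mulr_linear cl_contract_linl.
by rewrite scalerDr opprD addrACA scalerBr !scalerA mulrC.
Qed.
Let wedge_sq x u : wedge x (wedge x u) = 0.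
Proof.
rewrite /wedge (linB (cl_contract_lin _)) (linZ (cl_contract_lin _)).
rewrite cl_contract_sq scaler0 subr0 mulrBr -presented_scaleAr.
rewrite mulrA cliff_sq -presented_scaleAl mul1r cl_contractM scalerBr scalerA.
by rewrite subrr.
Qed.

Let wedge_rel r : exterior_rel r -> forall u, free_act wedge r u = 0.
Proof. exact: ext_act_rel. Qed.

(** The Chevalley map, in a form that allows induction on exterior words; its
    agreement with the skew-symmetrisation is [chevalleyE]. *)
Definition quantize (w : Lam) : Cl := presented_act wedge w 1.

Lemma quantize_lin : linear quantize.
Proof. exact: presented_act_linl wedge_rel _. Qed.
Lemma quantize1 : quantize 1 = 1.
Proof. exact: (presented_act1 wedge_lin wedge_rel). Qed.
Lemma quantizeM x w :
  quantize (e x * w) = c x * quantize w - half *: cl_contract x (quantize w).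
Proof.
by rewrite /quantize (presented_actM wedge_lin wedge_rel)
  (presented_act_gen wedge_lin wedge_rel).
Qed.

(* Clifford multiplication by x, transported to the exterior algebra; its square
   is the scalar <x,x>/2 by the Leibniz rule for the contraction. *)
Let clop x (w : Lam) : Lam := e x * w + half *: contract x w.
Let clop_lin x : linear (clop x).
Proof.
move=> k u v; rewrite /clop mull_linear contract_lin // scalerDr addrACA.
by rewrite scalerDr !scalerA mulrC.
Qed.
Let clop_linV u : linear (clop^~ u).
Proof.
move=> k x y; rewrite /clop ext_linear mulr_linear contract_linl //.
by rewrite scalerDr addrACA scalerDr !scalerA mulrC.
Qed.
Let clop_sq x w : clop x (clop x w) = (half * B x x) *: w.
Proof.
rewrite /clop (linD (contract_lin Br _)) (linZ (contract_lin Br _)).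
rewrite contract_sq // scaler0 addr0 mulrDr -presented_scaleAr.
rewrite mulrA ext_sq mul0r add0r contractM // scalerBr scalerA.
by rewrite addrC subrK.
Qed.

Let clop_rel r : clifford_rel B r -> forall u, free_act clop r u = 0.
Proof. exact: cliff_act_rel. Qed.

Definition cl_symbol (u : Cl) : Lam := presented_act clop u 1.

Lemma cl_symbol_lin : linear cl_symbol.
Proof. exact: presented_act_linl clop_rel _. Qed.
Lemma cl_symbol1 : cl_symbol 1 = 1.
Proof. exact: (presented_act1 clop_lin clop_rel). Qed.
Lemma cl_symbolM x u :
  cl_symbol (c x * u) = e x * cl_symbol u + half *: contract x (cl_symbol u).
Proof.
by rewrite /cl_symbol (presented_actM clop_lin clop_rel)
  (presented_act_gen clop_lin clop_rel).
Qed.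

(** Both contractions are antiderivations with the same values on generators,
    and contractions by two vectors anticommute, which handles the correction term
    of the exterior multiplication in Cl(V). *)
Lemma quantize_contract a w :
  quantize (contract a w) = cl_contract a (quantize w).
Proof.
move: w; apply: presented_ind => [|k u v IHu IHv|x w IHw].
- by rewrite contract1 // (lin0 quantize_lin) quantize1 cl_contract1.
- by rewrite contract_lin // !quantize_lin cl_contract_lin IHu IHv.
rewrite contractM // (linB quantize_lin) (linZ quantize_lin) !quantizeM.
rewrite (linB (cl_contract_lin _)) (linZ (cl_contract_lin _)) cl_contractM IHw.
by rewrite [in RHS]cl_contract_anticomm scalerN opprK opprD opprK !addrA.
Qed.

Lemma symbol_contract a u :
  cl_symbol (cl_contract a u) = contract a (cl_symbol u).
Proof.
move: u; apply: presented_ind => [|k u v IHu IHv|x u IHu].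
- by rewrite cl_contract1 // (lin0 cl_symbol_lin) cl_symbol1 contract1.
- by rewrite cl_contract_lin // !cl_symbol_lin contract_lin // IHu IHv.
rewrite cl_contractM // (linB cl_symbol_lin) (linZ cl_symbol_lin) !cl_symbolM.
rewrite (linD (contract_lin Br _)) (linZ (contract_lin Br _)) contractM // IHu.
by rewrite [in RHS]contract_anticomm // scalerN opprD !addrA.
Qed.

Lemma cl_symbolK u : quantize (cl_symbol u) = u.
Proof.
move: u; apply: presented_ind => [|k u v IHu IHv|x u IHu].
- by rewrite cl_symbol1 quantize1.
- by rewrite cl_symbol_lin quantize_lin IHu IHv.
rewrite cl_symbolM (linD quantize_lin) (linZ quantize_lin) quantizeM.
by rewrite quantize_contract IHu subrK.
Qed.

Lemma quantizeK w : cl_symbol (quantize w) = w.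
Proof.
move: w; apply: presented_ind => [|k u v IHu IHv|x w IHw].
- by rewrite quantize1 cl_symbol1.
- by rewrite quantize_lin cl_symbol_lin IHu IHv.
rewrite quantizeM (linB cl_symbol_lin) (linZ cl_symbol_lin) cl_symbolM.
by rewrite symbol_contract IHw addrK.
Qed.

End Clifford.

(** * Alternating sums *)

Section OfTensor.
Variables (K : fieldType) (V : lmodType K) (S : set (free_algebra K V)).
Hypothesis SS : linear_rel (V := V) `<=` S.
Local Notation gen := (generator (linear_rel (V := V))).

Lemma of_tensor_pproj x : of_tensor S (pproj (linear_rel (V := V)) x) = pproj S x.
Proof.
apply/pprojP; elim: (ideal_gen_repr (linear_rel (V := V)) x).
- by move=> y Sy; apply/IdealGen/SS.
- exact: Ideal0.
- by move=> *; apply: IdealD.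
- by move=> *; apply: IdealMl.
- by move=> *; apply: IdealMr.
Qed.

Lemma of_tensor_lin : linear (of_tensor S).
Proof.
move=> k u v; rewrite -(pproj_repr u) -(pproj_repr v) -pproj_linear.
by rewrite !of_tensor_pproj pproj_linear.
Qed.

Lemma of_tensorM u v : of_tensor S (u * v) = of_tensor S u * of_tensor S v.
Proof.
by rewrite -(pproj_repr u) -(pproj_repr v) -pprojM !of_tensor_pproj pprojM.
Qed.

Lemma of_tensor1 : of_tensor S 1 = 1.
Proof. by rewrite -pproj_nil of_tensor_pproj pproj_nil. Qed.

Lemma of_tensor_gen x : of_tensor S (gen x) = generator S x.
Proof. exact: of_tensor_pproj. Qed.

Lemma of_tensor_prod I (r : seq I) (F : I -> V) :
  of_tensor S (\prod_(i <- r) gen (F i)) = \prod_(i <- r) generator S (F i).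
Proof.
elim: r => [|i r IHr]; first by rewrite !big_nil of_tensor1.
by rewrite !big_cons of_tensorM of_tensor_gen IHr.
Qed.
End OfTensor.

Section Permuted.
Variables (K : fieldType) (V : lmodType K) (k : nat) (x : 'I_k -> V).

(** The indices are natural numbers, with value 0 out of range, so that products
    over intervals can be split at any position. *)
Definition permuted (s : 'S_k) (i : nat) : V := oapp (fun o => x (s o)) 0 (insub i).

Lemma permutedE s (o : 'I_k) : permuted s o = x (s o).
Proof. by rewrite /permuted valK. Qed.

Lemma permuted_tperm s (i j : 'I_k) (l : nat) :
  permuted (tperm i j * s)%g l =
  permuted s (if l == i then j : nat else if l == j then i : nat else l).
Proof.
have [lk|kl] := ltnP l k; last first.
  rewrite !ifF ?(gtn_eqF (leq_trans _ kl)) //.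
  by rewrite /permuted !insubN // -leqNgt.
rewrite -[l]/(val (Ordinal lk)); move: (Ordinal lk) => o.
rewrite permutedE permM; case: tpermP => [->|->|/eqP oi /eqP oj].
- by rewrite eqxx permutedE.
- by rewrite eqxx; case: eqP => [/val_inj ->|_]; rewrite permutedE.
by rewrite !val_eqE (negPf oi) (negPf oj) permutedE.
Qed.

(** Left multiplication by the transposition pairs off permutations of opposite
    signs and equal values. *)
Lemma sum_sign_invariant (U : lmodType K) (F : 'S_k -> U) (i j : 'I_k) :
  2%:R != 0 :> K -> i != j ->
  (forall s, F (tperm i j * s)%g = F s) ->
  \sum_(s : 'S_k) (-1) ^+ s *: F s = 0.
Proof.
move=> two ij Finv; apply: (eqN_eq0 two).
rewrite {1}(reindex_inj (mulgI (tperm i j))) -sumrN; apply: eq_bigr => s _.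
by rewrite Finv odd_permM odd_tperm ij signr_addb expr1 mulN1r scaleNr.
Qed.
End Permuted.

Section Alternation.
Variables (K : fieldType) (V : lmodType K).
Local Notation e := (generator (exterior_rel (V := V))).

Lemma ext_prod_comm u m n (f : nat -> V) :
  e u * (\prod_(m <= i < n) e (f i)) = (-1) ^+ (n - m) *: ((\prod_(m <= i < n) e (f i)) * e u).
Proof.
have [nm|mn] := leqP n m.
  rewrite big_geq // mulr1 mul1r; move: nm; rewrite -subn_eq0 => /eqP ->.
  by rewrite scale1r.
elim: n mn => // n IHn; rewrite ltnS => mn.
rewrite big_nat_recr //= mulrA.
have -> : e u * (\prod_(m <= i < n) e (f i)) =
    (-1) ^+ (n - m) *: ((\prod_(m <= i < n) e (f i)) * e u).
  move: mn; rewrite leq_eqVlt => /predU1P[->|/IHn//].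
  by rewrite big_geq // subnn mulr1 mul1r scale1r.
rewrite -presented_scaleAl -mulrA ext_anticomm mulrN -mulrA scalerN.
by rewrite subSn // exprS mulN1r scaleNr.
Qed.

Lemma ext_prod_swap k (i j : nat) (f : nat -> V) : (i < j < k)%N ->
  \prod_(0 <= l < k) e (f (if l == i then j else if l == j then i else l)) =
  - \prod_(0 <= l < k) e (f l).
Proof.
move=> /andP[ij jk]; pose f' l := f (if l == i then j else if l == j then i else l).
have ik := ltn_trans ij jk.
pose L (h : nat -> V) : exterior V := \prod_(0 <= l < i) e (h l).
pose M (h : nat -> V) : exterior V := \prod_(i.+1 <= l < j) e (h l).
pose N (h : nat -> V) : exterior V := \prod_(j.+1 <= l < k) e (h l).
have split (h : nat -> V) : \prod_(0 <= l < k) e (h l) =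
   L h * (e (h i) * M h * e (h j)) * N h.
  rewrite (big_cat_nat (n := i)) ?(ltnW ik) //= (big_ltn (m := i)) //.
  by rewrite (big_cat_nat (n := j) (m := i.+1)) ?(ltnW jk) //= (big_ltn (m := j)) // !mulrA.
rewrite -[LHS]/(\prod_(0 <= l < k) e (f' l)) !split.
have -> : L f' = L f.
  apply: eq_big_nat => l /andP[_ li].
  by rewrite /f' !ifF // ltn_eqF // (ltn_trans li).
have -> : M f' = M f.
  by apply: eq_big_nat => l /andP[il lj]; rewrite /f' (gtn_eqF il) (ltn_eqF lj).
have -> : N f' = N f.
  apply: eq_big_nat => l /andP[jl lk].
  by rewrite /f' !ifF // gtn_eqF // (ltn_trans ij).
have -> : f' i = f j by rewrite /f' eqxx.
have -> : f' j = f i by rewrite /f' eqxx gtn_eqF.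
rewrite -mulNr -mulrN; congr (_ * _ * _).
(* Moving either factor across M costs the same sign. *)
rewrite !ext_prod_comm -!presented_scaleAl -!mulrA ext_anticomm.
by rewrite mulrN scalerN.
Qed.

Lemma ext_prod_permuted k (x : 'I_k -> V) (s : 'S_k) :
  \prod_(0 <= l < k) e (permuted x s l) =
  (-1) ^+ s *: \prod_(0 <= l < k) e (permuted x 1 l).
Proof.
have tp (i j : 'I_k) (t : 'S_k) : i != j ->
    \prod_(0 <= l < k) e (permuted x (tperm i j * t) l) =
    - \prod_(0 <= l < k) e (permuted x t l).
  wlog ij : i j / (i < j)%N => [ih|].
    move=> ij; have [/ih/(_ ij)//|ji] := ltnP i j.
    by rewrite tpermC ih // 1?eq_sym // ltn_neqAle ji andbT eq_sym.
  move=> _; rewrite -(@ext_prod_swap k i j) ?ij ?ltn_ord //.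
  by apply: eq_bigr => l _; rewrite permuted_tperm.
have [ts -> ts_ok] := prod_tpermP s.
elim: ts ts_ok => [|[i j] ts IHts] /=; first by rewrite big_nil odd_perm1 scale1r.
move=> /andP[ij /IHts E]; rewrite big_cons tp //= E odd_permM odd_tperm.
by rewrite ij signr_addb expr1 mulN1r scaleNr.
Qed.
End Alternation.

(** * The Chevalley map on skew-symmetric tensors *)

Section Chevalley.
Variables (K : fieldType) (V : lmodType K) (B : V -> V -> K).
Local Notation c := (generator (clifford_rel B)).
Local Notation e := (generator (exterior_rel (V := V))).
Local Notation Cl := (clifford B).
Local Notation Lam := (exterior V).
Local Notation contract := (Defs.contract B).
Local Notation quantize := (@quantize K V B).
Local Notation cl_contract := (@cl_contract K V B).

Hypothesis char0 : forall n, n.+1%:R != 0 :> K.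
Let two := char0 1.
Hypothesis Bl : forall y, linear_for *%R (B^~ y).
Hypothesis Br : forall x, linear_for *%R (B x).
Hypothesis Bsym : forall x y, B x y = B y x.
Local Notation half := (2%:R^-1 : K).

Lemma contract_prod a m n (f : nat -> V) :
  contract a (\prod_(m <= i < n) e (f i)) =
  \sum_(m <= j < n) ((-1) ^+ (j - m) * B a (f j)) *:
    \prod_(m <= i < n | i != j) e (f i).
Proof.
have [nm|] := leqP n m; first by rewrite !big_geq // contract1.
move def_d: (n - m)%N => d; elim: d m def_d => [|d IHd] m.
  by move/eqP; rewrite subn_eq0 leqNgt => /negPf ->.
move=> nmd mn; rewrite big_ltn // contractM // [in RHS]big_ltn //.
rewrite subnn mul1r (big_ltn_cond mn) eqxx /=; congr (_ + _).
  congr (_ *: _); rewrite big_nat_cond [RHS]big_nat_cond; apply: eq_bigl => i.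
  by case: ltnP => //= mi; rewrite (gtn_eqF mi).
have [nm1|mn1] := leqP n m.+1.
  by rewrite [in LHS]big_geq // contract1 // mulr0 oppr0 big_geq.
rewrite IHd // ?subnS ?nmd // (lin_sum (mull_linear _)) -sumrN.
apply: eq_big_nat => j /andP[mj jn].
rewrite -presented_scaleAr (big_ltn_cond mn) (ltn_eqF mj) /= -scaleNr.
by rewrite -mulNr -mulN1r -exprS -subSn.
Qed.

(** In the interpolating sums F n, the first n factors are multiplied in the
    Clifford algebra and the others in the exterior algebra. Passing from n to
    n+1 costs contractions of the entry n with a later entry j, and these are
    invariant under exchanging the two entries because the form is symmetric, so
    they cancel in the alternating sum. *)
Lemma alternating_quantize k (x : 'I_k -> V) :
  \sum_(s : 'S_k) (-1) ^+ s *: \prod_(0 <= l < k) c (permuted x s l) =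
  quantize (\sum_(s : 'S_k) (-1) ^+ s *: \prod_(0 <= l < k) e (permuted x s l)).
Proof.
pose F n := \sum_(s : 'S_k) (-1) ^+ s *:
  ((\prod_(0 <= l < n) c (permuted x s l)) *
   quantize (\prod_(n <= l < k) e (permuted x s l)) : Cl).
have lq : linear quantize by exact: quantize_lin.
have -> : quantize (\sum_(s : 'S_k) (-1) ^+ s *:
    \prod_(0 <= l < k) e (permuted x s l)) = F 0%N.
  rewrite (lin_sum lq); apply: eq_bigr => s _.
  by rewrite (linZ lq) [in RHS]big_geq // mul1r.
have -> : \sum_(s : 'S_k) (-1) ^+ s *: \prod_(0 <= l < k) c (permuted x s l) = F k.
  by apply: eq_bigr => s _; rewrite [X in quantize X]big_geq // quantize1 // mulr1.
have step n : (n < k)%N -> F n.+1 = F n.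
  move=> nk; apply/eqP; rewrite eq_sym -subr_eq0 -sumrB; apply/eqP.
  pose G j s : Cl := (\prod_(0 <= l < n) c (permuted x s l)) *
    ((- half * ((-1) ^+ (j - n.+1) * B (permuted x s n) (permuted x s j))) *:
      quantize (\prod_(n.+1 <= i < k | i != j) e (permuted x s i))).
  transitivity (\sum_(s : 'S_k) \sum_(n.+1 <= j < k) (-1) ^+ s *: G j s).
    apply: eq_bigr => s _; rewrite -scalerBr -scaler_sumr; congr (_ *: _).
    rewrite big_nat_recr //= -mulrA -mulrBr /G -mulr_sumr; congr (_ * _).
    rewrite big_ltn // quantizeM // -quantize_contract // contract_prod.
    rewrite addrAC subrr add0r (lin_sum lq) scaler_sumr -sumrN.
    by apply: eq_bigr => j _; rewrite (linZ lq) scalerA mulNr scaleNr.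
  rewrite exchange_big /= big_nat_cond; apply: big1 => j /andP[/andP[nj jk] _].
  pose i0 := Ordinal nk; pose j0 := Ordinal jk.
  have ij : i0 != j0 by rewrite -val_eqE /= ltn_eqF.
  apply: (sum_sign_invariant two ij) => s.
  rewrite /G !permuted_tperm /= eqxx (gtn_eqF nj) eqxx Bsym; congr (_ * _).
    apply: eq_big_nat => l /andP[_ ln].
    by rewrite permuted_tperm /= (ltn_eqF ln) (ltn_eqF (ltn_trans ln nj)).
  congr (_ *: quantize _); rewrite big_nat_cond [RHS]big_nat_cond.
  apply: eq_bigr => l /andP[/andP[nl _] lj].
  by rewrite permuted_tperm /= (gtn_eqF nl) (negPf lj).
suff E n : (n <= k)%N -> F n = F 0%N by exact: E.
by elim: n => // n IHn nk; rewrite step // IHn // ltnW.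
Qed.

Lemma skew_prodE (S : set (free_algebra K V)) k (x : 'I_k -> V) :
  linear_rel (V := V) `<=` S ->
  of_tensor S (\sum_(s : 'S_k) (-1) ^+ s *:
     \prod_(i < k) generator (linear_rel (V := V)) (x (s i))) =
  \sum_(s : 'S_k) (-1) ^+ s *: \prod_(0 <= l < k) generator S (permuted x s l).
Proof.
move=> SS; have lt := of_tensor_lin SS.
rewrite (lin_sum lt); apply: eq_bigr => s _; rewrite (linZ lt) of_tensor_prod //.
by rewrite big_mkord; congr (_ *: _); apply: eq_bigr => i _; rewrite permutedE.
Qed.

Lemma skew_quantize t : skew_tensor t ->
  of_tensor (clifford_rel B) t = quantize (of_tensor (exterior_rel (V := V)) t).
Proof.
have lcS : linear_rel (V := V) `<=` clifford_rel B by move=> r; left.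
have leS : linear_rel (V := V) `<=` exterior_rel (V := V) by move=> r; left.
have [lc le] := (of_tensor_lin lcS, of_tensor_lin leS).
have lq : linear quantize by exact: quantize_lin.
elim=> [k x||a t1 t2 _ IH1 _ IH2].
- by rewrite !skew_prodE // alternating_quantize.
- by rewrite (lin0 lc) (lin0 le) (lin0 lq).
- by rewrite lc le lq IH1 IH2.
Qed.

(** Exterior monomials alternate, so a monomial of degree k is the image of 1/k!
    times its alternating sum. *)
Lemma skew_exists (w : Lam) :
  exists2 t, skew_tensor t & of_tensor (exterior_rel (V := V)) t = w.
Proof.
have leS : linear_rel (V := V) `<=` exterior_rel (V := V) by move=> r; left.
have le := of_tensor_lin leS.
move: w; apply: presented_word_ind => [|a u v [t ? <-] [t' ? <-]|s].
- by exists 0; [exact: Skew0 | exact: (lin0 le)].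
- by exists (a *: t + t'); [exact: SkewL | exact: le].
pose x (i : 'I_(size s)) := tnth (in_tuple s) i.
pose t := \sum_(p : 'S_(size s)) (-1) ^+ p *:
     \prod_(i < size s) generator (linear_rel (V := V)) (x (p i)).
have f0 : (size s)`!%:R != 0 :> K by case: (size s)`! (fact_gt0 (size s)).
exists ((size s)`!%:R^-1 *: t + 0); first exact: SkewL (SkewAlt _) (@Skew0 _ _).
rewrite addr0 (linZ le) skew_prodE //.
under eq_bigr do rewrite ext_prod_permuted scalerA -signr_addb addbb scale1r.
rewrite sumr_const card_Sn -scaler_nat scalerA mulVf // scale1r.
rewrite pproj_word [RHS]big_tnth [LHS]big_mkord; apply: eq_bigr => i _.
by rewrite permutedE perm1.
Qed.

Lemma chevalley_relE w u : chevalley_rel (B := B) w u <-> u = quantize w.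
Proof.
split=> [[t skt [<- <-]]|->]; first exact: skew_quantize.
by have [t skt tw] := skew_exists w; exists t => //; rewrite skew_quantize // tw.
Qed.

Lemma chevalleyE w : chevalley B w = quantize w.
Proof.
rewrite /chevalley; case: xgetP => [u _ /chevalley_relE//|].
by move=> /(_ (quantize w)) []; apply/chevalley_relE.
Qed.

Lemma symbolE (u : Cl) : symbol u = cl_symbol u.
Proof.
rewrite /symbol; case: xgetP => [w _ /chevalley_relE ->|].
  by rewrite quantizeK.
by move=> /(_ (cl_symbol u)) []; apply/chevalley_relE; rewrite cl_symbolK.
Qed.

(** The Chevalley map and the symbol are mutually inverse and intertwine the
    contraction of the exterior algebra with the supercommutator. *)
Lemma clifford_contractE a u : clifford_contract a u = cl_contract a u.
Proof.
by rewrite /clifford_contract chevalleyE symbolE quantize_contract // cl_symbolK.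
Qed.

End Chevalley.

(** * Functoriality and the kernel of the contractions *)

Section Functoriality.
Variables (K : fieldType) (V W : lmodType K) (f : V -> W).
Hypothesis f_lin : linear f.
Local Notation eV := (generator (exterior_rel (V := V))).
Local Notation eW := (generator (exterior_rel (V := W))).

Lemma ext_map_rel r : exterior_rel r -> forall u : exterior W,
  free_act (fun x u => eW (f x) * u) r u = 0.
Proof.
apply: ext_act_rel => [u k x y|x u]; first by rewrite f_lin ext_linear mulr_linear.
by rewrite mulrA ext_sq mul0r.
Qed.

Definition ext_map : exterior V -> exterior W := presented_map (@exterior_rel K W) f.

Lemma ext_map_lin : linear ext_map.
Proof. exact: presented_map_lin ext_map_rel. Qed.
Lemma ext_map1 : ext_map 1 = 1.
Proof. exact: presented_map1 ext_map_rel. Qed.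
Lemma ext_mapM x u : ext_map (eV x * u) = eW (f x) * ext_map u.
Proof. exact: presented_map_genM ext_map_rel x u. Qed.

Section Isometry.
Variables (BV : V -> V -> K) (BW : W -> W -> K).
Hypothesis two : 2%:R != 0 :> K.
Hypothesis Vl : forall y, linear_for *%R (BV^~ y).
Hypothesis Vr : forall x, linear_for *%R (BV x).
Hypothesis Vsym : forall x y, BV x y = BV y x.
Hypothesis Wl : forall y, linear_for *%R (BW^~ y).
Hypothesis Wr : forall x, linear_for *%R (BW x).
Hypothesis Wsym : forall x y, BW x y = BW y x.
Hypothesis f_iso : forall x y, BW (f x) (f y) = BV x y.
Local Notation cV := (generator (clifford_rel BV)).
Local Notation cW := (generator (clifford_rel BW)).
Local Notation cl_map := (presented_map (clifford_rel BW) f : clifford BV -> clifford BW).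

Lemma cl_map_rel r : clifford_rel BV r -> forall u : clifford BW,
  free_act (fun x u => cW (f x) * u) r u = 0.
Proof.
apply: cliff_act_rel => // [u k x y|x u].
  by rewrite f_lin cliff_linear mulr_linear.
by rewrite mulrA cliff_sq // f_iso -presented_scaleAl mul1r.
Qed.

Lemma cl_map_lin : linear cl_map.
Proof. exact: presented_map_lin cl_map_rel. Qed.
Lemma cl_map1 : cl_map 1 = 1.
Proof. exact: presented_map1 cl_map_rel. Qed.
Lemma cl_map_gen x : cl_map (cV x) = cW (f x).
Proof. exact: presented_map_gen cl_map_rel x. Qed.
Lemma cl_map_genM x u : cl_map (cV x * u) = cW (f x) * cl_map u.
Proof. exact: presented_map_genM cl_map_rel x u. Qed.
Lemma cl_mapM u v : cl_map (u * v) = cl_map u * cl_map v.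
Proof. exact: presented_mapM cl_map_rel u v. Qed.

Lemma cl_map_parity u : cl_map (clifford_parity u) = clifford_parity (cl_map u).
Proof.
move: u; apply: presented_ind => [|k u v IHu IHv|x u IHu].
- by rewrite parity1 // cl_map1 parity1.
- by rewrite parity_lin // !cl_map_lin parity_lin // IHu IHv.
rewrite parity_genM // (linN cl_map_lin) cl_map_genM IHu.
by rewrite -parity_genM // -cl_map_genM.
Qed.

Lemma cl_map_contract a u :
  cl_map (cl_contract a u) = cl_contract (f a) (cl_map u).
Proof.
by rewrite !cl_contract.unlock (linB cl_map_lin) !cl_mapM cl_map_gen cl_map_parity.
Qed.

Lemma cl_map_quantize w : cl_map (quantize BV w) = quantize BW (ext_map w).
Proof.
move: w; apply: presented_ind => [|k u v IHu IHv|x u IHu].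
- by rewrite quantize1 // cl_map1 ext_map1 quantize1.
- by rewrite quantize_lin // cl_map_lin ext_map_lin quantize_lin // IHu IHv.
rewrite quantizeM // (linB cl_map_lin) (linZ cl_map_lin) cl_map_genM.
by rewrite cl_map_contract IHu ext_mapM quantizeM.
Qed.

Lemma cl_map_symbol u : cl_symbol (cl_map u) = ext_map (cl_symbol u).
Proof. by rewrite -{1}[u]cl_symbolK // cl_map_quantize quantizeK. Qed.

End Isometry.
End Functoriality.

Section FunctorialityComp.
Variables (K : fieldType).

Lemma ext_map_comp (U V W : lmodType K) (f : U -> V) (h : V -> W) :
  linear f -> linear h -> forall w, ext_map h (ext_map f w) = ext_map (h \o f) w.
Proof.
move=> lf lh; have lhf : linear (h \o f) by move=> k u v; rewrite /= lf lh.
apply: presented_ind => [|k u v IHu IHv|x u IHu].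
- by rewrite !ext_map1.
- by rewrite !ext_map_lin // IHu IHv.
by rewrite !ext_mapM // IHu.
Qed.

Lemma ext_map_id (V : lmodType K) w : ext_map (idfun : V -> V) w = w.
Proof.
have li : linear (idfun : V -> V) by [].
move: w; apply: presented_ind => [|k u v IHu IHv|x u IHu].
- by rewrite !ext_map1.
- by rewrite !ext_map_lin // IHu IHv.
by rewrite !ext_mapM // IHu.
Qed.

Lemma eq_ext_map (V W : lmodType K) (f h : V -> W) :
  f =1 h -> ext_map f =1 ext_map h.
Proof. by move/funext ->. Qed.

End FunctorialityComp.

Section Horizontal.
Variables (K : fieldType) (V : lmodType K) (B : V -> V -> K).
Hypothesis two : 2%:R != 0 :> K.
Hypothesis Bl : forall y, linear_for *%R (B^~ y).
Hypothesis Br : forall x, linear_for *%R (B x).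
Hypothesis Bsym : forall x y, B x y = B y x.
Local Notation e := (generator (exterior_rel (V := V))).

(** When B a b = 1, this is the projection along b onto the orthogonal of a. *)
Definition drop_comp (a b x : V) : V := x - B a x *: b.

Lemma drop_comp_lin a b : linear (drop_comp a b).
Proof.
by move=> k x y; rewrite /drop_comp Br scalerDl opprD addrACA scalerBr scalerA.
Qed.

(** By induction on words: in the product of x - <a,x>b and w - b/\i_a w the term
    with two factors b vanishes. In particular the kernel of i_a is fixed. *)
Lemma ext_map_drop a b w :
  ext_map (drop_comp a b) w = w - e b * Defs.contract B a w.
Proof.
have ld := drop_comp_lin a b.
move: w; apply: presented_ind => [|k u v IHu IHv|x u IHu].
- by rewrite ext_map1 // contract1 // mulr0 subr0.
- rewrite ext_map_lin // IHu IHv contract_lin // mull_linear opprD addrACA.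
  by rewrite scalerBr.
rewrite ext_mapM // IHu contractM // /drop_comp (linB (@ext_linear _ _)).
rewrite (linZ (@ext_linear _ _)) !mulrBr !mulrBl -!presented_scaleAl !mulrA ext_sq.
rewrite mul0r scaler0 subr0 (ext_anticomm x b) mulNr opprK -presented_scaleAr.
by rewrite opprB addrA [in RHS]addrAC.
Qed.

End Horizontal.

Section HorizontalTensor.
Variables (K : fieldType) (X : choiceType) (S : set (free_algebra K X)).
Variables (V W : lmodType K) (B : V -> V -> K) (BW : W -> W -> K).
Hypothesis two : 2%:R != 0 :> K.
Hypothesis Bl : forall y, linear_for *%R (B^~ y).
Hypothesis Br : forall x, linear_for *%R (B x).
Hypothesis Bsym : forall x y, B x y = B y x.
Hypothesis Wl : forall y, linear_for *%R (BW^~ y).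
Hypothesis Wr : forall x, linear_for *%R (BW x).
Hypothesis Wsym : forall x y, BW x y = BW y x.
Variables (j : W -> V) (pr : V -> W).
Hypotheses (j_lin : linear j) (pr_lin : linear pr).
Hypothesis j_iso : forall x y, B (j x) (j y) = BW x y.
Hypothesis prK : forall x, pr (j x) = x.
Local Notation cl_map := (presented_map (clifford_rel B) j : clifford BW -> clifford B).
Local Notation Theta := (tensor_map (idfun : presented S -> presented S) cl_map).

(** The projection pr need not be an isometry and then does not act on Clifford
    algebras; it does act on exterior algebras, and the Chevalley maps transport this. *)
Definition cl_retract (u : clifford B) : clifford BW :=
  quantize BW (ext_map pr (cl_symbol u)).

Lemma cl_retract_lin : linear cl_retract.
Proof.
move=> k u v; rewrite /cl_retract cl_symbol_lin // ext_map_lin //.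
by rewrite quantize_lin.
Qed.

Lemma cl_mapK u : cl_retract (cl_map u) = u.
Proof.
rewrite /cl_retract (@cl_map_symbol _ _ _ _ _ BW) // ext_map_comp //.
rewrite (@eq_ext_map _ _ _ (pr \o j) idfun) ?ext_map_id ?cl_symbolK //.
Qed.

Lemma tensor_cl_mapK w : tensor_map idfun cl_retract (Theta w) = w.
Proof.
have li : linear (idfun : presented S -> presented S) by [].
have lj : linear cl_map by exact: cl_map_lin.
have lr := cl_retract_lin.
rewrite -[LHS]/((tensor_map idfun cl_retract \o Theta) w) tensor_map_comp //.
rewrite (_ : tensor_map _ _ = tensor_map idfun idfun) ?tensor_map_id //.
by congr tensor_map; apply: funext => u /=; rewrite cl_mapK.
Qed.

(** By [ext_map_drop], each projection along b orthogonally to a acts on the tensor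
    product as the identity minus a map that factors through the contraction by
    a. *)
Lemma horizontal_fix (s : seq (V * V)) (w : tensor_product S (clifford_rel B)) :
  (forall ab, ab \in s -> tensor_map idfun (cl_contract ab.1) w = 0) ->
  tensor_map idfun (fun u => quantize B (ext_map
    (foldr (fun ab f => drop_comp B ab.1 ab.2 \o f) id s) (cl_symbol u))) w = w.
Proof.
have li : linear (idfun : presented S -> presented S) by [].
have lq : linear (quantize B) by exact: quantize_lin.
have ls : linear (@cl_symbol _ _ B) by exact: cl_symbol_lin.
elim: s => [_|[a b] s IHs ws] /=.
  rewrite (_ : (fun u => _) = idfun) ?tensor_map_id //.
  by apply: funext => u; rewrite ext_map_id cl_symbolK.
set f := foldr _ _ _ in IHs *.
have lf : linear f.
  rewrite /f; elim: (s) => [//|ab s' IHs' k x y] /=.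
  by rewrite IHs' drop_comp_lin.
have {}IHs := IHs (fun ab abs => ws ab (mem_behead (s := (a, b) :: s) abs)).
have ld := @drop_comp_lin _ _ B Br a b.
pose Q (h : V -> V) (u : clifford B) := quantize B (ext_map h (cl_symbol u)).
have lQ h : linear h -> linear (Q h).
  by move=> lh k u v; rewrite /Q ls ext_map_lin // lq.
rewrite (_ : (fun u => _) = Q (drop_comp B a b) \o Q f); last first.
  by apply: funext => u; rewrite /Q /= quantizeK // ext_map_comp.
rewrite -[LHS]/(tensor_map (idfun \o idfun) _ w) -tensor_map_comp //; try exact: lQ.
rewrite /= IHs.
pose M (u : clifford B) := quantize B (generator _ b * cl_symbol u).
have lM : linear M by move=> k u v; rewrite /M ls mull_linear lq.
have lc : linear (@cl_contract K V B a) by exact: cl_contract_lin.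
have E v : tensor_map idfun (Q (drop_comp B a b)) v =
    v - tensor_map idfun M (tensor_map idfun (cl_contract a) v).
  move: v; apply: tensor_lin_eq => [||x u].
  - by apply: tensor_map_lin => //; exact: lQ.
  - move=> k u v; rewrite !tensor_map_lin // opprD addrACA.
    by rewrite scalerBr.
  rewrite !tensor_mapE //; last exact: lQ.
  rewrite -(linB (tensor_linr _)); congr tensor.
  by rewrite /Q /M ext_map_drop // (linB lq) cl_symbolK // symbol_contract.
rewrite E (ws (a, b)) ?mem_head // (lin0 (tensor_map_lin _ _)) ?subr0 //.
Qed.

(** The composite of the projections is j o pr, so the endomorphism that fixes w
    factors through Cl(W). *)
Lemma horizontal_image (s : seq (V * V)) (w : tensor_product S (clifford_rel B)) :
  foldr (fun ab f => drop_comp B ab.1 ab.2 \o f) id s =1 j \o pr ->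
  (forall ab, ab \in s -> tensor_map idfun (cl_contract ab.1) w = 0) ->
  w = Theta (tensor_map idfun cl_retract w).
Proof.
move=> sE /horizontal_fix; rewrite (funext sE) => {1}<-.
have li : linear (idfun : presented S -> presented S) by [].
have lj : linear cl_map by exact: cl_map_lin.
have lr := cl_retract_lin.
rewrite -[RHS]/((Theta \o tensor_map idfun cl_retract) w) tensor_map_comp //.
rewrite /=; congr (tensor_map _ _ w); apply: funext => u /=.
rewrite /cl_retract (@cl_map_quantize _ _ _ _ j_lin BW) //.
by rewrite ext_map_comp.
Qed.

End HorizontalTensor.

(** * The Cartan form in the Clifford algebra *)

Section Antisymmetric.
Variables (K : fieldType) (U : lmodType K).
Hypothesis two : 2%:R != 0 :> K.

Lemma sum_antisym m (F : 'I_m -> 'I_m -> U) :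
  (forall i k, F i k = - F k i) -> \sum_i \sum_k F i k = 0.
Proof.
move=> F_anti; apply: (eqN_eq0 two); rewrite {1}exchange_big -sumrN.
by apply: eq_bigr => i _; rewrite -sumrN; apply: eq_bigr.
Qed.
End Antisymmetric.

Section Cartan.
Variables (K : fieldType) (g W : lmodType K).
Variables (br : g -> g -> g) (B : g -> g -> K) (j : W -> g).
Hypothesis two : 2%:R != 0 :> K.
Hypothesis Bl : forall y, linear_for *%R (B^~ y).
Hypothesis Br : forall x, linear_for *%R (B x).
Hypothesis Bsym : forall x y, B x y = B y x.
Hypothesis brN : forall x y, br x y = - br y x.
Hypothesis Binv : forall x y z, B (br x y) z = - B y (br x z).
Hypothesis j_lin : linear j.
Local Notation BW := (pullback_form B j).
Local Notation c := (generator (clifford_rel BW)).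
Local Notation e := (generator (exterior_rel (V := W))).

Lemma form_oppl x y : B (- x) y = - B x y.
Proof.
have B0 : B 0 y = 0 by have := Bl y (-1) 0 0; rewrite scaler0 addr0 mulN1r addNr.
by rewrite -[- x]addr0 -scaleN1r Bl B0 mulN1r addr0.
Qed.
Lemma form_oppr x y : B x (- y) = - B x y.
Proof. by rewrite Bsym form_oppl Bsym. Qed.

Lemma cartan_swap12 x y z : B x (br y z) = - B y (br x z).
Proof. by rewrite -[LHS]opprK -(Binv y x z) (brN y x) form_oppl opprK Binv. Qed.
Lemma cartan_swap23 x y z : B x (br y z) = - B x (br z y).
Proof. by rewrite brN form_oppr. Qed.

Lemma pullback_linearl y : linear_for *%R (BW^~ y).
Proof. by move=> k u v; rewrite /pullback_form j_lin Bl. Qed.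
Lemma pullback_linearr x : linear_for *%R (BW x).
Proof. by move=> k u v; rewrite /pullback_form j_lin Br. Qed.
Lemma pullback_sym x y : BW x y = BW y x.
Proof. exact: Bsym. Qed.

Lemma quantize_gen x : quantize BW (e x) = c x.
Proof.
have [[Wl Wr] Ws] := (pullback_linearl, pullback_linearr, pullback_sym).
by rewrite -[e x]mulr1 quantizeM // quantize1 // cl_contract1 // scaler0 subr0 mulr1.
Qed.

Lemma quantize2 x y : quantize BW (e x * e y) =
  c x * c y - (2%:R^-1 * BW x y) *: (1 : clifford BW).
Proof.
have [[Wl Wr] Ws] := (pullback_linearl, pullback_linearr, pullback_sym).
rewrite quantizeM // quantize_gen -[X in cl_contract _ X]mulr1 cl_contractM //.
by rewrite cl_contract1 // mulr0 subr0 scalerA.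
Qed.

Lemma quantize3 x y z : quantize BW (e x * (e y * e z)) =
  c x * (c y * c z) - ((2%:R^-1 * BW y z) *: c x
    + ((2%:R^-1 * BW x y) *: c z - (2%:R^-1 * BW x z) *: c y)).
Proof.
have [[Wl Wr] Ws] := (pullback_linearl, pullback_linearr, pullback_sym).
rewrite quantizeM // quantize2 (linB (cl_contract_lin _ _)) //.
rewrite (linZ (cl_contract_lin _ _)) // cl_contract1 // scaler0 subr0.
have -> : c z = c z * 1 by rewrite mulr1.
rewrite !cl_contractM //.
rewrite cl_contract1 // mulr0 subr0 mulrBr -!presented_scaleAr !mulr1.
by rewrite scalerBr !scalerA !opprD !addrA.
Qed.

Section Families.
Variables (m : nat) (p q : 'I_m -> W).
Local Notation f i k l := (B (j (p i)) (br (j (p k)) (j (p l)))).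

(** Each correction term of [quantize3] pairs the symmetric form with two
    arguments in which the Cartan form is antisymmetric. *)
Lemma cartan_quantize : quantize BW (\sum_i \sum_k \sum_l
    f i k l *: (e (q i) * e (q k) * e (q l))) =
  \sum_i \sum_k \sum_l f i k l *: (c (q i) * c (q k) * c (q l)).
Proof.
have [[Wl Wr] Ws] := (pullback_linearl, pullback_linearr, pullback_sym).
have lq : linear (quantize BW) by exact: quantize_lin.
pose h i k := 2%:R^-1 * BW (q i) (q k).
have hC i k : h i k = h k i by rewrite /h Ws.
transitivity (\sum_i \sum_k \sum_l (f i k l *: (c (q i) * c (q k) * c (q l)) -
    (f i k l *: (h k l *: c (q i)) +
      (f i k l *: (h i k *: c (q l)) - f i k l *: (h i l *: c (q k)))))).
  rewrite (lin_sum lq); apply: eq_bigr => i _; rewrite (lin_sum lq).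
  apply: eq_bigr => k _; rewrite (lin_sum lq); apply: eq_bigr => l _.
  by rewrite (linZ lq) -!mulrA quantize3 !(scalerBr, scalerDr).
have split3 (F1 F2 F3 F4 : 'I_m -> 'I_m -> 'I_m -> clifford BW) :
   \sum_i \sum_k \sum_l (F1 i k l - (F2 i k l + (F3 i k l - F4 i k l))) =
   \sum_i \sum_k \sum_l F1 i k l - (\sum_i \sum_k \sum_l F2 i k l +
    (\sum_i \sum_k \sum_l F3 i k l - \sum_i \sum_k \sum_l F4 i k l)).
  rewrite -sumrB -big_split -sumrB; apply: eq_bigr => i _ /=.
  rewrite -sumrB -big_split -sumrB; apply: eq_bigr => k _ /=.
  by rewrite -sumrB -big_split -sumrB.
rewrite split3.
have -> : \sum_i \sum_k \sum_l f i k l *: (h k l *: c (q i)) = 0.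
  apply: big1 => i _; apply: (sum_antisym two) => k l.
  by rewrite cartan_swap23 hC scaleNr.
have -> : \sum_i \sum_k \sum_l f i k l *: (h i k *: c (q l)) = 0.
  under eq_bigr do rewrite exchange_big; rewrite exchange_big.
  apply: big1 => l _; apply: (sum_antisym two) => i k.
  by rewrite cartan_swap12 hC scaleNr.
have -> : \sum_i \sum_k \sum_l f i k l *: (h i l *: c (q k)) = 0.
  rewrite exchange_big; apply: big1 => k _; apply: (sum_antisym two) => i l.
  rewrite cartan_swap12 cartan_swap23 opprK cartan_swap12.
  by rewrite hC scaleNr.
by rewrite !subr0 addr0 subr0.
Qed.
End Families.
End Cartan.

(** * Decomposition of the cubic Dirac operator *)

Section DualSum.
Variables (K : fieldType) (g U : lmodType K) (B : g -> g -> K).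
Variables (I J : finType) (a b : I -> g) (a' b' : J -> g) (Phi : g -> g -> U).

(** Expand each a_i in the family a', exchange the sums, and recognise the
    expansion of b' in the family b. *)
Lemma dual_sum :
  (forall x, x = \sum_i B (a i) x *: b i) ->
  (forall x, x = \sum_i B x (b' i) *: a' i) ->
  (forall y, linear (Phi^~ y)) -> (forall x, linear (Phi x)) ->
  \sum_i Phi (a i) (b i) = \sum_i Phi (a' i) (b' i).
Proof.
move=> bE aE Pl Pr.
transitivity (\sum_i \sum_k B (a i) (b' k) *: Phi (a' k) (b i)).
  apply: eq_bigr => i _; rewrite [X in Phi X _]aE (lin_sum (Pl _)).
  by apply: eq_bigr => k _; rewrite (linZ (Pl _)).
rewrite exchange_big; apply: eq_bigr => k _; rewrite [X in _ = Phi _ X]bE.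
by rewrite (lin_sum (Pr _)); apply: eq_bigr => i _; rewrite (linZ (Pr _)).
Qed.

End DualSum.

Section CubicSum.
Variables (K : fieldType) (g W : lmodType K).
Variables (br : g -> g -> g) (B : g -> g -> K) (j : W -> g).
Hypothesis Bl : forall y, linear_for *%R (B^~ y).
Hypothesis Br : forall x, linear_for *%R (B x).
Hypothesis brl : forall y, linear (br^~ y).
Hypothesis brr : forall x, linear (br x).
Hypothesis j_lin : linear j.
Local Notation BW := (pullback_form B j).
Local Notation c := (generator (clifford_rel BW)).

Definition cubic_sum (I J L : finType) (a1 : I -> g) (b1 : I -> W) (a2 : J -> g)
    (b2 : J -> W) (a3 : L -> g) (b3 : L -> W) : clifford BW :=
  \sum_i \sum_k \sum_l
    B (a1 i) (br (a2 k) (a3 l)) *: (c (b1 i) * c (b2 k) * c (b3 l)).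

Lemma cubic_sum_dual (I J : finType) (a b : I -> W) (a' b' : J -> W) :
  (forall x, x = \sum_i BW (a i) x *: b i) ->
  (forall x, x = \sum_i BW x (b' i) *: a' i) ->
  cubic_sum (j \o a) b (j \o a) b (j \o a) b =
  cubic_sum (j \o a') b' (j \o a') b' (j \o a') b'.
Proof.
move=> bE aE; have lc : linear c by exact: cliff_linear.
rewrite /cubic_sum /=.
transitivity (\sum_i \sum_k \sum_l
    B (j (a' i)) (br (j (a k)) (j (a l))) *: (c (b' i) * c (b k) * c (b l))).
  apply: (dual_sum (Phi := fun x y => \sum_k \sum_l
    B (j x) (br (j (a k)) (j (a l))) *: (c y * c (b k) * c (b l))) bE aE).
  - move=> y t x x'; rewrite scaler_sumr -big_split; apply: eq_bigr => k' _ /=.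
    rewrite scaler_sumr -big_split; apply: eq_bigr => l' _ /=.
    by rewrite j_lin Bl scalerDl scalerA.
  - move=> x t y y'; rewrite scaler_sumr -big_split; apply: eq_bigr => k' _ /=.
    rewrite scaler_sumr -big_split; apply: eq_bigr => l' _ /=.
    by rewrite lc !mulr_linear scalerDr !scalerA mulrC.
apply: eq_bigr => i _.
transitivity (\sum_k \sum_l
    B (j (a' i)) (br (j (a' k)) (j (a l))) *: (c (b' i) * c (b' k) * c (b l))).
  apply: (dual_sum (Phi := fun x y => \sum_l
    B (j (a' i)) (br (j x) (j (a l))) *: (c (b' i) * c y * c (b l))) bE aE).
  - move=> y t x x'; rewrite scaler_sumr -big_split; apply: eq_bigr => l' _ /=.
    by rewrite j_lin brl Br scalerDl scalerA.
  - move=> x t y y'; rewrite scaler_sumr -big_split; apply: eq_bigr => l' _ /=.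
    by rewrite lc mull_linear !mulr_linear scalerDr !scalerA mulrC.
apply: eq_bigr => k' _.
apply: (dual_sum (Phi := fun x y =>
    B (j (a' i)) (br (j (a' k')) (j x)) *: (c (b' i) * c (b' k') * c y)) bE aE).
- by move=> y t x x'; rewrite j_lin brr Br scalerDl scalerA.
- by move=> x t y y'; rewrite lc mull_linear scalerDr !scalerA mulrC.
Qed.

End CubicSum.

Section CubicDirac.
Variables (K : fieldType) (g W : lmodType K).
Variables (br : g -> g -> g) (B : g -> g -> K) (j : W -> g).
Hypothesis char0 : forall n, n.+1%:R != 0 :> K.
Let two := char0 1.
Hypothesis Bl : forall y, linear_for *%R (B^~ y).
Hypothesis Br : forall x, linear_for *%R (B x).
Hypothesis Bsym : forall x y, B x y = B y x.
Hypothesis brN : forall x y, br x y = - br y x.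
Hypothesis Binv : forall x y z, B (br x y) z = - B y (br x z).
Hypothesis j_lin : linear j.
Local Notation BW := (pullback_form B j).
Local Notation c := (generator (clifford_rel BW)).
Local Notation u := (generator (enveloping_rel br)).

Lemma cubic_diracE m (p q : m.-tuple W) :
  cubic_dirac br B j p q =
  \sum_(i < m) tensor (u (j (tnth p i))) (c (tnth q i))
  - tensor 1 (6%:R^-1 *: cubic_sum br B j
      (fun i => j (tnth p i)) (tnth q) (fun i => j (tnth p i)) (tnth q)
      (fun i => j (tnth p i)) (tnth q)).
Proof.
rewrite /cubic_dirac /weil_tensor; congr (_ - tensor 1 _).
have [[Wl' Wr'] Ws] := (pullback_linearl Bl j_lin, pullback_linearr Br j_lin, @pullback_sym _ _ _ _ j Bsym).
have lq : linear (quantize BW) by exact: quantize_lin.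
rewrite chevalleyE // /cartan_form (linZ lq); congr (_ *: _).
by rewrite cartan_quantize.
Qed.

End CubicDirac.

Section Decomposition.
Variables (K : fieldType) (g W : lmodType K).
Variables (br : g -> g -> g) (B : g -> g -> K) (j : W -> g).
Hypothesis char0 : forall n, n.+1%:R != 0 :> K.
Let two := char0 1.
Hypothesis Bl : forall y, linear_for *%R (B^~ y).
Hypothesis Br : forall x, linear_for *%R (B x).
Hypothesis Bsym : forall x y, B x y = B y x.
Hypothesis brl : forall y, linear (br^~ y).
Hypothesis brr : forall x, linear (br x).
Hypothesis brN : forall x y, br x y = - br y x.
Hypothesis Binv : forall x y z, B (br x y) z = - B y (br x z).
Hypothesis j_lin : linear j.
Local Notation BW := (pullback_form B j).
Local Notation BG := (pullback_form B idfun).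
Local Notation c := (generator (clifford_rel BG)).
Local Notation cW := (generator (clifford_rel BW)).
Local Notation u := (generator (enveloping_rel br)).
Local Notation cl_map := (presented_map (clifford_rel BG) j : clifford BW -> clifford BG).
Local Notation Theta := (tensor_map (idfun : enveloping br -> enveloping br) cl_map).

Variables (m n k : nat) (a b : m.-tuple g) (p q : n.-tuple W) (r s : k.-tuple g).

(** The constant is fixed by [spin x, c_y] = c_[x,y] for [x,y] in W
    ([spin_commutator]). *)
Definition spin (x : g) : clifford BW :=
  - 2%:R^-1 *: \sum_l \sum_l' B x (br (j (tnth p l)) (j (tnth p l'))) *:
    (cW (tnth q l) * cW (tnth q l')).

(** The inner form of the derivative of the group action on U(g) (x) Cl(W). *)
Definition inf_action (x : g) : weil br B j := tensor (u x) 1 + tensor 1 (spin x).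

Hypothesis ab_dual : forall x, x = \sum_i B (tnth a i) x *: tnth b i.
Hypothesis pr_dual : forall x,
  x = \sum_l B x (j (tnth q l)) *: j (tnth p l) + \sum_i B x (tnth s i) *: tnth r i.
Hypothesis s_perp : forall i x, B (tnth s i) (j x) = 0.
Hypothesis prr0 : forall l i i', B (j (tnth p l)) (br (tnth r i) (tnth r i')) = 0.

Let P l := j (tnth p l).
Let Q l := j (tnth q l).
Let X (i : 'I_n + 'I_k) := match i with inl l => P l | inr l => tnth r l end.
Let Y (i : 'I_n + 'I_k) := match i with inl l => Q l | inr l => tnth s l end.

Let XYsum (U : lmodType K) (Phi : g -> g -> U) :
  (forall y, linear (Phi^~ y)) -> (forall x, linear (Phi x)) ->
  \sum_i Phi (tnth a i) (tnth b i) = \sum_i Phi (X i) (Y i).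
Proof.
by apply: dual_sum ab_dual _ => x; rewrite {1}[x]pr_dual big_sumType.
Qed.

Let BGl : forall y, linear_for *%R (BG^~ y). Proof. exact: Bl. Qed.
Let BGr : forall y, linear_for *%R (BG y). Proof. exact: Br. Qed.
Let BGs : forall x y, BG x y = BG y x. Proof. exact: Bsym. Qed.

Let cubic_XY :
  cubic_sum br B idfun (tnth a) (tnth b) (tnth a) (tnth b) (tnth a) (tnth b) =
  cubic_sum br B idfun X Y X Y X Y.
Proof.
apply: (cubic_sum_dual (W := g) (j := idfun)) => // x.
by rewrite {1}[x]pr_dual big_sumType.
Qed.

Let cs_anti i x : c (tnth s i) * c (j x) = - (c (j x) * c (tnth s i)).
Proof.
apply/eqP; rewrite -addr_eq0 cliff_anticomm // /pullback_form /= s_perp.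
by rewrite scale0r.
Qed.

Let RPP := \sum_i c (tnth s i) *
  \sum_l \sum_l' B (tnth r i) (br (P l) (P l')) *: (c (Q l) * c (Q l')).

Let swap12 x y z : B x (br y z) = - B y (br x z).
Proof. exact: (cartan_swap12 Bl brN Binv). Qed.
Let swap23 x y z : B x (br y z) = - B x (br z y).
Proof. exact: (cartan_swap23 Bl Bsym brN). Qed.

(* Blocks with two indices in r and one in p vanish because [r,r] is orthogonal
   to p; the three blocks with one index in r are equal by antisymmetry, since c_s
   anticommutes with c_y for y in p. *)
Let cubic_blocks :
  cubic_sum br B idfun X Y X Y X Y =
  cubic_sum br B idfun P Q P Q P Q + (RPP + RPP + RPP) +
  cubic_sum br B idfun (tnth r) (tnth s) (tnth r) (tnth s) (tnth r) (tnth s).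
Proof.
pose F x1 y1 x2 y2 x3 y3 := B x1 (br x2 x3) *: (c y1 * c y2 * c y3 : clifford BG).
have E1 : \sum_(i < k) \sum_(l < n) \sum_(l' < n)
    F (tnth r i) (tnth s i) (P l) (Q l) (P l') (Q l') = RPP.
  apply: eq_bigr => i _; rewrite (lin_sum (mull_linear _)); apply: eq_bigr => l _.
  rewrite (lin_sum (mull_linear _)); apply: eq_bigr => l' _.
  by rewrite -presented_scaleAr mulrA.
have E2 : \sum_(l < n) \sum_(i < k) \sum_(l' < n)
    F (P l) (Q l) (tnth r i) (tnth s i) (P l') (Q l') = RPP.
  rewrite -E1 exchange_big; apply: eq_bigr => i _; apply: eq_bigr => l _.
  apply: eq_bigr => l' _; rewrite /F swap12 cs_anti.
  by rewrite mulNr scalerN scaleNr.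
have E3 : \sum_(l < n) \sum_(l' < n) \sum_(i < k)
    F (P l) (Q l) (P l') (Q l') (tnth r i) (tnth s i) = RPP.
  rewrite -E2; apply: eq_bigr => l _; rewrite exchange_big.
  apply: eq_bigr => i _; apply: eq_bigr => l' _; rewrite /F swap23 -!mulrA cs_anti.
  by rewrite mulrN scalerN scaleNr.
have Z1 l i i' : F (P l) (Q l) (tnth r i) (tnth s i) (tnth r i') (tnth s i') = 0.
  by rewrite /F prr0 scale0r.
have Z2 i l i' : F (tnth r i) (tnth s i) (P l) (Q l) (tnth r i') (tnth s i') = 0.
  by rewrite /F swap12 prr0 oppr0 scale0r.
have Z3 i i' l : F (tnth r i) (tnth s i) (tnth r i') (tnth s i') (P l) (Q l) = 0.
  by rewrite /F swap23 swap12 prr0 !oppr0 scale0r.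
have S2 (U : nmodType) (G : 'I_n + 'I_k -> 'I_n + 'I_k -> U) : \sum_i \sum_l G i l =
    \sum_i \sum_l G (inl i) (inl l) + \sum_i \sum_l G (inl i) (inr l) +
    (\sum_i \sum_l G (inr i) (inl l) + \sum_i \sum_l G (inr i) (inr l)).
  rewrite big_sumType -!big_split.
  by congr (_ + _); apply: eq_bigr => i _; rewrite big_sumType.
rewrite /cubic_sum big_sumType /=.
under eq_bigr do rewrite S2.
under [X in _ + X]eq_bigr do rewrite S2.
rewrite !big_split /= -!/(F _ _ _ _ _ _).
rewrite /F in E1 E2 E3 Z1 Z2 Z3.
rewrite E1 E2 E3.
have zero (I J L : finType) (G : I -> J -> L -> clifford BG) :
    (forall i i' l, G i i' l = 0) -> \sum_i \sum_i' \sum_l G i i' l = 0.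
  by move=> G0; do 2 apply: big1 => ? _; apply: big1.
by rewrite (zero _ _ _ _ Z1) (zero _ _ _ _ Z2) (zero _ _ _ _ Z3) !addr0 add0r !addrA.
Qed.

Let BWl := pullback_linearl Bl j_lin.
Let BWr := pullback_linearr Br j_lin.
Let BWs : forall x y, BW x y = BW y x := pullback_sym j Bsym.

Let lj : linear cl_map.
Proof. by apply: cl_map_lin => //; exact: BWl. Qed.
Let cl_map_gen' x : cl_map (cW x) = c (j x).
Proof. by apply: cl_map_gen. Qed.
Let cl_mapM' x y : cl_map (x * y) = cl_map x * cl_map y.
Proof. by apply: cl_mapM. Qed.
Let li : linear (idfun : enveloping br -> enveloping br). Proof. by []. Qed.
Let lT : linear Theta. Proof. exact: tensor_map_lin. Qed.
Let ThetaE x y : Theta (tensor x y) = tensor x (cl_map y).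
Proof. exact: tensor_mapE. Qed.
Let ThetaM x y : Theta (x * y) = Theta x * Theta y.
Proof. exact: tensor_mapM. Qed.

Let cl_map_cubic (a' : 'I_n -> g) :
  cl_map (cubic_sum br B j a' (tnth q) a' (tnth q) a' (tnth q)) =
  cubic_sum br B idfun a' Q a' Q a' Q.
Proof.
rewrite /cubic_sum (lin_sum lj); apply: eq_bigr => i _.
rewrite (lin_sum lj); apply: eq_bigr => i' _.
rewrite (lin_sum lj); apply: eq_bigr => l _.
by rewrite (linZ lj) !cl_mapM' !cl_map_gen'.
Qed.

Let cl_map_spin x : cl_map (spin x) = - 2%:R^-1 *:
  \sum_l \sum_l' B x (br (P l) (P l')) *: (c (Q l) * c (Q l')).
Proof.
rewrite /spin (linZ lj); congr (_ *: _).
rewrite (lin_sum lj); apply: eq_bigr => l _.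
rewrite (lin_sum lj); apply: eq_bigr => l' _.
by rewrite (linZ lj) !cl_mapM' !cl_map_gen'.
Qed.

Let RRR := cubic_sum br B idfun
  (tnth r) (tnth s) (tnth r) (tnth s) (tnth r) (tnth s).

(** The three equal mixed blocks of the cubic term add up to the factor 1/2 of
    [spin], so they join the r part of the linear term. *)
Lemma dirac_decomposition :
  cubic_dirac br B idfun a b = Theta (cubic_dirac br B j p q) +
  (\sum_i tensor 1 (c (tnth s i)) * Theta (inf_action (tnth r i))
   - tensor 1 (6%:R^-1 *: RRR)).
Proof.
rewrite !cubic_diracE // cubic_XY cubic_blocks.
have -> : \sum_(i < m) tensor (u (tnth a i)) (c (tnth b i)) =
   \sum_l tensor (u (P l)) (c (Q l)) + \sum_i tensor (u (tnth r i)) (c (tnth s i)).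
  rewrite (XYsum (Phi := fun x y => tensor (u x) (c y))) ?big_sumType //.
  - by move=> y t x x'; rewrite env_linear tensor_linl.
  - by move=> x t y y'; rewrite cliff_linear tensor_linr.
rewrite (linB lT) (lin_sum lT) ThetaE (linZ lj) cl_map_cubic.
have -> : \sum_l Theta (tensor (u (j (tnth p l))) (cW (tnth q l))) =
    \sum_l tensor (u (P l)) (c (Q l)).
  by apply: eq_bigr => l _; rewrite ThetaE cl_map_gen'.
have -> : \sum_i tensor 1 (c (tnth s i)) * Theta (inf_action (tnth r i)) =
    \sum_i tensor (u (tnth r i)) (c (tnth s i)) - tensor 1 (2%:R^-1 *: RPP).
  rewrite -(linN (tensor_linr _)) -scaleNr scaler_sumr (lin_sum (tensor_linr _)) -big_split.
  apply: eq_bigr => i _ /=.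
  rewrite /inf_action (linD lT) !ThetaE mulrDr !tensorM !mul1r.
  rewrite (@cl_map1 _ _ _ j _ BW) // mulr1; congr (_ + tensor 1 _).
  by rewrite cl_map_spin -presented_scaleAr.
have l1 := @tensor_linr _ _ _ _ (clifford_rel BG) (1 : enveloping br).
rewrite !scalerDr -!scalerDl !(linD l1).
have -> : 6%:R^-1 + 6%:R^-1 + 6%:R^-1 = 2%:R^-1 :> K.
  apply: (mulfI (char0 5)); rewrite !mulrDr mulfV; last exact: (char0 5).
  by rewrite -[6%N]/(3 * 2)%N natrM mulfK // -[1 + 1]/(2%:R) natr1.
by rewrite !opprD !addrA [X in X - _ - _ = _]addrAC.
Qed.

Local Notation parT := (@weil_parity K g g br B idfun).
Let lpT : linear parT.
Proof. by apply: tensor_map_lin => //; exact: parity_lin. Qed.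
Let parTE x y : parT (tensor x y) = tensor x (clifford_parity y).
Proof. by apply: tensor_mapE => //; exact: parity_lin. Qed.
Lemma Theta_parity w : Theta (weil_parity w) = weil_parity (Theta w).
Proof.
have lp : linear (@weil_parity K g W br B j).
  by apply: tensor_map_lin => //; exact: parity_lin.
move: w; apply: tensor_lin_eq => [t x y|t x y|x y].
- by rewrite lp lT.
- by rewrite lT lpT.
rewrite {1}/weil_parity tensor_mapE //; last exact: parity_lin.
by rewrite !ThetaE parTE (@cl_map_parity _ _ _ _ _ BW).
Qed.

Let cl_contract_perp (x : g) v : (forall y, B x (j y) = 0) ->
  cl_contract x (cl_map v) = 0.
Proof.
move=> x_perp; move: v; apply: presented_ind => [|t v v' IH IH'|y v IH].
- by rewrite (@cl_map1 _ _ _ j _ BW) // cl_contract1.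
- by rewrite lj cl_contract_lin // IH IH' scaler0 addr0.
rewrite cl_mapM' cl_map_gen' cl_contractM // IH mulr0 subr0.
by rewrite /pullback_form x_perp scale0r.
Qed.

(** The supercommutator with c_x is the contraction by x, which kills the image of
    Cl(W) when x is orthogonal to W. *)
Lemma Theta_supercomm (x : g) w : (forall y, B x (j y) = 0) ->
  tensor 1 (c x) * Theta w = weil_parity (Theta w) * tensor 1 (c x).
Proof.
move=> x_perp.
have cl0 v := cl_contract_perp v x_perp.
move: w; apply: tensor_ind => [t v v' IH IH'|y v].
  by rewrite !lT mull_linear lpT mulr_linear IH IH'.
rewrite ThetaE parTE !tensorM mul1r mulr1; congr tensor.
by apply/eqP; rewrite -subr_eq0 -[X in X == _]/(_ - _) -(cl0 v) cl_contract.unlock.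
Qed.

Lemma contract_Theta (x : g) w : (forall y, B x (j y) = 0) ->
  tensor_map idfun (cl_contract x) (Theta w) = 0.
Proof.
move=> x_perp; have lc : linear (@cl_contract K g BG x) by exact: cl_contract_lin.
have cl0 v := cl_contract_perp v x_perp.
have lcT := tensor_map_lin li lc.
move: w; apply: tensor_ind => [t v v' IH IH'|y v].
  by rewrite lT lcT IH IH' scaler0 addr0.
by rewrite ThetaE tensor_mapE // cl0 (lin0 (tensor_linr _)).
Qed.

(** Each remaining term z of [dirac_decomposition] is odd and supercommutes with
    the image of w: the terms c_s (u + spin) since w commutes with the second
    factor, the cubic term in r since each of its three factors does. *)
Lemma odd_ad_restrict w :
  (forall i, inf_action (tnth r i) * w = w * inf_action (tnth r i)) ->
  odd_ad (cubic_dirac br B idfun a b) (Theta w) =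
  Theta (odd_ad (cubic_dirac br B j p q) w).
Proof.
move=> w_inv; rewrite /odd_ad [RHS](linB lT) !ThetaM Theta_parity dirac_decomposition.
rewrite mulrDl mulrDr opprD addrACA -[RHS]addr0; congr (_ + _).
pose N z := z * Theta w = parT (Theta w) * z.
have Nlin t z z' : N z -> N z' -> N (t *: z + z').
  by rewrite /N mulr_linear mull_linear => -> ->.
suff : N (\sum_i tensor 1 (c (tnth s i)) * Theta (inf_action (tnth r i)) -
          tensor 1 (6%:R^-1 *: RRR)) by move=> ->; rewrite subrr.
have N0 : N 0 by rewrite /N mul0r mulr0.
have ND z z' : N z -> N z' -> N (z + z').
  by move=> Nz Nz'; rewrite -[z]scale1r; apply: Nlin.
have NZ t z : N z -> N (t *: z) by move=> Nz; rewrite -[t *: z]addr0; apply: Nlin.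
have Nsum (I : Type) (e : seq I) (F : I -> weil br B idfun) :
    (forall i, N (F i)) -> N (\sum_(i <- e) F i).
  by move=> NF; elim/big_ind: _ => //.
have Ns i : N (tensor 1 (c (tnth s i))) by apply: Theta_supercomm.
apply: (ND); first apply: (Nsum) => i.
  by rewrite /N -mulrA -ThetaM w_inv ThetaM mulrA Ns mulrA.
rewrite -(linN (tensor_linr _)) -scaleNr (linZ (tensor_linr _)); apply: (NZ).
rewrite (lin_sum (tensor_linr _)); apply: (Nsum) => i.
rewrite (lin_sum (tensor_linr _)); apply: (Nsum) => i'.
rewrite (lin_sum (tensor_linr _)); apply: (Nsum) => l.
rewrite (linZ (tensor_linr _)); apply: (NZ).
have -> : tensor 1 (c (tnth s i) * c (tnth s i') * c (tnth s l)) =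
   tensor 1 (c (tnth s i)) * tensor 1 (c (tnth s i')) * tensor 1 (c (tnth s l))
   :> weil br B idfun by rewrite !tensorM !mul1r.
have Ts i0 v : tensor 1 (c (tnth s i0)) * Theta v =
    Theta (weil_parity v) * tensor 1 (c (tnth s i0)).
  by rewrite Theta_parity Theta_supercomm.
rewrite /N -Theta_parity -mulrA Ts [LHS]mulrA -[_ * _ * Theta _]mulrA Ts.
rewrite [X in X * _]mulrA Ts -!mulrA; congr (Theta _ * _).
have lp : linear (@weil_parity K g W br B j).
  by apply: tensor_map_lin => //; exact: parity_lin.
have pE x y : weil_parity (tensor x y) = tensor x (clifford_parity y) :> weil br B j.
  by apply: tensor_mapE => //; exact: parity_lin.
move: (w); apply: tensor_lin_eq => [t x y|//|x y].
  by rewrite !lp.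
by rewrite !pE parityK.
Qed.
End Decomposition.

(** * Strict differentiability and mixed derivatives *)

Section StrictDerivative.
Variables (R : realType) (V : normedModType R).

Lemma is_derive_line (W : normedModType R) (f : V -> W) (y v : V) (s : R) :
  derivable f (y + s *: v) v ->
  is_derive s (1 : R) (fun t : R => f (y + t *: v)) ('D_v f (y + s *: v)).
Proof.
have E : (fun h : R => h^-1 *: (((fun t : R => f (y + t *: v)) \o shift s) (h *: (1 : R)) - f (y + s *: v)))
   = (fun h : R => h^-1 *: ((f \o shift (y + s *: v)) (h *: v) - f (y + s *: v))).
  apply: funext => h /=; congr (_ *: (f _ - _)).
  by rewrite [h *: 1]mulr1 scalerDl addrCA.
by move=> df; split; rewrite /derivable /derive /= E.
Qed.

Lemma is_derive_translate (W : normedModType R) (f : V -> W) (a y v : V) (df : W) :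
  is_derive (y + a) v f df -> is_derive y v (fun z => f (z + a)) df.
Proof.
have E : (fun k : R => k^-1 *: (((fun z => f (z + a)) \o shift y) (k *: v) - f (y + a)))
   = (fun k : R => k^-1 *: ((f \o shift (y + a)) (k *: v) - f (y + a))).
  by apply: funext => k /=; rewrite addrA.
by move=> [df1 df2]; split; [rewrite /derivable E | rewrite /derive E].
Qed.

Lemma MVT_dir (f : V -> R) (y v : V) (t : R) (D : set V) :
  (forall s : R, `|s| <= `|t| -> D (y + s *: v)) ->
  (forall z, D z -> derivable f z v) ->
  exists2 s : R, `|s| <= `|t| & f (y + t *: v) - f y = t * 'D_v f (y + s *: v).
Proof.
move=> Dy Df.
pose g s := f (y + s *: v).
have dg (s : R) : `|s| <= `|t| -> is_derive s (1 : R) g ('D_v f (y + s *: v)).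
  by move=> st; apply: is_derive_line; exact/Df/Dy.
have main (a b : R) : a <= b -> (forall s, s \in `[a, b] -> `|s| <= `|t|) ->
    exists2 c, c \in `[a, b]%R & g b - g a = 'D_v f (y + c *: v) * (b - a).
  move=> ab abt; apply: (@MVT_segment _ g (fun s => 'D_v f (y + s *: v))) => // [s sab|].
    by apply: dg; apply: abt; apply: subset_itv_oo_cc sab.
  apply: continuous_in_subspaceT => s /set_mem sab.
  by apply: differentiable_continuous; apply/derivable1_diffP; have [] := dg _ (abt _ sab).
have g0 : g 0 = f y by rewrite /g scale0r addr0.
have [t0|t0] := leP 0 t.
  have [|c cI E] := main 0 t t0.
    by move=> s; rewrite in_itv /= => /andP[s0 st]; rewrite !ger0_norm.
  exists c; first by move: cI; rewrite in_itv /= => /andP[s0 st]; rewrite !ger0_norm.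
  by rewrite -g0 -/(g t) E subr0 mulrC.
have [|c cI E] := main t 0 (ltW t0).
  by move=> s; rewrite in_itv /= => /andP[s0 st]; rewrite !ler0_norm ?lerN2 // ltW.
exists c.
  by move: cI; rewrite in_itv /= => /andP[s0 st]; rewrite !ler0_norm ?lerN2 // ltW.
rewrite -g0 -/(g t); apply/eqP; rewrite -eqr_opp opprB E sub0r mulrN mulrC.
by rewrite eqxx.
Qed.

(** The estimate is uniform in the base point y near x, as the mean value theorem
    replaces the difference quotient by a nearby value of the derivative. *)
Lemma strict_derive (f : V -> R) (x v : V) :
  (\forall y \near x, derivable f y v) -> {for x, continuous ('D_v f)} ->
  forall e, 0 < e -> exists2 d, 0 < d & forall y t, `|y - x| < d -> `|t| < d ->
    `|f (y + t *: v) - f y - t * 'D_v f x| <= e * `|t|.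
Proof.
move=> fd fc e e0.
have : \forall y \near x, derivable f y v /\ `|'D_v f x - 'D_v f y| <= e.
  near=> y; split; near: y => //.
  by move/cvgrPdist_le : fc; apply.
move=> /nbhs_normP [d /= d0 dP].
have v1 : 0 < `|v| + 1 by rewrite ltr_wpDl.
exists (d / 2 / (`|v| + 1) ) => [|y t yx td].
  by rewrite !divr_gt0.
have yx2 : `|y - x| < d / 2.
  by apply: lt_le_trans yx _; rewrite ler_pdivrMr // ler_peMr ?divr_ge0 ?(ltW d0) // lerDr.
have tv : `|t| * `|v| < d / 2.
  move: td; rewrite ltr_pdivlMr // => /(le_lt_trans _); apply.
  by rewrite ler_wpM2l // lerDl.
have Dy s : `|s| <= `|t| -> ball_ Num.norm x d (y + s *: v).
  move=> st; rewrite /ball_ /= distrC addrAC.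
  apply: le_lt_trans (ler_normD _ _) _; rewrite (splitr d) ltrD //.
  by rewrite normrZ; apply: le_lt_trans tv; rewrite ler_wpM2r.
have [z /dP[]//|s st ->] := MVT_dir Dy (f := f).
have [_ H] := dP _ (Dy _ st).
by rewrite -mulrBr normrM mulrC ler_wpM2r // distrC.
Unshelve. all: by end_near. Qed.

(** The second difference of f over the parallelogram with sides tv and tw is t^2
    times either mixed derivative, up to o(t^2). *)
Lemma derive_swap (f : V -> R) (x v w : V) :
  (\forall y \near x, derivable f y v) -> (\forall y \near x, derivable f y w) ->
  (\forall y \near x, derivable ('D_v f) y w) ->
  (\forall y \near x, derivable ('D_w f) y v) ->
  {for x, continuous ('D_w ('D_v f))} -> {for x, continuous ('D_v ('D_w f))} ->
  'D_w ('D_v f) x = 'D_v ('D_w f) x.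
Proof.
have key (v' w' : V) : (\forall y \near x, derivable f y v') ->
    (\forall y \near x, derivable ('D_v' f) y w') ->
    {for x, continuous ('D_w' ('D_v' f))} ->
    forall e, 0 < e -> \forall t \near 0^'+,
    `|(f (x + t *: v' + t *: w') - f (x + t *: v') - f (x + t *: w') + f x)
      - t * t * 'D_w' ('D_v' f) x| <= e * (t * t).
  move=> fv fvw c e e0.
  have [d d0 dP] := strict_derive fvw c e0.
  have [d' /= d'0 d'P] := (nbhs_normP _ _).1 fv.
  pose C := `|v'| + `|w'| + 1.
  have C0 : 0 < C by rewrite ltr_wpDl.
  near=> t.
  have t0 : 0 < t by near: t; exact: nbhs_right_gt.
  have td : t < d by near: t; exact: nbhs_right_lt.
  have tdC : t * C < d.
    by rewrite -ltr_pdivlMr //; near: t; apply: nbhs_right_lt; rewrite divr_gt0.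
  have td'C : t * C < d'.
    by rewrite -ltr_pdivlMr //; near: t; apply: nbhs_right_lt; rewrite divr_gt0.
  pose h y := f (y + t *: w') - f y.
  have small (s s' : R) : `|s| <= `|t| -> `|s'| <= `|t| -> `|s *: v' + s' *: w'| <= t * C.
    move=> st s't; apply: le_trans (ler_normD _ _) _; rewrite !normrZ.
    rewrite !mulrDr mulr1 -[leLHS]addr0; apply: lerD; last exact: ltW.
    by rewrite lerD // ler_wpM2r // -(gtr0_norm t0).
  pose D : set V := fun y => `|y - x| < d' /\ `|y + t *: w' - x| < d'.
  have Dx s : `|s| <= `|t| -> D (x + s *: v').
    move=> st; split.
      apply: le_lt_trans td'C; rewrite addrAC subrr add0r.
      by have := small s 0 st; rewrite scale0r addr0; apply; rewrite normr0.
    apply: le_lt_trans td'C; rewrite -[x + _ + _]addrA [x + _]addrC addrK.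
    by apply: small.
  have sh y : D y -> derivable f y v' /\ derivable (fun z => f (z + t *: w')) y v'
      /\ 'D_v' (fun z => f (z + t *: w')) y = 'D_v' f (y + t *: w').
    move=> [y1 y2]; have f1 : derivable f y v' by apply: d'P; rewrite /ball_ /= distrC.
    have f2 : derivable f (y + t *: w') v' by apply: d'P; rewrite /ball_ /= distrC.
    have [g1 g2] := is_derive_translate (DeriveDef f2 erefl).
    by split; [exact: f1 | split; [exact: g1 | exact: g2]].
  have dh y : D y -> derivable h y v'.
    by move=> /sh[f1 [f2 _]]; apply: derivableB.
  have [s st E] := MVT_dir Dx dh.
  have -> : f (x + t *: v' + t *: w') - f (x + t *: v') - f (x + t *: w') + f x
      = t * ('D_v' f (x + s *: v' + t *: w') - 'D_v' f (x + s *: v')).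
    have -> : 'D_v' f (x + s *: v' + t *: w') - 'D_v' f (x + s *: v') = 'D_v' h (x + s *: v').
      have [f1 [f2 f3]] := sh _ (Dx _ st).
      by rewrite -f3; apply/esym/deriveB; [exact: f2 | exact: f1].
    by rewrite -E /h opprB addrA [RHS]addrAC.
  rewrite -mulrA -mulrBr normrM (gtr0_norm t0) mulrCA ler_pM2l //.
  rewrite -[X in _ <= _ * X](gtr0_norm t0); apply: dP; last by rewrite gtr0_norm.
  rewrite addrAC subrr add0r; apply: le_lt_trans tdC.
  by have := small s 0 st; rewrite scale0r addr0; apply; rewrite normr0.
move=> fv fw fvw fwv cvw cwv.
apply/eqP; rewrite -subr_eq0 -normr_le0; apply/ler_addgt0Pr => e e0.
rewrite add0r.
have e2 : 0 < e / 2 by rewrite divr_gt0.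
have k1 := key v w fv fvw cvw _ e2.
have k2 := key w v fw fwv cwv _ e2.
have [t [[K1 K2] t0]] := filter_ex (filterI (filterI k1 k2) (nbhs_right_gt (0 : R))).
have tt : 0 < t * t by rewrite mulr_gt0.
have wv : f (x + t *: w + t *: v) - f (x + t *: w) - f (x + t *: v) =
    f (x + t *: v + t *: w) - f (x + t *: v) - f (x + t *: w).
  by rewrite addrAC [x + _ + _]addrAC.
rewrite wv in K2; move: K1 K2; set Q := _ - _ + _ => K1 K2.
rewrite -(ler_pM2l tt) -[X in X * `|_|](gtr0_norm tt) -normrM.
have R3 (a b c q : R) : c * (a - b) = (q - c * b) - (q - c * a) by ring.
rewrite (R3 _ _ _ Q).
apply: le_trans (ler_normB _ _) _; apply: le_trans (lerD K2 K1) _.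
by rewrite -mulrDl -splitr mulrC.
Unshelve. all: by end_near. Qed.

End StrictDerivative.

(** * Frechet differentiability of smooth maps *)

Lemma cvg_sumr (R : realType) (W : normedModType R) (T : Type) (F : set_system T)
    (I : Type) (r : seq I) (Ff : I -> T -> W) (Fa : I -> W) : Filter F ->
  (forall i, Ff i x @[x --> F] --> Fa i) ->
  \sum_(i <- r) Ff i x @[x --> F] --> \sum_(i <- r) Fa i.
Proof.
move=> FF FfFa; apply: cvg_big => //; exact: add_continuous.
Qed.

Section Frechet.
Variables (R : realType) (V : normedModType R).

Lemma differentiable_approx (W : normedModType R) (f : V -> W) (x : V)
    (L : {linear V -> W}) : continuous L ->
  (forall e, 0 < e -> \forall h \near (0 : V), `|f (h + x) - f x - L h| <= e * `|h|) ->
  differentiable f x /\ 'd f x = L :> (V -> W).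
Proof.
move=> Lc fL.
have fE : f \o shift x = cst (f x) + L +o_ (0 : V) id.
  apply/eqaddoP => e e0; apply: filterS (fL _ e0) => h.
  suff -> : (f \o shift x - (cst (f x) + L)) h = f (h + x) - f x - L h by [].
  by rewrite -[LHS]/(f (h + x) - (f x + L h)) opprD addrA.
have dE := diff_unique Lc fE; split => //.
by apply/diff_locallyP; rewrite dE.
Qed.

(** The increment of f is telescoped over the coordinates; uniformity in
    [strict_derive] controls each step although its base point moves with h. *)
Lemma differentiable_coords (m : nat) (co : 'I_m -> V -> R) (b : 'I_m -> V)
    (M : R) (f : V -> R) (x : V) :
  0 < M -> (forall i, linear (co i)) -> (forall i v, `|co i v| <= M * `|v|) ->
  (forall v, v = \sum_i co i v *: b i) ->
  (forall i, \forall y \near x, derivable f y (b i)) ->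
  (forall i, {for x, continuous ('D_(b i) f)}) ->
  differentiable f x.
Proof.
move=> M0 col coM vE fd fc.
have co_cont i : continuous (co i).
  move=> v; apply/cvgrPdist_le => e e0; near=> w.
  rewrite -(linB (col i)); apply: le_trans (coM _ _) _.
  rewrite mulrC -ler_pdivlMr //; near: w.
  by apply/nbhs_normP; exists (e / M) => [|w /=]; [exact: divr_gt0 | exact: ltW].
pose L v : R := \sum_i co i v * 'D_(b i) f x.
have L_lin : linear L.
  move=> k u v; rewrite scaler_sumr -big_split; apply: eq_bigr => i _.
  by rewrite col mulrDl /= [k *: (_ * _)]mulrA.
pose LLm := GRing.isLinear.Build R V R *:%R L L_lin.
pose LL : {linear V -> R} := HB.pack L LLm.
have LLc : continuous LL.
  move=> v; rewrite /LL /= /L.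
  apply: cvg_sumr => i; apply: cvgM; [exact: co_cont | exact: cvg_cst].
suff [] : differentiable f x /\ 'd f x = LL :> (V -> R) by [].
apply: differentiable_approx => //.
pose P (s : seq 'I_m) h := \sum_(i <- s) co i h *: b i.
have small (s : seq 'I_m) d : 0 < d -> \forall h \near (0 : V), `|P s h| < d.
  move=> d0.
  have Pc : P s h @[h --> (0 : V)] --> (0 : V).
    have {2}-> : 0 = P s 0 by rewrite /P big1 // => i _; rewrite (lin0 (col i)) scale0r.
    apply: cvg_sumr => i; apply: cvgZ; [exact: co_cont | exact: cvg_cst].
  by near=> h; rewrite -[P s h]subr0 distrC; near: h; move/cvgrPdist_lt: Pc; apply.
suff H (s : seq 'I_m) e : 0 < e -> \forall h \near (0 : V),
    `|f (x + P s h) - f x - \sum_(i <- s) co i h * 'D_(b i) f x| <= e * `|h|.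
  move=> e e0; apply: filterS (H (index_enum _) e e0) => h.
  by rewrite /P -vE (addrC x h).
elim: s e => [|i s IHs] e e0.
  near=> h; rewrite /P !big_nil addr0 !subrr normr0.
  by rewrite mulr_ge0 // ltW.
have e2 : 0 < e / 2 by rewrite divr_gt0.
have eM : 0 < e / 2 / M by rewrite divr_gt0.
have [d d0 dP] := strict_derive (fd i) (fc i) eM.
near=> h.
have h1 : `|P s h| < d by near: h; apply: small.
have h2 : `|co i h| < d.
  near: h; have /cvgrPdist_lt := co_cont i 0; move/(_ _ d0).
  apply: filterS => h; rewrite (lin0 (col i)) sub0r normrN; apply.
have h3 : `|f (x + P s h) - f x - \sum_(i <- s) co i h * 'D_(b i) f x| <= e / 2 * `|h|.
  by near: h; apply: IHs.
have h4 := dP (x + P s h) (co i h).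
have -> : f (x + P (i :: s) h) - f x - \sum_(i <- i :: s) co i h * 'D_(b i) f x =
   (f (x + P s h + co i h *: b i) - f (x + P s h) - co i h * 'D_(b i) f x)
   + (f (x + P s h) - f x - \sum_(i <- s) co i h * 'D_(b i) f x).
  rewrite /P !big_cons [_ *: _ + _ in LHS]addrC [x + (_ + _)]addrA.
  have R5 (a z c p q : R) : a - c - (p + q) = (a - z - p) + (z - c - q) by ring.
  exact: R5.
apply: le_trans (ler_normD _ _) _; rewrite (splitr e) mulrDl lerD //.
apply: le_trans (h4 _ h2) _; first by rewrite addrC addKr.
rewrite mulrAC ler_pdivrMr // -[leRHS]mulrA ler_wpM2l ?(ltW e2) // mulrC; exact: coM.
Unshelve. all: by end_near. Qed.

End Frechet.

Section SmoothDifferentiable.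
Variable R : realType.

Lemma continuous_near_eq (V W : normedModType R) (f h : V -> W) (x : V) :
  (\forall y \near x, f y = h y) -> {for x, continuous f} -> {for x, continuous h}.
Proof.
move=> fh fc; rewrite /prop_for /continuous_at -(nbhs_singleton fh).
by apply: cvg_trans fc; apply: near_eq_cvg; apply: filterS fh.
Qed.

Lemma norm_coord n (v : 'rV[R]_n) i j : `|v i j| <= `|v|.
Proof.
rewrite [leRHS]/Num.Def.normr/= mx_normrE.
exact: (le_bigmax _ (fun ij => `|v ij.1 ij.2|) (i, j)).
Qed.

(** What the criterion above needs of a finite-dimensional space, in a form that
    passes to products. *)
Definition bounded_basis (V : normedModType R) m (co : 'I_m -> V -> R) (b : 'I_m -> V) :=
  [/\ forall i, linear (co i), forall i v, `|co i v| <= `|v|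
    & forall v, v = \sum_i co i v *: b i].

Lemma rV_basis n : bounded_basis (fun (i : 'I_n) (v : 'rV[R]_n) => v 0 i)
  (fun i => delta_mx 0 i).
Proof.
split=> [i k u v|i v|v]; first by rewrite !mxE.
  exact: norm_coord.
by rewrite {1}[v]row_sum_delta.
Qed.

Lemma prod_basis (V1 V2 : normedModType R) m1 m2 (co1 : 'I_m1 -> V1 -> R) b1
    (co2 : 'I_m2 -> V2 -> R) b2 : bounded_basis co1 b1 -> bounded_basis co2 b2 ->
  bounded_basis (fun (i : 'I_(m1 + m2)) (v : V1 * V2) =>
     match fintype.split i with inl i => co1 i v.1 | inr i => co2 i v.2 end)
   (fun i => match fintype.split i with inl i => (b1 i, 0) | inr i => (0, b2 i) end).
Proof.
move=> [l1 n1 e1] [l2 n2 e2]; split=> [i k u v|i v|v].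
- by case: (fintype.split i) => j; rewrite ?l1 ?l2.
- rewrite prod_normE /=; case: (fintype.split i) => j; rewrite le_max.
    by rewrite n1.
  by rewrite n2 orbT.
rewrite big_split_ord /=.
have sl i : fintype.split (lshift m2 i) = inl i :> 'I_m1 + 'I_m2 by exact: (unsplitK (inl i)).
have sr i : fintype.split (rshift m1 i) = inr i :> 'I_m1 + 'I_m2 by exact: (unsplitK (inr i)).
under eq_bigr do rewrite sl; under [X in _ + X]eq_bigr do rewrite sr.
have fE (W1 W2 : lmodType R) (I : Type) (s : seq I) (F : I -> W1) (G : I -> W2) :
    \sum_(i <- s) (F i, G i) = (\sum_(i <- s) F i, \sum_(i <- s) G i).
  elim: s => [|i s IHs]; first by rewrite !big_nil.
  by rewrite !big_cons IHs.
rewrite [in LHS](surjective_pairing v) {1}[v.1]e1 {1}[v.2]e2.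
have -> : \sum_(i < m1) co1 i v.1 *: (b1 i, 0 : V2) =
    (\sum_(i < m1) co1 i v.1 *: b1 i, 0).
  transitivity (\sum_(i < m1) (co1 i v.1 *: b1 i, 0 : V2)).
    by apply: eq_bigr => i _; congr pair; rewrite scaler0.
  by rewrite fE [X in (_, X)]big1.
have -> : \sum_(i < m2) co2 i v.2 *: (0 : V1, b2 i) =
    (0, \sum_(i < m2) co2 i v.2 *: b2 i).
  transitivity (\sum_(i < m2) (0 : V1, co2 i v.2 *: b2 i)).
    by apply: eq_bigr => i _; congr pair; rewrite scaler0.
  by rewrite fE [X in (X, _)]big1.
by apply/pair_equal_spec; rewrite addr0 add0r.
Qed.

Lemma derive_coord (V : normedModType R) n (f : V -> 'rV[R]_n) x v j :
  derivable f x v -> derivable (fun y => f y 0 j) x v /\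
  'D_v (fun y => f y 0 j) x = 'D_v f x 0 j.
Proof.
move=> fd; split; first by have /derivable_mxP := fd; apply.
by rewrite derive_mx // mxE.
Qed.

Lemma C1_differentiable (V : normedModType R) m (co : 'I_m -> V -> R) b n
    (f : V -> 'rV[R]_n) (x : V) : bounded_basis co b ->
  (forall i, \forall y \near x, derivable f y (b i)) ->
  (forall i, {for x, continuous ('D_(b i) f)}) ->
  differentiable f x.
Proof.
move=> [col con coE] fd fc.
have dj j : differentiable (fun y => f y 0 j) x.
  apply: (differentiable_coords (M := 1) ltr01 col _ coE) => [i v|i|i].
  - by rewrite mul1r.
  - by apply: filterS (fd i) => y /(derive_coord j) [].
  apply: (@continuous_near_eq _ _ (fun y => 'D_(b i) f y 0 j)).
    by apply: filterS (fd i) => y /(derive_coord j) [].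
  apply: (@continuous_comp _ _ _ ('D_(b i) f) (fun M : 'rV[R]_n => M 0 j)).
    exact: fc.
  exact: coord_continuous.
have -> : f = \sum_(j < n) (fun y => f y 0 j *: delta_mx 0 j).
  by apply: funext => y; rewrite fct_sumE [LHS]row_sum_delta.
by apply: differentiable_sum => j; exact: differentiableZl.
Qed.

Lemma near_eq_diff (V W : normedModType R) (f h : V -> W) (x : V) :
  (\forall y \near x, f y = h y) -> differentiable f x ->
  differentiable h x /\ 'd h x = 'd f x :> (V -> W).
Proof.
move=> fh df; apply: differentiable_approx; first exact: diff_continuous.
move=> e e0.
have /eqaddoP/(_ e e0) := diff_locally df.
have fh0 : \forall k \near (0 : V), f (k + x) = h (k + x).
  by move: fh; rewrite (near_shift 0) subr0.
apply: filter_app; apply: filterS fh0 => k fk.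
have -> : (f \o shift x - (cst (f x) + 'd f x)) k = h (k + x) - h x - 'd f x k.
  by rewrite -[LHS]/(f (k + x) - (f x + 'd f x k)) opprD addrA fk (nbhs_singleton fh).
by [].
Qed.

End SmoothDifferentiable.

Section SmoothAt.
Variable R : realType.

Definition smooth_at (V W : normedModType R) (f : V -> W) (x : V) :=
  exists U : set V, [/\ open U, U x & smooth_on U f].

Lemma smooth_at_near (V W : normedModType R) (f : V -> W) x :
  smooth_at f x -> \forall y \near x, smooth_at f y.
Proof.
move=> [U [oU Ux fU]]; have : nbhs x U by apply: open_nbhs_nbhs; split.
by apply: filterS => y Uy; exists U.
Qed.

Lemma smooth_at_derive (V W : normedModType R) (f : V -> W) x v :
  smooth_at f x -> smooth_at ('D_v f) x.
Proof.
move=> [U [oU Ux fU]]; exists U; split => // k.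
by have [_ /(_ v) []] := fU k.+1.
Qed.

Lemma smooth_at_derivable (V W : normedModType R) (f : V -> W) x v :
  smooth_at f x -> derivable f x v.
Proof. by move=> [U [oU Ux fU]]; have [_ /(_ v) [+ _]] := fU 1%N; apply. Qed.

Lemma smooth_at_continuous (V W : normedModType R) (f : V -> W) x :
  smooth_at f x -> {for x, continuous f}.
Proof. by move=> [U [oU Ux fU]]; have [+ _] := fU 0%N; apply. Qed.

Lemma smooth_at_differentiable (V : normedModType R) m (co : 'I_m -> V -> R) b n
    (f : V -> 'rV[R]_n) (x : V) : bounded_basis co b ->
  smooth_at f x -> differentiable f x.
Proof.
move=> cob fx; apply: (C1_differentiable cob) => i.
  by apply: filterS (smooth_at_near fx) => y; exact: smooth_at_derivable.
exact/smooth_at_continuous/smooth_at_derive.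
Qed.

Lemma smooth_at_swap (V : normedModType R) n (f : V -> 'rV[R]_n) (x v w : V) :
  smooth_at f x -> 'D_w ('D_v f) x = 'D_v ('D_w f) x.
Proof.
move=> fx; apply/rowP => j.
have E (u : V) (g : V -> 'rV[R]_n) y : smooth_at g y ->
    'D_u (fun z => g z 0 j) y = 'D_u g y 0 j.
  by move=> gy; have [] := derive_coord j (smooth_at_derivable (v := u) gy).
have D (u : V) (g : V -> 'rV[R]_n) y : smooth_at g y -> derivable (fun z => g z 0 j) y u.
  by move=> gy; have [] := derive_coord j (smooth_at_derivable (v := u) gy).
have E1 (u : V) (g : V -> 'rV[R]_n) y : smooth_at g y ->
    \forall z \near y, 'D_u g z 0 j = 'D_u (fun z => g z 0 j) z.
  by move=> gy; apply: filterS (smooth_at_near gy) => z /E ->.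
have E2 (u u' : V) y : smooth_at f y ->
    'D_u' ('D_u f) y 0 j = 'D_u' ('D_u (fun z => f z 0 j)) y.
  move=> fy; rewrite -E; last exact: smooth_at_derive.
  exact/near_eq_derive/E1.
have D2 (u u' : V) y : smooth_at f y -> derivable ('D_u (fun z => f z 0 j)) y u'.
  move=> fy; apply: (near_eq_derivable (f := fun z => 'D_u f z 0 j)); first exact: E1.
  exact/D/smooth_at_derive.
have C2 (u u' : V) : {for x, continuous ('D_u' ('D_u (fun z => f z 0 j)))}.
  apply: (@continuous_near_eq _ _ _ (fun z => 'D_u' ('D_u f) z 0 j)).
    by apply: filterS (smooth_at_near fx) => z; exact: E2.
  apply: (@continuous_comp _ _ _ ('D_u' ('D_u f)) (fun M : 'rV[R]_n => M 0 j)).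
    by apply: smooth_at_continuous; do 2 apply: smooth_at_derive.
  exact: coord_continuous.
apply: (etrans (E2 v w x fx)); apply: (etrans _ (esym (E2 w v x fx))).
apply: derive_swap; last 2 first.
- exact: C2.
- exact: C2.
- by apply: filterS (smooth_at_near fx) => y; exact: D.
- by apply: filterS (smooth_at_near fx) => y; exact: D.
- by apply: filterS (smooth_at_near fx) => y; exact: D2.
- by apply: filterS (smooth_at_near fx) => y; exact: D2.
Qed.
End SmoothAt.

(** * Lie groups in charts *)

Section Charts.
Variables (R : realType) (n : nat) (G : lieGroupType R n).
Implicit Types (phi psi chi : chart R n G) (x y : G).

Lemma chart_imgP phi x : chart_dom phi x -> chart_img phi (phi x).
Proof. by move=> phix; exists x. Qed.

Lemma chart_near phi x : chart_dom phi x -> \forall y \near x, chart_dom phi y.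
Proof. by move=> phix; apply: open_nbhs_nbhs; split; [exact: chart_dom_open|]. Qed.

Lemma chart_img_near phi u : chart_img phi u -> \forall v \near u, chart_img phi v.
Proof. by move=> phiu; apply: open_nbhs_nbhs; split; [exact: chart_img_open|]. Qed.

Lemma chart_invK phi u : chart_img phi u ->
  chart_dom phi (chart_inv phi u) /\ phi (chart_inv phi u) = u.
Proof. by move=> [x phix <-]; rewrite chart_funK. Qed.

Lemma chart_inv_cvg phi u : chart_img phi u -> {for u, continuous (chart_inv phi)}.
Proof. exact: chart_inv_continuous. Qed.

Definition chart_mul phi psi chi (uv : 'rV[R]_n * 'rV[R]_n) : 'rV[R]_n :=
  chi (chart_inv phi uv.1 * chart_inv psi uv.2)%g.

Lemma smooth_chart_mul phi psi chi u v :
  lie_atlas phi -> lie_atlas psi -> lie_atlas chi ->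
  chart_img phi u -> chart_img psi v ->
  chart_dom chi (chart_inv phi u * chart_inv psi v)%g ->
  smooth_at (chart_mul phi psi chi) (u, v).
Proof.
move=> aphi apsi achi iu iv d.
exists [set uv | [/\ chart_img phi uv.1, chart_img psi uv.2
  & chart_dom chi (chart_inv phi uv.1 * chart_inv psi uv.2)%g]]; split => //.
  rewrite openE => -[u' v'] [/= iu' iv' d']; rewrite /interior.
  have n1 : \forall uv \near (u', v'), chart_img phi uv.1.
    by apply: (@cvg_fst _ _ (nbhs u') (nbhs v')); exact: chart_img_near.
  have n2 : \forall uv \near (u', v'), chart_img psi uv.2.
    by apply: (@cvg_snd _ _ (nbhs u') (nbhs v')); exact: chart_img_near.
  have n3 : \forall uv \near (u', v'),
      chart_dom chi (chart_inv phi uv.1 * chart_inv psi uv.2)%g.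
    have c1 : chart_inv phi uv.1 @[uv --> (u', v')] --> chart_inv phi u'.
      apply: (@cvg_comp _ _ _ fst (chart_inv phi) _ (nbhs u')); last exact: chart_inv_cvg.
      exact: cvg_fst.
    have c2 : chart_inv psi uv.2 @[uv --> (u', v')] --> chart_inv psi v'.
      apply: (@cvg_comp _ _ _ snd (chart_inv psi) _ (nbhs v')); last exact: chart_inv_cvg.
      exact: cvg_snd.
    have c3 := cvg_comp _ _ (cvg_pair c1 c2)
      (@lie_mul_continuous R n G (chart_inv phi u', chart_inv psi v')).
    by apply: c3; exact: chart_near.
  by near=> uv; split; near: uv.
exact: lie_mul_smooth.
Unshelve. all: by end_near. Qed.

Definition chart_opp phi psi (u : 'rV[R]_n) : 'rV[R]_n := psi ((chart_inv phi u)^-1)%g.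

Lemma smooth_chart_opp phi psi u : lie_atlas phi -> lie_atlas psi ->
  chart_img phi u -> chart_dom psi ((chart_inv phi u)^-1)%g ->
  smooth_at (chart_opp phi psi) u.
Proof.
move=> aphi apsi iu d.
exists [set u | chart_img phi u /\ chart_dom psi ((chart_inv phi u)^-1)%g]; split => //.
  rewrite openE => u' [/= iu' d']; rewrite /interior.
  have c3 : ((chart_inv phi v)^-1)%g @[v --> u'] --> ((chart_inv phi u')^-1)%g.
    apply: (@cvg_comp _ _ _ (chart_inv phi) (fun x : G => x^-1%g) _
      (nbhs (chart_inv phi u'))); [exact: chart_inv_cvg | exact: lie_inv_continuous].
  have n1 := chart_img_near iu'.
  have n2 : \forall v \near u', chart_dom psi ((chart_inv phi v)^-1)%g.
    by apply: c3; exact: chart_near.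
  by near=> v; split; near: v.
exact: lie_inv_smooth.
Unshelve. all: by end_near. Qed.

Lemma pair_differentiable m (f : 'rV[R]_n * 'rV[R]_n -> 'rV[R]_m) uv :
  smooth_at f uv -> differentiable f uv.
Proof.
exact: smooth_at_differentiable (prod_basis (rV_basis R n) (rV_basis R n)).
Qed.

Lemma rV_differentiable m (f : 'rV[R]_n -> 'rV[R]_m) u :
  smooth_at f u -> differentiable f u.
Proof. exact: smooth_at_differentiable (rV_basis R n). Qed.

End Charts.

(** * The adjoint action *)

Lemma differentiable_idfun (R : realType) (V : normedModType R) (x : V) :
  differentiable (fun v : V => v) x.
Proof. by have [] := is_diff_id x. Qed.

Section Adjoint.
Variables (R : realType) (n : nat) (G : lieGroupType R n) (phi : chart R n G).
Hypotheses (aphi : lie_atlas phi) (phi1 : chart_dom phi 1%g).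
Local Notation e := (phi 1%g).
Local Notation inv := (chart_inv phi).

Definition conj_chart (x : G) (y : 'rV[R]_n) : 'rV[R]_n := phi (x * inv y * x^-1)%g.

Lemma e_img : chart_img phi e. Proof. exact: (chart_imgP phi1). Qed.

Lemma inv_e : inv e = 1%g. Proof. exact: (chart_funK phi1). Qed.

Lemma mul_continuous_at (T : topologicalType) (f g : T -> G) u :
  {for u, continuous f} -> {for u, continuous g} ->
  {for u, continuous (fun t => (f t * g t)%g)}.
Proof.
move=> fu gu; exact: cvg_comp _ _ (cvg_pair fu gu) (@lie_mul_continuous R n G (f u, g u)).
Qed.

Lemma conj_continuous (x : G) u : chart_img phi u ->
  {for u, continuous (fun y => (x * inv y * x^-1)%g)}.
Proof.
move=> iu; apply: mul_continuous_at; last exact: cst_continuous.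
by apply: mul_continuous_at; [exact: cst_continuous | exact: chart_inv_cvg].
Qed.

Lemma near_img : \forall y \near e, chart_img phi y.
Proof. exact: chart_img_near e_img. Qed.

Lemma conj_near (x : G) : \forall y \near e, chart_dom phi (x * inv y * x^-1)%g.
Proof.
have d1 : chart_dom phi (x * inv e * x^-1)%g by rewrite inv_e mulg1 mulgV.
exact: (@conj_continuous x _ e_img _ (chart_near d1)).
Qed.

Lemma conj_chart_e x : conj_chart x e = e.
Proof. by rewrite /conj_chart inv_e mulg1 mulgV. Qed.

Lemma inv_conj x y : chart_dom phi (x * inv y * x^-1)%g ->
  inv (conj_chart x y) = (x * inv y * x^-1)%g.
Proof. exact: chart_funK. Qed.

(** Conjugation by x leaves the chart at the identity: it is the composite of two
    products read in charts around x and its inverse. *)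
Lemma conj_differentiable (x : G) : differentiable (conj_chart x) e.
Proof.
have [psi apsi psix] := lie_atlas_cover x.
have [chi achi chix] := lie_atlas_cover (x^-1)%g.
pose f1 v := chart_mul psi phi psi (psi x, v).
pose f2 u := chart_mul psi chi phi (u, chi (x^-1)%g).
have px := chart_funK psix; have cx := chart_funK chix.
have df1 : differentiable f1 e.
  apply: (@differentiable_comp _ _ _ _ (fun v => (psi x, v)) (chart_mul psi phi psi)).
    apply: differentiable_pair; [exact: differentiable_cst | exact: differentiable_idfun].
  apply: pair_differentiable; apply: smooth_chart_mul => //; try exact: chart_imgP.
  by rewrite px inv_e mulg1.
have f1e : f1 e = psi x by rewrite /f1 /chart_mul /= px inv_e mulg1.
have df2 : differentiable f2 (f1 e).
  rewrite f1e.
  apply: (@differentiable_comp _ _ _ _ (fun u => (u, chi (x^-1)%g)) (chart_mul psi chi phi)).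
    apply: differentiable_pair; [exact: differentiable_idfun | exact: differentiable_cst].
  apply: pair_differentiable; apply: smooth_chart_mul => //; try exact: chart_imgP.
  by rewrite px cx mulgV.
suff near1 : \forall y \near e, (f2 \o f1) y = conj_chart x y.
  exact: (proj1 (near_eq_diff near1 (differentiable_comp df1 df2))).
have xinv : {for e, continuous (fun y => (x * inv y)%g)}.
  apply: mul_continuous_at; [exact: cst_continuous | exact: chart_inv_cvg e_img].
have dx : chart_dom psi (x * inv e)%g by rewrite inv_e mulg1.
have n1 : \forall y \near e, chart_dom psi (x * inv y)%g by exact: (xinv _ (chart_near dx)).
apply: filterS n1 => y dy.
by rewrite /f2 /f1 /conj_chart /chart_mul /= px cx chart_funK.
Qed.

Local Notation rAd := (real_Ad phi).

Lemma real_AdE x v : rAd x v = 'd (conj_chart x) e v.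
Proof. exact/deriveE/conj_differentiable. Qed.

Lemma real_Ad_linear x : linear (rAd x).
Proof. by move=> k u v; rewrite !real_AdE linearP. Qed.

Lemma real_Ad1 v : rAd 1%g v = v.
Proof.
transitivity ('D_v (fun y : 'rV[R]_n => y) e); last exact: derive_id.
apply: near_eq_derive; apply: filterS near_img => y /chart_invK [_ yE].
by rewrite invg1 mulg1 mul1g.
Qed.

Lemma real_AdM x y v : rAd (x * y)%g v = rAd x (rAd y v).
Proof.
rewrite 3!real_AdE.
have dc : differentiable (conj_chart x \o conj_chart y) e.
  by apply: differentiable_comp; rewrite ?conj_chart_e; exact: conj_differentiable.
have near0 : \forall z \near e, (conj_chart x \o conj_chart y) z = conj_chart (x * y)%g z.
  apply: filterS (conj_near y) => z dz.
  by rewrite /= /conj_chart chart_funK // invgM !mulgA.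
have [_ dE] := near_eq_diff near0 dc.
have dx : differentiable (conj_chart x) (conj_chart y e).
  by rewrite conj_chart_e; exact: conj_differentiable.
have dyx := diff_comp (conj_differentiable y) dx.
apply: (etrans (congr1 (fun F : _ -> _ => F v) (etrans dE dyx))).
by rewrite /= conj_chart_e.
Qed.

Lemma conj_curve (c : R -> G) v x : c 0 = 1%g -> {for 0, continuous c} ->
  is_derive (0 : R) (1 : R) (phi \o c) v ->
  is_derive (0 : R) (1 : R) (fun t => phi (x * c t * x^-1)%g) (rAd x v).
Proof.
move=> c0 cc [dc vE].
have dc' : differentiable (phi \o c) 0 by apply/derivable1_diffP.
have e0 : (phi \o c) 0 = e by rewrite /= c0.
have dd : differentiable (conj_chart x \o (phi \o c)) 0.
  by apply: differentiable_comp => //; rewrite e0; exact: conj_differentiable.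
have near0 : \forall t \near 0, (conj_chart x \o (phi \o c)) t = phi (x * c t * x^-1)%g.
  have d1 : chart_dom phi (c 0) by rewrite c0.
  have n1 : \forall t \near 0, chart_dom phi (c t) by exact: (cc _ (chart_near d1)).
  by apply: filterS n1 => t dt; rewrite /= /conj_chart chart_funK.
have [dg dgE] := near_eq_diff near0 dd.
split; first exact: diff_derivable.
have dx : differentiable (conj_chart x) ((phi \o c) 0).
  by rewrite e0; exact: conj_differentiable.
have dcx := diff_comp dc' dx.
apply: (etrans (deriveE _ dg)).
apply: (etrans (congr1 (fun F : _ -> _ => F (1 : R)) (etrans dgE dcx))).
by rewrite /= c0 real_AdE -vE -(deriveE _ dc').
Qed.

End Adjoint.

(** * The bracket *)

Section Calculus.
Variable R : realType.

Lemma derive_comp (U V W : normedModType R) (f : U -> V) (h : V -> W) x v :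
  differentiable f x -> differentiable h (f x) ->
  differentiable (h \o f) x /\ 'D_v (h \o f) x = 'D_('D_v f x) h (f x).
Proof.
move=> df dh; have dhf := differentiable_comp df dh; split => //.
apply: (etrans (deriveE _ dhf)).
apply: (etrans (congr1 (fun F : _ -> _ => F v) (diff_comp df dh))).
by rewrite /= -(deriveE _ df) -(deriveE _ dh).
Qed.

Lemma derive_pair (U V W : normedModType R) (f : U -> V) (h : U -> W) x v :
  differentiable f x -> differentiable h x ->
  differentiable (fun y => (f y, h y)) x /\
  'D_v (fun y => (f y, h y)) x = ('D_v f x, 'D_v h x).
Proof.
move=> df dh; have dp := differentiable_pair df dh; split => //.
apply: (etrans (deriveE _ dp)).
apply: (etrans (congr1 (fun F : _ -> _ => F v) (diff_pair df dh))).
by rewrite /= -(deriveE _ df) -(deriveE _ dh).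
Qed.

Lemma derive_dir_linear (V W : normedModType R) (f : V -> W) x :
  differentiable f x -> linear (fun v => 'D_v f x).
Proof. by move=> df k u v; rewrite !(deriveE _ df) linearP. Qed.

Lemma differentiable_of_coords (V : normedModType R) n (f : V -> 'rV[R]_n) x :
  (forall j, differentiable (fun y => f y 0 j) x) -> differentiable f x.
Proof.
move=> dj; have -> : f = \sum_(j < n) (fun y => f y 0 j *: delta_mx 0 j).
  by apply: funext => y; rewrite fct_sumE [LHS]row_sum_delta.
by apply: differentiable_sum => j; exact: differentiableZl.
Qed.

Lemma differentiable_coord_fun (V : normedModType R) n (f : V -> 'rV[R]_n) x j :
  differentiable f x -> differentiable (fun y => f y 0 j) x.
Proof.
move=> df; apply: (@differentiable_comp _ _ _ _ f (fun M : 'rV[R]_n => M 0 j)) => //.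
exact: differentiable_coord.
Qed.

Lemma derive_scale_fun (V : normedModType R) n (a : V -> R) (h : V -> 'rV[R]_n) x v :
  differentiable a x -> differentiable h x ->
  differentiable (fun y => a y *: h y) x /\
  'D_v (fun y => a y *: h y) x = 'D_v a x *: h x + a x *: 'D_v h x.
Proof.
move=> da dh.
have E j : (fun y => (a y *: h y) 0 j) = a * (fun y => h y 0 j).
  by apply: funext => y; rewrite mxE.
have dj j : differentiable (fun y => h y 0 j) x by exact: differentiable_coord_fun.
have dg : differentiable (fun y => a y *: h y) x.
  by apply: differentiable_of_coords => j; rewrite E; exact: differentiableM.
split => //; apply/rowP => j.
have [_ <-] := derive_coord j (diff_derivable (v := v) dg).
have [_ hE] := derive_coord j (diff_derivable (v := v) dh).
rewrite E deriveM; [|exact: diff_derivable|exact: diff_derivable].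
by rewrite hE !mxE addrC [_ *: 'D_v a x]mulrC.
Qed.

Lemma derive_sum_fun (V W : normedModType R) n (f : 'I_n -> V -> W) x v :
  (forall k, differentiable (f k) x) ->
  differentiable (fun y => \sum_k f k y) x /\
  'D_v (fun y => \sum_k f k y) x = \sum_k 'D_v (f k) x.
Proof.
move=> df; have E : (fun y => \sum_k f k y) = \sum_k f k.
  by apply: funext => y; rewrite fct_sumE.
rewrite E; split; first exact: differentiable_sum.
by rewrite derive_sum // => k; exact: diff_derivable.
Qed.

End Calculus.

Section Bracket.
Variables (R : realType) (n : nat) (G : lieGroupType R n) (phi : chart R n G).
Hypotheses (aphi : lie_atlas phi) (phi1 : chart_dom phi 1%g).
Local Notation e := (phi 1%g).
Local Notation inv := (chart_inv phi).
Local Notation rAd := (real_Ad phi).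
Local Notation m := (chart_mul phi phi phi).
Local Notation opp := (chart_opp phi phi).
Local Notation b k := (delta_mx 0 k : 'rV[R]_n).

Let ie := inv_e phi1.
Let ei := e_img phi1.

Let ok y := chart_img phi y /\ chart_dom phi (inv y)^-1%g.

Let ok_e : ok e.
Proof. by split => //; rewrite ie invg1. Qed.

Let near_ok : \forall y \near e, ok y.
Proof.
have c : {for e, continuous (fun y => ((inv y)^-1)%g)}.
  apply: (@continuous_comp _ _ _ inv (fun x : G => x^-1%g)).
    exact: chart_inv_cvg ei.
  exact: lie_inv_continuous.
have d1 : chart_dom phi (inv e)^-1%g by rewrite ie invg1.
have n1 : \forall y \near e, chart_dom phi (inv y)^-1%g by exact: (c _ (chart_near d1)).
have n2 := near_img phi1.
by near=> y; split; near: y.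
Unshelve. all: by end_near. Qed.

Let m_right y : chart_img phi y -> m (y, e) = y.
Proof. by move=> /chart_invK [_ yE]; rewrite /chart_mul /= ie mulg1. Qed.
Let m_left y : chart_img phi y -> m (e, y) = y.
Proof. by move=> /chart_invK [_ yE]; rewrite /chart_mul /= ie mul1g. Qed.

Let sm_right y : chart_img phi y -> smooth_at m (y, e).
Proof.
move=> iy; apply: smooth_chart_mul => //.
by rewrite ie mulg1; have [] := chart_invK iy.
Qed.

Let sm_opp y : ok y -> smooth_at m (y, opp y).
Proof.
move=> [iy dy]; apply: smooth_chart_mul => //.
  exact: (chart_imgP dy).
by rewrite /chart_opp (chart_funK dy) mulgV.
Qed.

Let opp_e : opp e = e. Proof. by rewrite /chart_opp ie invg1. Qed.

Let dm_right y : chart_img phi y -> differentiable m (y, e).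
Proof. by move=> iy; apply: pair_differentiable; exact: sm_right. Qed.
Let dm_opp y : ok y -> differentiable m (y, opp y).
Proof. by move=> oy; apply: pair_differentiable; exact: sm_opp. Qed.

Let did (x : 'rV[R]_n) : differentiable (fun v : 'rV[R]_n => v) x.
Proof. exact: differentiable_idfun. Qed.
Let dcst (W : normedModType R) (a : W) (x : 'rV[R]_n) : differentiable (fun=> a) x.
Proof. exact: differentiable_cst. Qed.

Let partial1 (f : 'rV[R]_n * 'rV[R]_n -> 'rV[R]_n) y z v : differentiable f (y, z) ->
  differentiable (fun y => f (y, z)) y /\ 'D_v (fun y => f (y, z)) y = 'D_(v, 0) f (y, z).
Proof.
pose P (y : 'rV[R]_n) := (y, z) => df.
have [dp pE] : differentiable P y /\ _ := derive_pair v (did y) (dcst z y).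
have pE' : 'D_v P y = (v, 0).
  exact: (etrans pE (congr2 pair (derive_id y v) (derive_cst z y v))).
have [dc cE] := @derive_comp _ _ _ _ P f y v dp df; split; first exact: dc.
exact: (etrans cE (congr1 (fun u => 'D_u f (y, z)) pE')).
Qed.
Let partial2 (f : 'rV[R]_n * 'rV[R]_n -> 'rV[R]_n) y z v : differentiable f (y, z) ->
  differentiable (fun z => f (y, z)) z /\ 'D_v (fun z => f (y, z)) z = 'D_(0, v) f (y, z).
Proof.
pose P (z : 'rV[R]_n) := (y, z) => df.
have [dp pE] : differentiable P z /\ _ := derive_pair v (dcst y z) (did z).
have pE' : 'D_v P z = (0, v).
  exact: (etrans pE (congr2 pair (derive_cst y z v) (derive_id z v))).
have [dc cE] := @derive_comp _ _ _ _ P f z v dp df; split; first exact: dc.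
exact: (etrans cE (congr1 (fun u => 'D_u f (y, z)) pE')).
Qed.

(** Conjugation by the point y of the chart is m(m(y,z),y^-1); the chain rule at
    z = e makes Ad an expression in first derivatives of m. *)
Lemma real_Ad_formula y w : ok y ->
  rAd (inv y) w = 'D_('D_(0, w) m (y, e), 0) m (y, opp y).
Proof.
move=> oy; have [iy dy] := oy; have [dy' yE] := chart_invK iy.
have [d1 E1] := partial2 w (dm_right iy).
have d2' : differentiable m (m (y, e), opp y) by rewrite m_right //; exact: dm_opp.
have [d2 E2] := partial1 ('D_(0, w) m (y, e)) d2'.
have [d3 E3] := derive_comp w d1 d2.
rewrite /real_Ad; apply: etrans (etrans E3 _); last by rewrite E1 E2 m_right.
apply: near_eq_derive.
have c : {for e, continuous (fun z => (inv y * inv z)%g)}.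
  apply: mul_continuous_at; [exact: cst_continuous | exact: chart_inv_cvg ei].
have dz : chart_dom phi (inv y * inv e)%g by rewrite ie mulg1.
have n1 : \forall z \near e, chart_dom phi (inv y * inv z)%g by exact: (c _ (chart_near dz)).
apply: filterS n1 => z zd.
by rewrite /= /chart_mul /chart_opp /= (chart_funK zd) (chart_funK dy).
Qed.

(* The direction in [real_Ad_formula] depends on y; expanding it in coordinates
   leaves sums of products of functions of y. *)
Let a w k y : R := 'D_(0, w) m (y, e) 0 k.
Let h k y : 'rV[R]_n := 'D_(b k, 0) m (y, opp y).

Let real_Ad_sum w y : ok y -> rAd (inv y) w = \sum_k a w k y *: h k y.
Proof.
move=> oy; rewrite real_Ad_formula // /a; set u := 'D_(0, w) m (y, e).
have lD := derive_dir_linear (dm_opp oy).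
have -> : (u, 0) = \sum_k u 0 k *: (b k, 0 : 'rV[R]_n).
  have fE (s : seq 'I_n) : \sum_(k <- s) u 0 k *: (b k, 0 : 'rV[R]_n) =
      (\sum_(k <- s) u 0 k *: b k, 0).
    elim: s => [|k s IHs]; first by rewrite !big_nil.
    rewrite !big_cons IHs; apply/pair_equal_spec; split => //=.
    by rewrite scaler0 addr0.
  by rewrite fE -row_sum_delta.
by rewrite (lin_sum lD); apply: eq_bigr => k _; rewrite (linZ lD).
Qed.

Let da w k y : chart_img phi y -> differentiable (a w k) y.
Proof.
move=> iy; have sm := smooth_at_derive (0, w) (sm_right iy).
have [d _] := partial1 0 (pair_differentiable sm).
exact: differentiable_coord_fun.
Qed.

Let dopp y : ok y -> differentiable opp y.
Proof. by move=> [iy dy]; apply: rV_differentiable; exact: smooth_chart_opp. Qed.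

Let pair_opp y v : ok y -> differentiable (fun y => (y, opp y)) y /\
  'D_v (fun y => (y, opp y)) y = (v, 'D_v opp y).
Proof.
move=> oy; have [dp pE] := derive_pair v (did y) (dopp oy); split; first exact: dp.
exact: (etrans pE (congr1 (fun u => (u, _)) (derive_id y v))).
Qed.

Let dh k y v : ok y -> differentiable (h k) y /\
  'D_v (h k) y = 'D_(v, 'D_v opp y) ('D_(b k, 0) m) (y, opp y).
Proof.
move=> oy; have [dp pE] := pair_opp v oy.
have dD : differentiable ('D_(b k, 0) m) (y, opp y).
  by apply: pair_differentiable; apply: smooth_at_derive; exact: sm_opp.
have [dc cE] := @derive_comp _ _ _ _ (fun y => (y, opp y)) ('D_(b k, 0) m) y v dp dD.
split; first exact: dc.
exact: (etrans cE (congr1 (fun u => 'D_u ('D_(b k, 0) m) (y, opp y)) pE)).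
Qed.

Let F w y := rAd (inv y) w.

Let F_near w : \forall y \near e, \sum_k a w k y *: h k y = F w y.
Proof. by apply: filterS near_ok => y oy; rewrite /F real_Ad_sum. Qed.

Let sum_derive w v : differentiable (fun y => \sum_k a w k y *: h k y) e /\
  'D_v (fun y => \sum_k a w k y *: h k y) e =
  \sum_k ('D_v (a w k) e *: h k e + a w k e *: 'D_v (h k) e).
Proof.
have dk k : differentiable (fun y => a w k y *: h k y) e.
  by have [] := derive_scale_fun v (da w k ei) (proj1 (dh k v ok_e)).
have [d E] := derive_sum_fun v dk; split; first exact: d.
apply: (etrans E); apply: eq_bigr => k _.
by have [_ ->] := derive_scale_fun v (da w k ei) (proj1 (dh k v ok_e)).
Qed.

Lemma real_Ad_differentiable w : differentiable (F w) e.
Proof.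
have [d _] := sum_derive w 0.
exact: (proj1 (near_eq_diff (F_near w) d)).
Qed.

Local Notation brk := (real_bracket phi).

Lemma real_bracket_linearl w : linear (fun v => brk v w).
Proof. exact: (derive_dir_linear (real_Ad_differentiable w)). Qed.

Lemma real_bracket_linearr v : linear (brk v).
Proof.
move=> k w w'; rewrite /real_bracket.
have -> : (fun y => rAd (inv y) (k *: w + w')) = k \*: F w + F w'.
  by apply: funext => y; rewrite real_Ad_linear.
have d1 := diff_derivable (v := v) (real_Ad_differentiable w).
have d2 := diff_derivable (v := v) (real_Ad_differentiable w').
rewrite deriveD; [|exact: derivableZ|exact: d2].
by rewrite deriveZ.
Qed.

Let beta v w := 'D_(v, 0) ('D_(0, w) m) (e, e).

Let D10 v : 'D_(v, 0) m (e, e) = v.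
Proof.
have [_ <-] := partial1 v (dm_right ei).
apply: (etrans _ (derive_id e v)); apply: near_eq_derive.
by apply: filterS (near_img phi1) => y iy; rewrite m_right.
Qed.

Let D01 v : 'D_(0, v) m (e, e) = v.
Proof.
have [_ <-] := partial2 v (dm_right ei).
apply: (etrans _ (derive_id e v)); apply: near_eq_derive.
by apply: filterS (near_img phi1) => y iy; rewrite m_left.
Qed.

Let D10_right y v : chart_img phi y -> 'D_(v, 0) m (y, e) = v.
Proof.
move=> iy; have [_ <-] := partial1 v (dm_right iy).
apply: (etrans _ (derive_id y v)); apply: near_eq_derive.
by apply: filterS (chart_img_near iy) => z iz; rewrite m_right.
Qed.

Let pair_split (u v : 'rV[R]_n) : (u, v) = (u, 0) + (0, v).
Proof. by apply/pair_equal_spec; rewrite addr0 add0r. Qed.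

Let Dopp v : 'D_v opp e = - v.
Proof.
have [dp pE] := pair_opp v ok_e.
have [dc cE] := @derive_comp _ _ _ _ (fun y => (y, opp y)) m e v dp (dm_opp ok_e).
have c0 : 'D_v (m \o (fun y => (y, opp y))) e = 0.
  apply: (etrans _ (derive_cst e e v)); apply: near_eq_derive.
  apply: filterS near_ok => y [iy dy].
  by rewrite /= /chart_mul /chart_opp /= (chart_funK dy) mulgV.
have E : 'D_(v, 'D_v opp e) m (e, opp e) = 0.
  by rewrite -c0 cE; exact: (congr1 (fun u => 'D_u m (e, opp e)) (esym pE)).
have lD := derive_dir_linear (dm_right ei).
move: E; rewrite opp_e (pair_split v ('D_v opp e)) (linD lD) D10 D01 => /eqP.
by rewrite addr_eq0 => /eqP E; rewrite [in RHS]E opprK.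
Qed.

(** Differentiating [real_Ad_formula] by the Leibniz rule, the first factor gives
    the mixed derivative in (v,w). The second gives minus the one in (w,v): the
    inversion has derivative -1 at e, m(y,e) = y has no second derivative, and
    mixed derivatives are symmetric. *)
Lemma real_bracketE v w : brk v w = beta v w - beta w v.
Proof.
have [_ E] := sum_derive w v.
have -> : brk v w = \sum_k ('D_v (a w k) e *: h k e + a w k e *: 'D_v (h k) e).
  apply: (etrans _ E); apply: near_eq_derive.
  by apply: filterS (F_near w) => y /esym.
have aE k : a w k e = w 0 k by rewrite /a D01.
have hE k : h k e = b k by rewrite /h opp_e D10.
have DaE k : 'D_v (a w k) e = beta v w 0 k.
  have sm := pair_differentiable (smooth_at_derive (0, w) (sm_right ei)).
  have [d pE] := partial1 v sm.
  have [_ cE] := derive_coord k (diff_derivable (v := v) d).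
  exact: (etrans cE (congr1 (fun M : 'rV[R]_n => M 0 k) pE)).
have DhE k : 'D_v (h k) e = - beta (b k) v.
  have [_ ->] := dh k v ok_e; rewrite Dopp opp_e (pair_split v (- v)).
  have sm := pair_differentiable (smooth_at_derive (b k, 0) (sm_right ei)).
  have lD := derive_dir_linear sm.
  have -> : (0, - v) = - (0, v) :> 'rV[R]_n * 'rV[R]_n.
    by apply/pair_equal_spec; rewrite oppr0.
  rewrite (linD lD) (linN lD).
  have -> : 'D_(v, 0) ('D_(b k, 0) m) (e, e) = 0.
    have [_ pE] := partial1 v sm.
    apply: (etrans (esym pE)); apply: (etrans _ (derive_cst (b k) e v)); apply: near_eq_derive.
    by apply: filterS (near_img phi1) => y iy; rewrite D10_right.
  by rewrite add0r /beta (smooth_at_swap _ _ (sm_right ei)).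
under eq_bigr do rewrite aE hE DaE DhE scalerN.
rewrite sumrB -row_sum_delta; congr (_ - _).
have lD := derive_dir_linear (pair_differentiable (smooth_at_derive (0, v) (sm_right ei))).
have wE : (w, 0) = \sum_k w 0 k *: (b k, 0 : 'rV[R]_n).
  have fE (s : seq 'I_n) : \sum_(k <- s) w 0 k *: (b k, 0 : 'rV[R]_n) =
      (\sum_(k <- s) w 0 k *: b k, 0).
    elim: s => [|k s IHs]; first by rewrite !big_nil.
    rewrite !big_cons IHs; apply/pair_equal_spec; split => //=.
    by rewrite scaler0 addr0.
  by rewrite fE -row_sum_delta.
rewrite /beta wE (lin_sum lD); apply: eq_bigr => k _.
by rewrite (linZ lD).
Qed.

Lemma real_bracketN v w : brk v w = - brk w v.
Proof. by rewrite !real_bracketE opprB. Qed.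

End Bracket.

(** * Curves in a Lie group *)

Section Curves.
Variables (R : realType) (n : nat) (G : lieGroupType R n) (phi : chart R n G).
Hypotheses (aphi : lie_atlas phi) (phi1 : chart_dom phi 1%g).
Local Notation e := (phi 1%g).
Local Notation inv := (chart_inv phi).
Local Notation rAd := (real_Ad phi).
Local Notation brk := (real_bracket phi).

(** Differentiate Ad(x) Ad(y) w = Ad(x y x^-1) Ad(x) w with respect to y at the
    identity. *)
Lemma real_Ad_bracket x v w : rAd x (brk v w) = brk (rAd x v) (rAd x w).
Proof.
pose F w y := rAd (inv y) w.
have dF w' : differentiable (F w') e := real_Ad_differentiable aphi phi1 w'.
pose L : {linear 'rV[R]_n -> 'rV[R]_n} := 'd (conj_chart phi x) e.
have dc := conj_differentiable aphi phi1 x.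
have Lc : continuous L by exact: diff_continuous dc.
have rE u : rAd x u = L u by exact: real_AdE.
have dL y : differentiable L y by exact: linear_differentiable.
have DL y u : 'D_u L y = L u.
  exact: (etrans (deriveE _ (dL y)) (congr1 (fun M : _ -> _ => M u) (diff_lin y Lc))).
have [d1 E1] := derive_comp v (dF w) (dL (F w e)).
have dF' : differentiable (F (rAd x w)) (conj_chart phi x e).
  by rewrite conj_chart_e //; exact: dF.
have [d2 E2] := derive_comp v dc dF'.
have E3 : 'D_v (L \o F w) e = 'D_v (F (rAd x w) \o conj_chart phi x) e.
  apply: near_eq_derive; apply: filterS (conj_near phi1 x) => y dy.
  apply: (etrans (esym (rE (F w y)))).
  rewrite -[RHS]/(rAd (inv (conj_chart phi x y)) (rAd x w)) (inv_conj dy) /F.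
  by rewrite -(real_AdM aphi phi1 x) -(real_AdM aphi phi1 _ x) -[in RHS]mulgA mulVg mulg1.
apply: (etrans (rE _)); apply: (etrans (esym (DL (F w e) _))).
apply: (etrans (esym E1)); apply: (etrans E3); apply: (etrans E2).
exact: (congr1 (fun y => 'D_('D_v (conj_chart phi x) e) (F (rAd x w)) y)
  (conj_chart_e phi1 x)).
Qed.

Lemma real_Ad_curve (c : R -> G) v w : c 0 = 1%g -> {for 0, continuous c} ->
  is_derive (0 : R) (1 : R) (phi \o c) v ->
  is_derive (0 : R) (1 : R) (fun t => rAd (c t) w) (brk v w).
Proof.
move=> c0 cc [dc vE].
pose F w y := rAd (inv y) w.
have dc' : differentiable (phi \o c) 0 by apply/derivable1_diffP.
have dF : differentiable (F w) ((phi \o c) 0).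
  by rewrite /= c0; exact: real_Ad_differentiable.
have [d1 E1] := derive_comp (1 : R) dc' dF.
have near0 : \forall t \near 0, (F w \o (phi \o c)) t = rAd (c t) w.
  have d1' : chart_dom phi (c 0) by rewrite c0.
  have n1 : \forall t \near 0, chart_dom phi (c t) by exact: (cc _ (chart_near d1')).
  by apply: filterS n1 => t dt; rewrite /F /= chart_funK.
apply: (near_eq_is_derive near0); split; first exact: diff_derivable.
apply: (etrans E1); apply: (etrans (congr1 (fun u => 'D_u (F w) ((phi \o c) 0)) vE)).
exact: (congr1 (fun x => 'D_v (F w) (phi x)) c0).
Qed.

Lemma straight_curve v : let c (t : R) := inv (e + t *: v) in
  [/\ c 0 = 1%g, {for 0, continuous c} & is_derive (0 : R) (1 : R) (phi \o c) v].
Proof.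
move=> c.
have lc : {for (0 : R), continuous (fun t : R => e + t *: v)}.
  apply: cvgD; first exact: cvg_cst.
  by apply: cvgZ; [exact: cvg_id | exact: cvg_cst].
have e0 : e + (0 : R) *: v = e by rewrite scale0r addr0.
split; first by rewrite /c e0 inv_e.
  apply: (@continuous_comp _ _ _ (fun t : R => e + t *: v) inv); first exact: lc.
  by rewrite e0; apply: chart_inv_cvg; exact: e_img.
have n0 : \forall t \near (0 : R), chart_img phi (e + t *: v).
  have n1 : \forall y \near e + (0 : R) *: v, chart_img phi y by rewrite e0; exact: near_img.
  exact: (lc _ n1).
apply: (near_eq_is_derive (f := fun t : R => e + t *: v)).
  by apply: filterS n0 => t /chart_invK [_ tE]; rewrite /c /= tE.
have := @is_derive_line R _ _ idfun e v 0.
rewrite derive_id; apply; exact: derivable_id.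
Qed.

(** Conjugates of one-parameter subgroups of H by elements of H. *)
Lemma real_Lie_Ad (H : set G) h v : is_subgroup H -> H h ->
  real_Lie phi H v -> real_Lie phi H (rAd h v).
Proof.
move=> [H1 HM HV] Hh [c [cc cM Hc cv]].
have c0 : c 0 = 1%g.
  have := cM 0 0; rewrite addr0 => /(congr1 (fun x => (x * (c 0)^-1)%g)).
  by rewrite mulgV mulgK.
exists (fun t => (h * c t * h^-1)%g); split.
- move=> t; have hc : {for t, continuous (fun t => (h * c t)%g)}.
    by apply: mul_continuous_at; [exact: cst_continuous | exact: cc].
  exact: (mul_continuous_at hc (@cst_continuous _ _ (h^-1)%g t)).
- by move=> s t; rewrite cM !mulgA mulgVK.
- by move=> t; apply: (HM); [apply: (HM) | exact: HV].
- exact: (conj_curve aphi phi1 h c0 (cc 0) cv).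
Qed.

Lemma real_Lie_curve (H : set G) v : real_Lie phi H v -> exists c : R -> G,
  [/\ c 0 = 1%g, {for 0, continuous c}, is_derive (0 : R) (1 : R) (phi \o c) v
    & forall t, H (c t)].
Proof.
move=> [c [cc cM Hc cv]]; exists c; split => //; last exact: cc.
have := cM 0 0; rewrite addr0 => /(congr1 (fun x => (x * (c 0)^-1)%g)).
by rewrite mulgV mulgK.
Qed.

End Curves.

(** * Tangents of finite-dimensional curves *)

Section ComplexDerivative.
Variable R : realType.
Local Notation C := R[i].

Definition cderive0 (f : R -> C) (df : C) :=
  is_derive (0 : R) (1 : R) (fun t => complex.Re (f t)) (complex.Re df) /\
  is_derive (0 : R) (1 : R) (fun t => complex.Im (f t)) (complex.Im df).

Lemma cderive0_cst k : cderive0 (fun=> k) 0.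
Proof. by split; exact: is_derive_cst. Qed.

Lemma cderive0D f g df dg :
  cderive0 f df -> cderive0 g dg -> cderive0 (fun t => f t + g t) (df + dg).
Proof.
move=> [f1 f2] [g1 g2]; split.
  rewrite raddfD; under eq_fun do rewrite raddfD; exact: is_deriveD.
rewrite raddfD; under eq_fun do rewrite raddfD; exact: is_deriveD.
Qed.

Lemma cderive0M f g df dg : cderive0 f df -> cderive0 g dg ->
  cderive0 (fun t => f t * g t) (df * g 0 + f 0 * dg).
Proof.
move=> [f1 f2] [g1 g2]; split.
  have -> : (fun t => complex.Re (f t * g t)) =
      (fun t => complex.Re (f t) * complex.Re (g t)) -
      (fun t => complex.Im (f t) * complex.Im (g t)).
    by apply: funext => t; rewrite !fctE; case: (f t) (g t) => [a b] [a' b'].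
  apply: is_derive_eq; rewrite /GRing.scale /=.
  case: (f 0) (g 0) (df) (dg) => [a b] [a' b'] [x y] [x' y'] /=.
  ring.
have -> : (fun t => complex.Im (f t * g t)) =
    (fun t => complex.Re (f t) * complex.Im (g t)) +
    (fun t => complex.Im (f t) * complex.Re (g t)).
  by apply: funext => t; rewrite !fctE; case: (f t) (g t) => [a b] [a' b'].
apply: is_derive_eq; rewrite /GRing.scale /=.
case: (f 0) (g 0) (df) (dg) => [a b] [a' b'] [x y] [x' y'] /=.
ring.
Qed.

Lemma cderive0_unique f df dg : cderive0 f df -> cderive0 f dg -> df = dg.
Proof.
move=> [f1 f2] [g1 g2]; apply/eqP; rewrite eq_complex; apply/andP; split; apply/eqP.
  by rewrite -(derive_val (is_derive := f1)) -(derive_val (is_derive := g1)).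
by rewrite -(derive_val (is_derive := f2)) -(derive_val (is_derive := g2)).
Qed.

End ComplexDerivative.

Section Tangent.
Variable R : realType.
Local Notation C := R[i].

(** Orbits in the algebras at hand span finite-dimensional subspaces, so tangents
    can be defined by expansions in finitely many vectors, without a topology on
    U. The vectors are arbitrary; that the tangent of a constant curve does not
    depend on them is [tangent_const]. *)
Definition has_tangent (U : lmodType C) (gam : R -> U) (del : U) :=
  exists (I : finType) (e : I -> U) (f : I -> R -> C) (df : I -> C),
    [/\ forall i, cderive0 (f i) (df i), forall t, gam t = \sum_i f i t *: e i
      & del = \sum_i df i *: e i].

Lemma tangent_cst (U : lmodType C) (v : U) : has_tangent (fun=> v) 0.
Proof.
exists unit, (fun=> v), (fun _ _ => 1), (fun=> 0); split.
- by move=> _; exact: cderive0_cst.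
- by move=> _; rewrite big_const card_unit /= scale1r addr0.
- by rewrite big1 // => _ _; rewrite scale0r.
Qed.

Lemma tangentD (U : lmodType C) (gam gam' : R -> U) del del' :
  has_tangent gam del -> has_tangent gam' del' ->
  has_tangent (fun t => gam t + gam' t) (del + del').
Proof.
move=> [I [e [f [df [fdf gE ->]]]]] [I' [e' [f' [df' [fdf' gE' ->]]]]].
exists (I + I')%type, (fun i => match i with inl i => e i | inr i => e' i end),
  (fun i => match i with inl i => f i | inr i => f' i end),
  (fun i => match i with inl i => df i | inr i => df' i end); split.
- by case.
- by move=> t; rewrite gE gE' big_sumType.
- by rewrite big_sumType.
Qed.

Lemma tangent_bilinear (U V W : lmodType C) (Phi : U -> V -> W)
    (gam : R -> U) (gam' : R -> V) del del' :
  (forall y, linear (Phi^~ y)) -> (forall x, linear (Phi x)) ->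
  has_tangent gam del -> has_tangent gam' del' ->
  has_tangent (fun t => Phi (gam t) (gam' t)) (Phi del (gam' 0) + Phi (gam 0) del').
Proof.
move=> Pl Pr [I [e [f [df [fdf gE ->]]]]] [I' [e' [f' [df' [fdf' gE' ->]]]]].
have PE (x : I -> C) (y : I' -> C) :
    Phi (\sum_i x i *: e i) (\sum_i y i *: e' i) =
    \sum_(ij : I * I') (x ij.1 * y ij.2) *: Phi (e ij.1) (e' ij.2).
  rewrite -(pair_bigA _ (fun i i' => (x i * y i') *: Phi (e i) (e' i'))) /=.
  rewrite (lin_sum (Pl _)); apply: eq_bigr => i _.
  rewrite (linZ (Pl _)) (lin_sum (Pr _)) scaler_sumr; apply: eq_bigr => i' _.
  by rewrite (linZ (Pr _)) scalerA.
exists (I * I')%type, (fun ij => Phi (e ij.1) (e' ij.2)),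
  (fun ij t => f ij.1 t * f' ij.2 t),
  (fun ij => df ij.1 * f' ij.2 0 + f ij.1 0 * df' ij.2); split.
- by move=> ij; exact: cderive0M.
- by move=> t; rewrite gE gE' PE.
- rewrite gE gE' !PE -big_split; apply: eq_bigr => ij _ /=.
  by rewrite scalerDl.
Qed.

Lemma tangent_linear (U V : lmodType C) (Phi : U -> V) (gam : R -> U) del :
  linear Phi -> has_tangent gam del -> has_tangent (Phi \o gam) (Phi del).
Proof.
move=> lP [I [e [f [df [fdf gE ->]]]]].
exists I, (Phi \o e), f, df; split => //=.
- by move=> t; rewrite gE (lin_sum lP); apply: eq_bigr => i _; rewrite (linZ lP).
- by rewrite (lin_sum lP); apply: eq_bigr => i _; rewrite (linZ lP).
Qed.

(** If the vectors are dependent, one of them is eliminated and the number of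
    vectors drops; if they are independent, the coefficients are constant. *)
Lemma tangent_const_ord (U : lmodType C) (w : U) m (e : 'I_m -> U)
    (f : 'I_m -> R -> C) (df : 'I_m -> C) :
  (forall i, cderive0 (f i) (df i)) -> (forall t, w = \sum_i f i t *: e i) ->
  \sum_i df i *: e i = 0.
Proof.
elim: m e f df => [|m IHm] e f df fdf wE; first by rewrite big_ord0.
have [[x [xe [k xk]]]|indep] := pselect (exists x : 'I_m.+1 -> C,
    \sum_i x i *: e i = 0 /\ exists k, x k != 0).
  pose y i := - (x k)^-1 * x (lift k i).
  have ek : e k = \sum_i y i *: e (lift k i).
    move: xe; rewrite (bigD1_ord k) //= => /eqP; rewrite addr_eq0 => /eqP ekE.
    rewrite -[e k]scale1r -(mulVf xk) -scalerA ekE -scaleN1r scalerA scaler_sumr.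
    by apply: eq_bigr => i _; rewrite scalerA /y mulrN1.
  have subst (h : 'I_m.+1 -> C) : \sum_i h i *: e i =
      \sum_i (h k * y i + h (lift k i)) *: e (lift k i).
    rewrite (bigD1_ord k) //= [in LHS]ek scaler_sumr -big_split /=.
    by apply: eq_bigr => i _; rewrite scalerA scalerDl.
  rewrite subst.
  apply: (IHm _ (fun i t => f k t * y i + f (lift k i) t)) => [i|t].
    have := cderive0M (fdf k) (cderive0_cst (y i)); rewrite mulr0 addr0 => H.
    exact: cderive0D.
  by rewrite (wE t) subst.
apply: big1 => i _; suff -> : df i = 0 by rewrite scale0r.
suff fi : f i = fun=> f i 0.
  by apply: (cderive0_unique (fdf i)); rewrite fi; exact: cderive0_cst.
apply: funext => t; apply/eqP; rewrite -subr_eq0; apply/negPn/negP => ft.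
apply: indep; exists (fun i => f i t - f i 0); split; last by exists i.
under eq_bigr do rewrite scalerBl.
by rewrite sumrB -!wE subrr.
Qed.

Lemma tangent_const (U : lmodType C) (w : U) (gam : R -> U) del :
  (forall t, gam t = w) -> has_tangent gam del -> del = 0.
Proof.
move=> gw [I [e [f [df [fdf gE ->]]]]].
have enumE (F : I -> U) : \sum_i F i = \sum_(i < #|I|) F (enum_val i).
  exact: (reindex _ (onW_bij _ (@enum_val_bij I))).
rewrite enumE.
apply: (@tangent_const_ord _ w _ (fun i => e (enum_val i)) (fun i => f (enum_val i))).
  by move=> i; exact: fdf.
by move=> t; rewrite -(gw t) gE enumE.
Qed.

End Tangent.

(** * Infinitesimal invariance *)

Section SpinCommutator.
Variables (K : fieldType) (g W : lmodType K).
Variables (br : g -> g -> g) (B : g -> g -> K) (j : W -> g).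
Hypothesis two : 2%:R != 0 :> K.
Hypothesis Bl : forall y, linear_for *%R (B^~ y).
Hypothesis Br : forall x, linear_for *%R (B x).
Hypothesis Bsym : forall x y, B x y = B y x.
Hypothesis brr : forall x, linear (br x).
Hypothesis brN : forall x y, br x y = - br y x.
Hypothesis Binv : forall x y z, B (br x y) z = - B y (br x z).
Hypothesis j_lin : linear j.
Local Notation BW := (pullback_form B j).
Local Notation c := (generator (clifford_rel BW)).
Local Notation u := (generator (enveloping_rel br)).
Variables (n : nat) (p q : n.-tuple W).
Hypothesis pq_dual : forall y, y = \sum_l BW (tnth p l) y *: tnth q l.

Hypothesis qp_dual : forall y, y = \sum_l BW (tnth q l) y *: tnth p l.

Let BWl := pullback_linearl Bl j_lin.
Let BWr := pullback_linearr Br j_lin.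
Let BWs : forall x y, BW x y = BW y x := pullback_sym j Bsym.
Local Notation spinW := (spin br B j p q).
Local Notation P l := (j (tnth p l)).

Lemma cliff_commutator2 (x y z : W) :
  c x * c y * c z - c z * (c x * c y) = BW y z *: c x - BW x z *: c y.
Proof.
have H a b : c a * c b = BW a b *: (1 : clifford BW) - c b * c a.
  by rewrite -(cliff_anticomm two BWl BWs a b) addrK.
have E1 : c x * (c y * c z) = BW y z *: c x - c x * c z * c y.
  by rewrite (H y z) mulrBr -presented_scaleAr mulr1 mulrA.
have E2 : c x * c z * c y = BW x z *: c y - c z * (c x * c y).
  by rewrite (H x z) mulrBl -presented_scaleAl mul1r mulrA.
by rewrite -mulrA E1 E2 opprB addrA addrAC addrK.
Qed.

(** Commuting c_y with the quadratic terms contracts one of the two slots; the two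
    contractions are equal by antisymmetry, which cancels the factor 1/2. *)
Lemma spin_commutator x (y y' : W) : j y' = br x (j y) ->
  spinW x * c y - c y * spinW x = c y'.
Proof.
move=> y'E; pose f l l' := B x (br (P l) (P l')).
pose G := \sum_l B x (br (P l) (j y)) *: c (tnth q l).
have lc : linear c by exact: cliff_linear.
have GE : G = - c y'.
  rewrite [y' in RHS]pq_dual (lin_sum lc) -sumrN; apply: eq_bigr => l _.
  rewrite (linZ lc) -scaleNr; congr (_ *: _).
  by rewrite (cartan_swap12 Bl brN Binv) /pullback_form y'E.
rewrite /spin -presented_scaleAl -presented_scaleAr -scalerBr.
have -> : (\sum_l \sum_l' f l l' *: (c (tnth q l) * c (tnth q l'))) * c y -
    c y * (\sum_l \sum_l' f l l' *: (c (tnth q l) * c (tnth q l'))) =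
    \sum_l \sum_l' (f l l' *: (BW (tnth q l') y *: c (tnth q l)) -
      f l l' *: (BW (tnth q l) y *: c (tnth q l'))).
  rewrite (lin_sum (mulr_linear _)) (lin_sum (mull_linear _)) -sumrB.
  apply: eq_bigr => l _.
  rewrite (lin_sum (mulr_linear _)) (lin_sum (mull_linear _)) -sumrB.
  apply: eq_bigr => l' _.
  rewrite -presented_scaleAl -presented_scaleAr -scalerBr cliff_commutator2.
  by rewrite scalerBr.
have B0 z : B z 0 = 0 by have := Br z (-1) 0 0; rewrite scaler0 addr0 mulN1r addNr.
have fE (b : g -> g) : linear b ->
    \sum_l BW (tnth q l) y * B x (b (P l)) = B x (b (j y)).
  move=> lb; rewrite [y in RHS]qp_dual (lin_sum j_lin) (lin_sum lb).
  elim/big_rec2: _ => // l v1 v2 _ ->.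
  by rewrite (linZ j_lin) (linZ lb) Br.
have -> : \sum_l \sum_l' (f l l' *: (BW (tnth q l') y *: c (tnth q l)) -
      f l l' *: (BW (tnth q l) y *: c (tnth q l'))) = G + G.
  under eq_bigr do rewrite sumrB; rewrite sumrB; congr (_ + _).
    apply: eq_bigr => l _; rewrite -fE // scaler_suml; apply: eq_bigr => l' _.
    by rewrite scalerA mulrC.
  rewrite exchange_big -sumrN; apply: eq_bigr => l _.
  rewrite -fE // scaler_suml -sumrN; apply: eq_bigr => l' _.
  by rewrite scalerA /f (cartan_swap23 Bl Bsym brN) mulNr scaleNr opprK mulrC.
by rewrite GE scalerDr !scaleNr !scalerN opprK half_half.
Qed.

Lemma inf_action_gen x z :
  inf_action br B j p q x * tensor (u z) 1 - tensor (u z) 1 * inf_action br B j p q x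
  = tensor (u (br x z)) 1.
Proof.
rewrite /inf_action mulrDl mulrDr !tensorM !mul1r !mulr1 opprD addrACA subrr addr0.
by rewrite -env_comm (linB (tensor_linl _)).
Qed.

Lemma inf_action_cgen x y y' : j y' = br x (j y) ->
  inf_action br B j p q x * tensor 1 (c y) - tensor 1 (c y) * inf_action br B j p q x
  = tensor 1 (c y').
Proof.
move=> y'E; rewrite /inf_action mulrDl mulrDr !tensorM !mul1r !mulr1 opprD addrACA.
by rewrite subrr add0r -(spin_commutator y'E) (linB (tensor_linr _)).
Qed.

End SpinCommutator.

Section InfinitesimalInvariance.
Variable R : realType.
Local Notation C := R[i].
Variables (g W : lmodType C).
Variables (br : g -> g -> g) (B : g -> g -> C) (j : W -> g).
Hypothesis two : 2%:R != 0 :> C.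
Hypothesis Bl : forall y, linear_for *%R (B^~ y).
Hypothesis Br : forall x, linear_for *%R (B x).
Hypothesis Bsym : forall x y, B x y = B y x.
Hypothesis brr : forall x, linear (br x).
Hypothesis brN : forall x y, br x y = - br y x.
Hypothesis Binv : forall x y z, B (br x y) z = - B y (br x z).
Hypothesis j_lin : linear j.
Local Notation BW := (pullback_form B j).
Local Notation c := (generator (clifford_rel BW)).
Local Notation u := (generator (enveloping_rel br)).
Variables (n : nat) (p q : n.-tuple W).
Hypothesis pq_dual : forall y, y = \sum_l BW (tnth p l) y *: tnth q l.
Hypothesis qp_dual : forall y, y = \sum_l BW (tnth q l) y *: tnth p l.

Variables (A : R -> g -> g) (AW : R -> W -> W) (x : g) (adx : W -> W).
Hypotheses (A_lin : forall t, linear (A t)) (AW_lin : forall t, linear (AW t)).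
Hypothesis A_br : forall t y z, A t (br y z) = br (A t y) (A t z).
Hypothesis AW_iso : forall t y z, BW (AW t y) (AW t z) = BW y z.
Hypotheses (A0 : forall y, A 0 y = y) (AW0 : forall y, AW 0 y = y).
Hypothesis A_tangent : forall y, has_tangent (A^~ y) (br x y).
Hypothesis AW_tangent : forall y, has_tangent (AW^~ y) (adx y).
Hypothesis adxE : forall y, j (adx y) = br x (j y).

Let BWl := pullback_linearl Bl j_lin.
Let BWr := pullback_linearr Br j_lin.
Let BWs : forall x y, BW x y = BW y x := pullback_sym j Bsym.
Local Notation L := (inf_action br B j p q x).
Local Notation gU t := (presented_map (enveloping_rel br) (A t) : enveloping br -> _).
Local Notation gC t := (presented_map (clifford_rel BW) (AW t) : clifford BW -> _).

Let gU_rel t := env_map_rel (A_lin t) (A_br t).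
Let gC_rel t r : clifford_rel BW r -> forall v : clifford BW,
  free_act (fun y v => c (AW t y) * v) r v = 0.
Proof. by apply: cl_map_rel => //; exact: AW_iso. Qed.

Let mul_bil (K : comNzRingType) (X : choiceType) (S : set (free_algebra K X)) :
  (forall y, linear ((fun a b : presented S => a * b : presented S)^~ y)) /\
  (forall a, linear ((fun a b : presented S => a * b : presented S) a)).
Proof. by split=> y; [exact: mulr_linear | exact: mull_linear]. Qed.

Let gU0 v : gU 0 v = v.
Proof.
move: v; apply: presented_ind => [|k v v' IH IH'|y v IH].
- exact: presented_map1 (gU_rel 0).
- by rewrite (presented_map_lin (gU_rel 0)) IH IH'.
- by rewrite (presented_map_genM (gU_rel 0)) IH A0.
Qed.

Let gC0 v : gC 0 v = v.
Proof.
move: v; apply: presented_ind => [|k v v' IH IH'|y v IH].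
- exact: presented_map1 (@gC_rel 0).
- by rewrite (presented_map_lin (@gC_rel 0)) IH IH'.
- by rewrite (presented_map_genM (@gC_rel 0)) IH AW0.
Qed.

(* The commutator with L is a derivation that agrees on generators with the
   tangent of the group action; the Leibniz rule for tangents extends this to the
   two factors by induction on words. *)
Let comm (w : weil br B j) : weil br B j := L * w - w * L.

Let commM w w' : comm (w * w') = comm w * w' + w * comm w'.
Proof. by rewrite /comm mulrBl mulrBr !mulrA subrKA. Qed.

Let comm_lin : linear comm.
Proof.
by move=> k v w; rewrite /comm mull_linear mulr_linear opprD addrACA scalerBr.
Qed.

Let gU_tangent v : has_tangent (fun t => tensor (gU t v) 1 : weil br B j)
  (comm (tensor v 1)).
Proof.
move: v; apply: presented_ind => [|k v v' IH IH'|y v IH].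
- have -> : comm (tensor 1 1) = 0 by rewrite /comm tensor11 mulr1 mul1r subrr.
  under eq_fun => t do rewrite (presented_map1 (gU_rel t)).
  exact: tangent_cst.
- rewrite tensor_linl comm_lin.
  under eq_fun => t do rewrite (presented_map_lin (gU_rel t)) tensor_linl.
  apply: tangentD => //.
  by apply: (tangent_linear (Phi := fun w => k *: w)) => // a b d;
    rewrite scalerDr !scalerA mulrC.
have tE z z' : tensor (z * z') 1 = tensor z 1 * tensor z' 1 :> weil br B j.
  by rewrite tensorM mulr1.
have Lgen : comm (tensor (u y) 1) = tensor (u (br x y)) 1 by exact: inf_action_gen.
rewrite tE commM Lgen.
under eq_fun => t do rewrite (presented_map_genM (gU_rel t)) tE.
have -> : tensor (u (br x y)) 1 * tensor v 1 = tensor (u (br x y)) 1 * tensor (gU 0 v) 1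
  :> weil br B j by rewrite gU0.
rewrite -[in tensor (u y) 1](A0 y).
apply: (tangent_bilinear (proj1 (mul_bil _)) (proj2 (mul_bil _)) _ IH).
apply: (tangent_linear (Phi := fun z => tensor (u z) 1 : weil br B j)) => //.
by move=> k z z'; rewrite env_linear tensor_linl.
Qed.

Let gC_tangent v : has_tangent (fun t => tensor 1 (gC t v) : weil br B j)
  (comm (tensor 1 v)).
Proof.
move: v; apply: presented_ind => [|k v v' IH IH'|y v IH].
- have -> : comm (tensor 1 1) = 0 by rewrite /comm tensor11 mulr1 mul1r subrr.
  under eq_fun => t do rewrite (presented_map1 (@gC_rel t)).
  exact: tangent_cst.
- rewrite tensor_linr comm_lin.
  under eq_fun => t do rewrite (presented_map_lin (@gC_rel t)) tensor_linr.
  apply: tangentD => //.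
  by apply: (tangent_linear (Phi := fun w => k *: w)) => // a b d;
    rewrite scalerDr !scalerA mulrC.
have tE z z' : tensor 1 (z * z') = tensor 1 z * tensor 1 z' :> weil br B j.
  by rewrite tensorM mulr1.
have Lgen : comm (tensor 1 (c y)) = tensor 1 (c (adx y)) by exact: inf_action_cgen.
rewrite tE commM Lgen.
under eq_fun => t do rewrite (presented_map_genM (@gC_rel t)) tE.
have -> : tensor 1 (c (adx y)) * tensor 1 v = tensor 1 (c (adx y)) * tensor 1 (gC 0 v)
  :> weil br B j by rewrite gC0.
rewrite -[in tensor 1 (c y)](AW0 y).
apply: (tangent_bilinear (proj1 (mul_bil _)) (proj2 (mul_bil _)) _ IH).
apply: (tangent_linear (Phi := fun z => tensor 1 (c z) : weil br B j)) => //.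
by move=> k z z'; rewrite cliff_linear tensor_linr.
Qed.

(** The curve of the images of w has tangent [L, w]; it is constant. *)
Lemma infinitesimal_invariance w :
  (forall t, weil_map (A t) (AW t) w = w) -> L * w = w * L.
Proof.
move=> w_inv; apply/eqP; rewrite -subr_eq0; apply/eqP.
apply: (tangent_const w_inv); move: (w).
have lin t : linear (weil_map (br := br) (B := B) (j := j) (A t) (AW t)).
  by apply: tensor_map_lin; [exact: presented_map_lin (gU_rel t)
                            | exact: presented_map_lin (@gC_rel t)].
apply: tensor_ind => [k v v' IH IH'|a b].
  rewrite -/(comm _) comm_lin; under eq_fun => t do rewrite lin.
  apply: tangentD => //.
  by apply: (tangent_linear (Phi := fun w => k *: w)) => // a b d;
    rewrite scalerDr !scalerA mulrC.
have tE z z' : tensor z z' = tensor z 1 * tensor 1 z' :> weil br B j.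
  by rewrite tensorM mulr1 mul1r.
rewrite -/(comm _) tE commM.
have E t : weil_map (A t) (AW t) (tensor a b) = tensor (gU t a) 1 * tensor 1 (gC t b)
    :> weil br B j.
  rewrite -tE; apply: tensor_mapE; [exact: presented_map_lin (gU_rel t)
                            | exact: presented_map_lin (@gC_rel t)].
under eq_fun => t do rewrite -tE E.
rewrite -[in tensor 1 b](gC0 b) -[in tensor a 1](gU0 a).
have := tangent_bilinear (proj1 (mul_bil _)) (proj2 (mul_bil _)) (gU_tangent a) (gC_tangent b).
by rewrite !gU0 !gC0.
Qed.

End InfinitesimalInvariance.

(** * Complexification *)

Section Complexify.
Variables (R : realType) (n : nat).
Local Notation C := R[i].
Implicit Types (z w : 'rV[C]_n) (v : 'rV[R]_n) (k : C).

Lemma re_partE z i : re_part z 0 i = complex.Re (z 0 i).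
Proof. by rewrite mxE. Qed.
Lemma im_partE z i : im_part z 0 i = complex.Im (z 0 i).
Proof. by rewrite mxE. Qed.

Lemma re_partP k z w : re_part (k *: z + w) =
  complex.Re k *: re_part z - complex.Im k *: im_part z + re_part w.
Proof.
by apply/rowP => i; rewrite !mxE; case: k (z 0 i) (w 0 i) => a b [c d] [x y].
Qed.

Lemma im_partP k z w : im_part (k *: z + w) =
  complex.Re k *: im_part z + complex.Im k *: re_part z + im_part w.
Proof.
by apply/rowP => i; rewrite !mxE; case: k (z 0 i) (w 0 i) => a b [c d] [x y].
Qed.

Lemma re_im_eq z w : re_part z = re_part w -> im_part z = im_part w -> z = w.
Proof.
move=> /rowP zwr /rowP zwi; apply/rowP => i; apply/eqP.
by rewrite eq_complex -!re_partE -!im_partE zwr zwi !eqxx.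
Qed.

Lemma re_cplx v : re_part (cplx v) = v.
Proof. by apply/rowP => i; rewrite !mxE. Qed.
Lemma im_cplx v : im_part (cplx v) = 0.
Proof. by apply/rowP => i; rewrite !mxE. Qed.

Definition of_parts (v w : 'rV[R]_n) : 'rV[C]_n := cplx v + 'i%C *: cplx w.

Lemma re_of_parts (v w : 'rV[R]_n) : re_part (of_parts v w) = v.
Proof.
rewrite /of_parts addrC re_partP re_cplx im_cplx re_cplx /=.
by rewrite scale0r scaler0 subr0 add0r.
Qed.
Lemma im_of_parts (v w : 'rV[R]_n) : im_part (of_parts v w) = w.
Proof.
rewrite /of_parts addrC im_partP re_cplx !im_cplx /=.
by rewrite scaler0 add0r scale1r addr0.
Qed.
Lemma partsE z : z = of_parts (re_part z) (im_part z).
Proof. by apply: re_im_eq; rewrite ?re_of_parts ?im_of_parts. Qed.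

Definition cext (f : 'rV[R]_n -> 'rV[R]_n) z := of_parts (f (re_part z)) (f (im_part z)).

Lemma re_cext f z : re_part (cext f z) = f (re_part z).
Proof. exact: re_of_parts. Qed.
Lemma im_cext f z : im_part (cext f z) = f (im_part z).
Proof. exact: im_of_parts. Qed.

Lemma cext_linear f : linear f -> linear (cext f).
Proof.
move=> lf k z w; apply: re_im_eq.
  rewrite re_partP !re_cext im_cext re_partP.
  by rewrite (linD lf) (linB lf) !(linZ lf).
rewrite im_partP !im_cext re_cext im_partP.
by rewrite !(linD lf) !(linZ lf).
Qed.

Lemma cext_id f z : (forall v, f v = v) -> cext f z = z.
Proof. by move=> fE; rewrite /cext !fE -partsE. Qed.

Lemma cext_comp f f1 f2 z : (forall v, f v = f1 (f2 v)) -> cext f z = cext f1 (cext f2 z).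
Proof. by move=> fE; rewrite {1 2}/cext re_cext im_cext !fE. Qed.

Variable b : 'rV[R]_n -> 'rV[R]_n -> 'rV[R]_n.
Hypotheses (bl : forall v, linear (b^~ v)) (br : forall v, linear (b v)).

Definition cext2 z w := of_parts
  (b (re_part z) (re_part w) - b (im_part z) (im_part w))
  (b (re_part z) (im_part w) + b (im_part z) (re_part w)).

Lemma re_cext2 z w : re_part (cext2 z w) =
  b (re_part z) (re_part w) - b (im_part z) (im_part w).
Proof. exact: re_of_parts. Qed.
Lemma im_cext2 z w : im_part (cext2 z w) =
  b (re_part z) (im_part w) + b (im_part z) (re_part w).
Proof. exact: im_of_parts. Qed.

Lemma cext_cext2 f z w : linear f -> (forall v v', f (b v v') = b (f v) (f v')) ->
  cext f (cext2 z w) = cext2 (cext f z) (cext f w).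
Proof.
move=> lf fb; rewrite {1}/cext re_cext2 im_cext2 /cext2 !re_cext !im_cext.
by rewrite (linB lf) (linD lf) !fb.
Qed.

Lemma cext2N z w : (forall v v', b v v' = - b v' v) -> cext2 z w = - cext2 w z.
Proof.
have N1 (u : 'rV[C]_n) : re_part (- u) = - re_part u.
  by apply/rowP => i; rewrite !mxE; case: (u 0 i).
have N2 (u : 'rV[C]_n) : im_part (- u) = - im_part u.
  by apply/rowP => i; rewrite !mxE; case: (u 0 i).
move=> bN; apply: re_im_eq; rewrite ?N1 ?N2 ?re_cext2 ?im_cext2.
  by rewrite opprB addrC (bN (re_part z)) (bN (im_part z)) opprK.
by rewrite opprD addrC (bN (re_part z)) (bN (im_part z)).
Qed.

Lemma cext2_linearr z : linear (cext2 z).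
Proof.
have E w : cext2 z w = cext (b (re_part z)) w + 'i%C *: cext (b (im_part z)) w.
  apply: re_im_eq; rewrite addrC.
    by rewrite re_cext2 re_partP !re_cext im_cext /= scale0r scale1r sub0r addrC.
  by rewrite im_cext2 im_partP !im_cext re_cext /= scale0r scale1r add0r addrC.
move=> k w w'; rewrite !E !(cext_linear (br _)) !scalerDr !scalerA.
by rewrite [_ * k]mulrC addrACA.
Qed.

Lemma cext2_linearl w : (forall v v', b v v' = - b v' v) -> linear (cext2^~ w).
Proof.
move=> bN k z z'; rewrite (cext2N (k *: z + z') w bN) cext2_linearr opprD -scalerN.
by rewrite -(cext2N z w bN) -(cext2N z' w bN).
Qed.

Lemma cext2_cplx v w : cext2 (cplx v) w = of_parts (b v (re_part w)) (b v (im_part w)).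
Proof.
rewrite /cext2 re_cplx im_cplx (lin0 (bl (re_part w))) (lin0 (bl (im_part w))).
by rewrite subr0 addr0.
Qed.

End Complexify.

Section ComplexLie.
Variables (R : realType) (n : nat) (G : lieGroupType R n) (phi : chart R n G).
Hypotheses (aphi : lie_atlas phi) (phi1 : chart_dom phi 1%g).
Local Notation C := R[i].
Local Notation rAd := (real_Ad phi).
Local Notation rbr := (real_bracket phi).
Local Notation br := (bracket phi).
Local Notation Ad := (Ad phi).

Let bracketE z w : br z w = cext2 rbr z w. Proof. by []. Qed.
Let rbl w := real_bracket_linearl aphi phi1 w.
Let rbr_ v := real_bracket_linearr aphi phi1 v.

Lemma Ad_linear x : linear (Ad x).
Proof. exact: cext_linear (real_Ad_linear aphi phi1 x). Qed.

Lemma Ad1 z : Ad 1%g z = z.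
Proof. exact: cext_id (real_Ad1 phi1). Qed.

Lemma AdM x y z : Ad (x * y)%g z = Ad x (Ad y z).
Proof. exact: cext_comp (real_AdM aphi phi1 x y). Qed.

Lemma AdVK x z : Ad x (Ad x^-1%g z) = z.
Proof. by apply: (etrans (esym (AdM _ _ _))); rewrite mulgV; exact: Ad1. Qed.

Lemma Ad_bracket x z w : Ad x (br z w) = br (Ad x z) (Ad x w).
Proof.
exact: cext_cext2 (real_Ad_linear aphi phi1 x) (real_Ad_bracket aphi phi1 x).
Qed.

Lemma bracketN z w : br z w = - br w z.
Proof. exact: cext2N (real_bracketN aphi phi1). Qed.

Lemma bracket_linearr z : linear (br z).
Proof. exact: cext2_linearr rbr_ z. Qed.

Lemma bracket_linearl w : linear (br^~ w).
Proof. exact: cext2_linearl rbr_ w (real_bracketN aphi phi1). Qed.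

Lemma tangent_cplx (gam : R -> 'rV[R]_n) v :
  is_derive (0 : R) (1 : R) gam v -> has_tangent (fun t => cplx (gam t)) (cplx v).
Proof.
move=> [dg gE].
exists 'I_n, (fun k => delta_mx 0 k), (fun k t => (gam t 0 k)%:C%C), (fun k => (v 0 k)%:C%C).
split.
- move=> k; have [dk kE] := derive_coord k dg.
  split => /=; last exact: is_derive_cst.
  by split; [exact: dk | rewrite kE gE].
- by move=> t; rewrite [LHS]row_sum_delta; apply: eq_bigr => k _; rewrite mxE.
- by rewrite [LHS]row_sum_delta; apply: eq_bigr => k _; rewrite mxE.
Qed.

Lemma Ad_tangent (c : R -> G) v z : c 0 = 1%g -> {for 0, continuous c} ->
  is_derive (0 : R) (1 : R) (phi \o c) v ->
  has_tangent (fun t => Ad (c t) z) (br (cplx v) z).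
Proof.
move=> c0 cc cv.
rewrite bracketE (cext2_cplx rbl).
apply: tangentD.
  exact: (tangent_cplx (real_Ad_curve aphi phi1 (re_part z) c0 cc cv)).
apply: (tangent_linear (Phi := fun w => 'i%C *: w)).
  by move=> k w w'; rewrite scalerDr !scalerA mulrC.
exact: (tangent_cplx (real_Ad_curve aphi phi1 (im_part z) c0 cc cv)).
Qed.

End ComplexLie.

(** * Orthogonal splitting *)

Section OrthogonalSplitting.
Variables (F : fieldType) (vT : vectType F) (B : {symmetric vT}) (r : {vspace vT}).

Lemma form_linearl y : linear_for *%R (B^~ y).
Proof. by move=> k u v; rewrite linearPl. Qed.
Lemma form_linearr x : linear_for *%R (B x).
Proof. by move=> k u v; rewrite linearPr. Qed.
Lemma form_sym x y : B x y = B y x.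
Proof. by rewrite hermC expr0 mul1r. Qed.

Lemma form_suml (I : finType) (f : I -> vT) (k : I -> F) y :
  B (\sum_i k i *: f i) y = \sum_i k i * B (f i) y.
Proof.
rewrite (linear_sumlz B); apply: eq_bigr => i _.
by rewrite linearZl_LR.
Qed.

Hypothesis r_nondeg : (r :&: orthov B r = 0)%VS.
Let k := \dim r.
Let v := vbasis r.

(** The Gram matrix of a basis of r is invertible, and its inverse gives the dual
    family. *)
Lemma exists_dual_family : exists (m : nat) (a b : m.-tuple vT),
  [/\ forall i, tnth a i \in r, forall i, tnth b i \in r,
      forall i l, B (tnth b i) (tnth a l) = (i == l)%:R
    & forall x, x \in r -> exists c : 'I_m -> F, x = \sum_i c i *: tnth a i].
Proof.
have vr i : tnth v i \in r by apply: vbasis_mem; exact: mem_tnth.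
pose M : 'M[F]_k := \matrix_(i, l) B (tnth v i) (tnth v l).
have Mu : M \in unitmx.
  rewrite -row_free_unit; apply: inj_row_free => x /rowP xM.
  pose y := \sum_i x 0 i *: tnth v i.
  have yr : y \in r by apply: memv_suml => i _; exact: memvZ.
  have y0 : y = 0.
    apply/eqP; rewrite -memv0 -r_nondeg memv_cap yr /=; apply/mem_orthovP => z zr.
    rewrite (coord_vbasis zr) linear_sumr big1 //= => i _.
    rewrite linearZr_LR /= /y form_suml; have := xM i; rewrite !mxE => xMi.
    rewrite [X in _ * X](_ : _ = 0) ?mulr0 // -[RHS]xMi; apply: eq_bigr => l _.
    by rewrite !mxE -tnth_nth.
  have /freeP := basis_free (vbasisP r).
  move=> /(_ (x 0)) fr; apply/rowP => i; rewrite mxE.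
  by apply: fr; rewrite -[RHS]y0; apply: eq_bigr => l _; rewrite -tnth_nth.
pose b := [tuple \sum_l invmx M i l *: tnth v l | i < k].
exists k, v, b; split => //.
- by move=> i; rewrite tnth_mktuple; apply: memv_suml => l _; exact: memvZ.
- move=> i l; rewrite tnth_mktuple form_suml.
  have /matrixP/(_ i l) := mulVmx Mu; rewrite !mxE => <-.
  by apply: eq_bigr => l' _; rewrite !mxE.
move=> x xr; exists (fun i => coord v i x); rewrite {1}(coord_vbasis xr).
by apply: eq_bigr => i _; rewrite -tnth_nth.
Qed.

Section Projection.
Variables (m : nat) (a b : m.-tuple vT).
Hypotheses (ar : forall i, tnth a i \in r) (br : forall i, tnth b i \in r).
Hypothesis ba : forall i l, B (tnth b i) (tnth a l) = (i == l)%:R.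
Hypothesis a_span : forall x, x \in r -> exists c : 'I_m -> F, x = \sum_i c i *: tnth a i.

Definition horizontal_part (x : vT) : vT := x - \sum_i B (tnth b i) x *: tnth a i.

Lemma horizontal_part_linear : linear horizontal_part.
Proof.
move=> t x y; rewrite /horizontal_part scalerBr addrACA -opprD; congr (_ - _).
rewrite scaler_sumr -big_split; apply: eq_bigr => i _ /=.
by rewrite linearPr /= scalerDl scalerA.
Qed.

Lemma dual_family_expand y : y \in r -> y = \sum_l B y (tnth a l) *: tnth b l.
Proof.
move=> yr; apply/eqP; rewrite -subr_eq0 -memv0 -r_nondeg memv_cap; apply/andP; split.
  by rewrite rpredB //; apply: memv_suml => l _; exact: memvZ.
apply/mem_orthovP => z /a_span [c ->]; rewrite linear_sumr big1 //= => i _.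
rewrite linearZr_LR /= linearBl /= form_suml (bigD1 i) //= ba eqxx mulr1.
by rewrite big1 ?addr0 ?subrr ?mulr0 // => l /negPf li; rewrite ba li mulr0.
Qed.

Lemma horizontal_part_in x : horizontal_part x \in orthov B r.
Proof.
apply/mem_orthovP => y yr; rewrite (dual_family_expand yr) linear_sumr big1 //= => l _.
rewrite linearZr_LR /= linearBl /= form_suml (bigD1 l) //= (form_sym (tnth a l)) ba eqxx mulr1.
rewrite big1 => [|i /negPf il].
  by rewrite addr0 (form_sym x) subrr mulr0.
by rewrite (form_sym (tnth a i)) ba eq_sym il mulr0.
Qed.

(** A projection along one a_i leaves the pairings with the other b_l unchanged, so
    the composite subtracts all components at once. *)
Lemma horizontal_foldr x :
  foldr (fun ab f => drop_comp B ab.1 ab.2 \o f) id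
    [seq (tnth b i, tnth a i) | i <- enum 'I_m] x = horizontal_part x.
Proof.
have H (s : seq 'I_m) : uniq s ->
    foldr (fun ab f => drop_comp B ab.1 ab.2 \o f) id
      [seq (tnth b i, tnth a i) | i <- s] x =
    x - \sum_(i <- s) B (tnth b i) x *: tnth a i.
  elim: s => [|i s IHs] /=; first by rewrite big_nil subr0.
  move=> /andP[iNs /IHs ->]; rewrite /drop_comp linearBr linear_sumr /=.
  have -> : \sum_(l <- s) B (tnth b i) (B (tnth b l) x *: tnth a l) = 0.
    rewrite big_seq big1 // => l ls; rewrite linearZr_LR /= ba.
    by case: eqP => [il|_]; rewrite ?mulr0 //; rewrite il ls in iNs.
  by rewrite subr0 big_cons opprD addrA addrAC.
rewrite H ?enum_uniq // /horizontal_part; congr (_ - _).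
by rewrite -big_enum.
Qed.

End Projection.
End OrthogonalSplitting.

(** * Quadratic pairs *)

Section QuadraticPair.
Variables (R : realType) (n : nat) (G : lieGroupType R n) (phi : chart R n G).
Hypotheses (aphi : lie_atlas phi) (phi1 : chart_dom phi 1%g).
Variables (H : set G) (B : {symmetric 'rV[R[i]]_n}) (r : {vspace 'rV[R[i]]_n}).
Hypothesis GH : quadratic_pair phi H B r.
Local Notation C := R[i].
Local Notation g := 'rV[C]_n.
Local Notation br := (bracket phi).
Local Notation Ad := (Ad phi).
Local Notation p := (complement B r).

Lemma complex_natr_neq0 m : m.+1%:R != 0 :> C.
Proof. by rewrite pnatr_eq0. Qed.

(* Tangents are defined in modules, so B is given values in C^o. *)
Let Bo : g -> g -> C^o := fun x y => B x y.
Let Bol y : linear (Bo^~ y). Proof. exact: form_linearl. Qed.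
Let Bor x : linear (Bo x). Proof. exact: form_linearr. Qed.

Let real_skew (f h : g -> g) y z : linear f -> linear h ->
  (forall v, B (f (cplx v)) z = - B y (h (cplx v))) ->
  forall x, B (f x) z = - B y (h x).
Proof.
move=> lf lh E x; rewrite (partsE x) /of_parts addrC lf lh.
by rewrite (form_linearl B z) (form_linearr B y) (E (im_part x)) (E (re_part x))
  mulrN -opprD.
Qed.

(** For real x, differentiate the invariance of the form under Ad along a straight
    curve in the chart; real vectors span g over C. *)
Lemma form_invariant x y z : B (br x y) z = - B y (br x z).
Proof.
have real v : Bo (br (cplx v) y) z + Bo y (br (cplx v) z) = 0.
  have [c [c0 cc cv]] : exists c : R -> G, [/\ c 0 = 1%g, {for 0, continuous c}
      & is_derive (0 : R) (1 : R) (phi \o c) v].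
    by eexists; exact: (straight_curve phi1 v).
  have t1 := Ad_tangent aphi phi1 y c0 cc cv.
  have t2 := Ad_tangent aphi phi1 z c0 cc cv.
  have := tangent_bilinear Bol Bor t1 t2; rewrite c0 !(Ad1 phi1).
  by apply: (tangent_const (w := Bo y z)) => t; exact: (qp_invariant GH).
have E v : B (br (cplx v) y) z = - B y (br (cplx v) z).
  by apply/eqP; rewrite -addr_eq0; apply/eqP; exact: real.
exact: (real_skew (bracket_linearl aphi phi1 y) (bracket_linearl aphi phi1 z) E).
Qed.

Lemma cplx_Ad h v : Ad h (cplx v) = cplx (real_Ad phi h v).
Proof.
apply: (etrans (_ : _ = of_parts (real_Ad phi h v) (real_Ad phi h 0))).
  by rewrite /Defs.Ad re_cplx im_cplx.
rewrite (lin0 (real_Ad_linear aphi phi1 h)) /of_parts.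
have -> : cplx (0 : 'rV[R]_n) = 0 by apply/rowP => i; rewrite !mxE.
by rewrite scaler0 addr0.
Qed.

Lemma mem_Lie_span z : z \in r -> exists (m : nat) (k : 'I_m -> C) (v : 'I_m -> 'rV[R]_n),
  (forall i, real_Lie phi H (v i)) /\ z = \sum_i k i *: cplx (v i).
Proof.
move=> /(qp_Lie GH) [s sH]; rewrite -[X in span X]in_tupleE => /coord_span zE.
exists (size [seq cplx v | v <- s]), (fun i => coord (in_tuple [seq cplx v | v <- s]) i z).
exists (fun i => nth 0 s i); split.
  move=> i; apply: sH; apply: mem_nth; rewrite -(size_map (@cplx R n)).
  exact: ltn_ord.
rewrite {1}zE; apply: eq_bigr => i _; congr (_ *: _).
by rewrite /= (nth_map 0) // -(size_map (@cplx R n)); exact: ltn_ord.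
Qed.

Lemma real_Lie_in_r v : real_Lie phi H v -> cplx v \in r.
Proof.
move=> Hv; apply/(qp_Lie GH); exists [:: v]; first by move=> w; rewrite inE => /eqP ->.
by rewrite /= span_seq1 memv_line.
Qed.

Lemma Ad_r h z : H h -> z \in r -> Ad h z \in r.
Proof.
move=> Hh /mem_Lie_span [m [k [v [Hv ->]]]]; have lA := Ad_linear aphi phi1 h.
rewrite (lin_sum lA); apply: memv_suml => i _; rewrite (linZ lA) cplx_Ad.
apply: memvZ; apply: real_Lie_in_r.
exact: (real_Lie_Ad aphi phi1 (qp_subgroup GH) Hh).
Qed.

Lemma Ad_p h y : H h -> y \in p -> Ad h y \in p.
Proof.
move=> Hh /mem_orthovP yp; apply/mem_orthovP => a ar.
rewrite -(AdVK aphi phi1 h a) (qp_invariant GH); apply: yp.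
by apply: Ad_r => //; have [_ _ HV] := qp_subgroup GH; exact: HV.
Qed.

(** Pairings with r of the curve Ad(c(t))y vanish for c in H, so they vanish on
    its tangent. *)
Lemma bracket_r_p a y : a \in r -> y \in p -> br a y \in p.
Proof.
move=> /mem_Lie_span [m [k [v [Hv ->]]]] yp.
rewrite (lin_sum (bracket_linearl aphi phi1 y)); apply: memv_suml => i _.
rewrite (linZ (bracket_linearl aphi phi1 y)); apply: memvZ.
apply/mem_orthovP => b rb.
have [c [c0 cc cv Hc]] := real_Lie_curve (Hv i).
have t1 := Ad_tangent aphi phi1 y c0 cc cv.
apply: (tangent_const (U := C^o) (w := 0) _ (tangent_linear (Bol b) t1)) => t /=.
by have /mem_orthovP := Ad_p (Hc t) yp; apply.
Qed.

End QuadraticPair.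

(** * The relative Weil algebra *)

Section RelativeWeil.
Variables (K : fieldType) (g : vectType K) (br : g -> g -> g) (B : {symmetric g}).
Variable r : {vspace g}.
Hypothesis char0 : forall n, n.+1%:R != 0 :> K.
Let two := char0 1.
Hypothesis brl : forall y, linear (br^~ y).
Hypothesis brr : forall x, linear (br x).
Hypothesis brN : forall x y, br x y = - br y x.
Hypothesis Binv : forall x y z, B (br x y) z = - B y (br x z).
Hypothesis r_nondeg : (r :&: orthov B r = 0)%VS.
Local Notation p := (orthov B r).
Hypothesis br_rp : forall x y, x \in r -> y \in p -> br x y \in p.
Local Notation W := (subvs_of p).
Local Notation j := (@vsval K g p).
Local Notation BW := (pullback_form B j).
Local Notation BG := (pullback_form B idfun).
Local Notation WW := (weil br B idfun).
Local Notation Wp := (weil br B j).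
Local Notation c := (generator (clifford_rel BG)).
Local Notation cW := (generator (clifford_rel BW)).
Local Notation u := (generator (enveloping_rel br)).
Local Notation cl_map := (presented_map (clifford_rel BG) j : clifford BW -> clifford BG).

Let Bl := form_linearl B.
Let Br := form_linearr B.
Let Bs := form_sym B.

Lemma vsval_linear : linear j. Proof. exact: linearP. Qed.
Let jl := vsval_linear.
Let BGl : forall y, linear_for *%R (BG^~ y). Proof. exact: Bl. Qed.
Let BGr : forall y, linear_for *%R (BG y). Proof. exact: Br. Qed.
Let BGs : forall x y, BG x y = BG y x. Proof. exact: Bs. Qed.
Let BWl := pullback_linearl Bl jl.
Let BWr := pullback_linearr Br jl.
Let BWs : forall x y, BW x y = BW y x := pullback_sym j Bs.

Let perp x (y : W) : x \in r -> B x (j y) = 0.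
Proof. by move=> xr; rewrite Bs; have /mem_orthovP := subvsP y; apply. Qed.

Definition weil_inclusion : Wp -> WW := tensor_map idfun cl_map.
Local Notation Theta := weil_inclusion.

Let li : linear (idfun : enveloping br -> enveloping br). Proof. by []. Qed.
Let lj : linear cl_map. Proof. by apply: cl_map_lin => //; exact: BWl. Qed.

Lemma weil_inclusion_linear : linear Theta.
Proof. exact: tensor_map_lin. Qed.

Lemma weil_inclusionE x y : Theta (tensor x y) = tensor x (cl_map y).
Proof. exact: tensor_mapE. Qed.

Lemma weil_inclusion_gen x y : Theta (weil_tensor x (cW y)) = weil_tensor x (c (j y)).
Proof. by rewrite /weil_tensor weil_inclusionE; congr tensor; exact: cl_map_gen. Qed.

Lemma weil_inclusion_morphism : monoid_morphism Theta.
Proof.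
split; last first.
  by apply: tensor_mapM => // *; exact: cl_mapM.
by apply: tensor_map1 => //; exact: cl_map1.
Qed.

Lemma weil_inclusion_parity w : Theta (weil_parity w) = weil_parity (Theta w).
Proof. exact: Theta_parity. Qed.

Lemma weil_inclusion_inj : injective Theta.
Proof.
pose pr x : W := vsproj p x.
have prl : linear pr by exact: linearP.
have prK y : pr (j y) = y by exact: vsvalK.
have ThetaK w : tensor_map idfun (cl_retract (B := BG) BW pr) (Theta w) = w.
  exact: tensor_cl_mapK.
by move=> w w' ww'; rewrite -(ThetaK w) ww' ThetaK.
Qed.

(** For dual bases of r, the projections along single vectors compose to the
    orthogonal projection onto p, as [horizontal_image] asks. *)
Lemma weil_horizontalP (w : WW) :
  (forall x, x \in r -> weil_contract x w = 0) <-> exists w', w = Theta w'.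
Proof.
have cE x : tensor_map idfun (clifford_contract (B := BG) x) =
    tensor_map idfun (cl_contract x) :> (WW -> WW).
  by congr tensor_map; apply: funext => v; exact: clifford_contractE.
split=> [wr|[w' ->] x xr]; last first.
  rewrite /weil_contract cE; apply: contract_Theta => // y.
  exact: perp.
have [m [a [b [ar br' ba aspan]]]] := exists_dual_family r_nondeg.
pose pr x : W := vsproj p (horizontal_part B a b x).
have prl : linear pr.
  by move=> t x y; rewrite /pr horizontal_part_linear linearP.
have jpr x : j (pr x) = horizontal_part B a b x.
  by apply: vsprojK; exact: horizontal_part_in.
exists (tensor_map idfun (cl_retract (B := BG) BW pr) w).
pose s := [seq (tnth b i, tnth a i) | i <- enum 'I_m].
have sE : foldr (fun ab f => drop_comp BG ab.1 ab.2 \o f) id s =1 j \o pr.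
  by move=> x; rewrite /= jpr; exact: horizontal_foldr.
apply: (horizontal_image two BGl BGr BGs BWl BWs jl prl _ sE) => // _ /mapP[i _ ->] /=.
by rewrite -cE; apply: wr.
Qed.

Section Invariants.
Variables (T : Type) (HT : T -> Prop) (A : T -> g -> g).
Hypothesis A_lin : forall t, HT t -> linear (A t).
Hypothesis A_br : forall t, HT t -> forall x y, A t (br x y) = br (A t x) (A t y).
Hypothesis A_iso : forall t, HT t -> forall x y, B (A t x) (A t y) = B x y.
Hypothesis A_p : forall t, HT t -> forall y, y \in p -> A t y \in p.
Hypothesis A_inv : forall t, HT t -> exists2 t', HT t' & forall x, A t (A t' x) = x.

Definition restricted (f : g -> g) (y : W) : W := vsproj p (f (j y)).
Local Notation AW t := (restricted (A t)).

Let AWE t y : HT t -> j (AW t y) = A t (j y).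
Proof. by move=> Ht; apply: vsprojK; apply: A_p => //; exact: subvsP. Qed.

Let AWl t : HT t -> linear (AW t).
Proof. by move=> Ht k x y; rewrite /restricted linearP (A_lin Ht) linearP. Qed.

Let AWiso t y z : HT t -> BW (AW t y) (AW t z) = BW y z.
Proof. by move=> Ht; rewrite /pullback_form !AWE // A_iso. Qed.

Local Notation actG t := (weil_map (br := br) (B := B) (j := idfun) (A t) (A t)).
Local Notation actW t := (weil_map (br := br) (B := B) (j := j) (A t) (AW t)).
Local Notation fU t := (presented_map (enveloping_rel br) (A t) : enveloping br -> _).
Local Notation fG t := (presented_map (clifford_rel BG) (A t) : clifford BG -> _).
Local Notation fW t := (presented_map (clifford_rel BW) (AW t) : clifford BW -> _).

Let fU_rel t (Ht : HT t) := env_map_rel (A_lin Ht) (A_br Ht).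

Let fG_rel t (Ht : HT t) s : clifford_rel BG s -> forall v : clifford BG,
  free_act (fun x v => c (A t x) * v) s v = 0.
Proof. by apply: cl_map_rel => //; [exact: A_lin | move=> x y; exact: A_iso]. Qed.

Let fW_rel t (Ht : HT t) s : clifford_rel BW s -> forall v : clifford BW,
  free_act (fun x v => cW (AW t x) * v) s v = 0.
Proof. by apply: cl_map_rel => //; [exact: AWl | move=> x y; exact: AWiso]. Qed.

Let fUl t (Ht : HT t) := presented_map_lin (fU_rel Ht).
Let fGl t (Ht : HT t) := presented_map_lin (@fG_rel t Ht).
Let fWl t (Ht : HT t) := presented_map_lin (@fW_rel t Ht).

Lemma weil_inclusion_equivariant t w : HT t -> Theta (actW t w) = actG t (Theta w).
Proof.
move=> Ht; have [lU lG lW] := And3 (fUl Ht) (fGl Ht) (fWl Ht).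
have lTW := tensor_map_lin lU lW; have lTG := tensor_map_lin lU lG.
have lT := weil_inclusion_linear.
have cE v : cl_map (fW t v) = fG t (cl_map v).
  move: v; apply: presented_ind => [|k v v' IH IH'|y v IH].
  - have F1 : fW t 1 = 1 by exact: presented_map1 (@fW_rel t Ht).
    have F2 : fG t 1 = 1 by exact: presented_map1 (@fG_rel t Ht).
    have F3 : cl_map 1 = 1 by exact: cl_map1.
    by rewrite F1 F3 F2.
  - by rewrite lW !lj lG IH IH'.
  rewrite (presented_map_genM (@fW_rel t Ht)).
  rewrite !(@cl_map_genM _ _ _ j jl BW) // (presented_map_genM (@fG_rel t Ht)).
  by rewrite IH AWE.
move: w; apply: tensor_ind => [k v v' IH IH'|x y].
  by rewrite /weil_map lTW !lT lTG -!/(weil_map _ _ _) IH IH'.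
rewrite /weil_map tensor_mapE // !weil_inclusionE tensor_mapE //.
by congr tensor.
Qed.

Lemma weil_inclusion_invariants :
  Theta @` [set w | forall t, HT t -> actW t w = w] =
  [set w | (forall t, HT t -> actG t w = w) /\
           (forall x, x \in r -> weil_contract x w = 0)].
Proof.
apply/seteqP; split=> [_ [w winv <-]|w [winv /weil_horizontalP [w' wE]]] /=.
  split=> [t Ht|x xr]; first by rewrite -weil_inclusion_equivariant // winv.
  by apply: (proj2 (weil_horizontalP _)) => //; exists w.
exists w' => // t Ht; apply: weil_inclusion_inj.
by rewrite weil_inclusion_equivariant // -wE winv.
Qed.

Section Dirac.
Variables (n : nat) (pl ql : n.-tuple W).
Hypothesis pq_dual : forall y, y = \sum_l BW (tnth pl l) y *: tnth ql l.
Hypothesis qp_dual : forall y, y = \sum_l BW y (tnth ql l) *: tnth pl l.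

(** The image of a pair of dual bases under an isometry is another such pair, and
    the Dirac operator is the same for both. *)
Lemma cubic_dirac_invariant t : HT t ->
  actW t (cubic_dirac br B j pl ql) = cubic_dirac br B j pl ql.
Proof.
move=> Ht; have [lU lW] := (fUl Ht, fWl Ht).
have lTW := tensor_map_lin lU lW; rewrite cubic_diracE //.
rewrite /weil_map (linB lTW) (lin_sum lTW) tensor_mapE //.
pose P' l := AW t (tnth pl l); pose Q' l := AW t (tnth ql l).
have [t' Ht' tt'] := A_inv Ht.
have AWK y : AW t (AW t' y) = y.
  by apply: val_inj; rewrite /= AWE // AWE // tt'.
have P'dual y : y = \sum_l BW (P' l) y *: Q' l.
  rewrite -{1}[y]AWK [AW t' y]pq_dual (lin_sum (AWl Ht)); apply: eq_bigr => l _.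
  by rewrite (linZ (AWl Ht)) -(AWiso _ _ Ht) AWK.
have -> : fU t 1 = 1 by exact: presented_map1 (fU_rel Ht).
congr (_ - tensor 1 _).
  rewrite -(dual_sum (Phi := fun x y => tensor (u (j x)) (cW y)) P'dual qp_dual).
  - apply: eq_bigr => l _; rewrite tensor_mapE //; congr tensor.
      by rewrite (presented_map_gen (fU_rel Ht)) AWE.
    exact: (presented_map_gen (@fW_rel t Ht)).
  - by move=> y k x x'; rewrite jl env_linear tensor_linl.
  - by move=> x k y y'; rewrite cliff_linear tensor_linr.
rewrite (linZ lW); congr (_ *: _).
rewrite -[RHS](cubic_sum_dual Bl Br brl brr jl P'dual qp_dual) /cubic_sum (lin_sum lW).
apply: eq_bigr => i _; rewrite (lin_sum lW); apply: eq_bigr => k _.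
rewrite (lin_sum lW); apply: eq_bigr => l _; rewrite (linZ lW).
rewrite !(presented_mapM (@fW_rel t Ht)) !(presented_map_gen (@fW_rel t Ht)) /=.
by rewrite !AWE // -A_br // A_iso.
Qed.

End Dirac.
End Invariants.

Section OddAd.
Variables (n m : nat) (pl ql : n.-tuple W) (a b : m.-tuple g).
Hypothesis ab_dual : forall x, x = \sum_i B (tnth a i) x *: tnth b i.
Hypothesis qp_dual : forall y, y = \sum_l BW y (tnth ql l) *: tnth pl l.

(** Dual bases of p, completed by dual bases of r, expand every vector of g, which
    is what the decomposition of the Dirac operator starts from. *)
Lemma odd_ad_inclusion w :
  (forall x, x \in r -> inf_action br B j pl ql x * w = w * inf_action br B j pl ql x) ->
  odd_ad (cubic_dirac br B idfun a b) (Theta w) =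
  Theta (odd_ad (cubic_dirac br B j pl ql) w).
Proof.
move=> wr; have [k [ra [rb [rar rbr rba raspan]]]] := exists_dual_family r_nondeg.
have split_dual x : x =
    \sum_l B x (j (tnth ql l)) *: j (tnth pl l) + \sum_i B x (tnth rb i) *: tnth ra i.
  pose y : W := vsproj p (horizontal_part B ra rb x).
  have yE : j y = horizontal_part B ra rb x.
    by apply: vsprojK; exact: horizontal_part_in.
  have -> : \sum_l B x (j (tnth ql l)) *: j (tnth pl l) = j y.
    rewrite [y in RHS]qp_dual (lin_sum jl); apply: eq_bigr => l _; rewrite (linZ jl).
    congr (_ *: _); rewrite /pullback_form yE /horizontal_part linearBl /= form_suml.
    by rewrite big1 ?subr0 // => i _; rewrite perp ?mulr0.
  rewrite yE /horizontal_part; under [X in _ + X]eq_bigr do rewrite Bs.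
  by rewrite subrK.
have s_perp i (y : W) : B (tnth rb i) (j y) = 0 by exact: perp.
have prr0 l i i' : B (j (tnth pl l)) (br (tnth ra i) (tnth ra i')) = 0.
  rewrite Bs Binv Bs; have /mem_orthovP H := br_rp (rar i) (subvsP (tnth pl l)).
  by rewrite H ?oppr0.
apply: (odd_ad_restrict char0 Bl Br Bs brl brr brN Binv jl ab_dual split_dual s_perp prr0).
by move=> i; apply: wr.
Qed.

End OddAd.

End RelativeWeil.

(** * The main theorem *)

Section DualBases.
Variables (K : fieldType) (W : vectType K) (Bf : W -> W -> K) (m : nat) (a b : m.-tuple W).
Hypothesis Bfl : forall y, linear_for *%R (Bf^~ y).
Hypothesis Bfs : forall x y, Bf x y = Bf y x.
Hypothesis ab : dual_bases Bf a b.

Let sumE (I : finType) (f : I -> W) (k : I -> K) y :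
  Bf (\sum_i k i *: f i) y = \sum_i k i * Bf (f i) y.
Proof.
have lB : linear (Bf^~ y : W -> K^o) by exact: Bfl.
exact: (etrans (lin_sum lB _ _ _) (eq_bigr _ (fun i _ => linZ lB _ _))).
Qed.

Lemma dual_bases_expandl y : y = \sum_l Bf y (tnth b l) *: tnth a l.
Proof.
have [abas abE] := ab.
rewrite {1}(coord_basis abas (memvf y)); apply: eq_bigr => l _.
rewrite -tnth_nth; congr (_ *: _).
rewrite [in RHS](coord_basis abas (memvf y)).
under [in RHS]eq_bigr do rewrite -tnth_nth.
rewrite sumE (bigD1 l) //= abE eqxx mulr1 big1 ?addr0 // => i /negPf il.
by rewrite abE il mulr0.
Qed.

Lemma dual_bases_expandr y : y = \sum_l Bf (tnth a l) y *: tnth b l.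
Proof.
have [abas abE] := ab; apply/eqP; rewrite -subr_eq0; apply/eqP; set z := _ - _.
rewrite [z]dual_bases_expandl.
have az i : Bf (tnth a i) z = 0.
  have lB : linear (Bf^~ (tnth a i) : W -> K^o) by exact: Bfl.
  rewrite Bfs /z; apply: (etrans (linB lB _ _)).
  rewrite sumE (bigD1 i) //= Bfs (Bfs (tnth b i)) abE eqxx mulr1.
  rewrite big1 ?addr0 ?subrr // => l /negPf li.
  by rewrite (Bfs (tnth b l)) abE eq_sym li mulr0.
have z0 x : Bf x z = 0.
  by rewrite [x]dual_bases_expandl sumE big1 // => i _; rewrite az mulr0.
by rewrite big1 // => l _; rewrite Bfs z0 scale0r.
Qed.

End DualBases.

Section InfAction.
Variables (K : fieldType) (g W : lmodType K) (br : g -> g -> g) (B : g -> g -> K).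
Variables (j : W -> g) (n : nat) (p q : n.-tuple W).
Hypothesis Bl : forall y, linear_for *%R (B^~ y).

Lemma inf_action_linear : linear (inf_action br B j p q).
Proof.
move=> k x y; rewrite /inf_action env_linear tensor_linl scalerDr addrACA.
congr (_ + _); rewrite -tensor_linr; congr tensor.
rewrite /spin scalerA mulrC -scalerA -scalerDr; congr (_ *: _).
rewrite scaler_sumr -big_split; apply: eq_bigr => l _ /=.
rewrite scaler_sumr -big_split; apply: eq_bigr => l' _ /=.
by rewrite Bl scalerDl scalerA.
Qed.
End InfAction.

Theorem lemma3p1 (R : realType) (n : nat) (G : lieGroupType R n)
    (phi : chart R n G) (phi_atlas : lie_atlas phi)
    (phi1 : chart_dom phi 1%g) (H : set G) (B : {symmetric 'rV[R[i]]_n})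
    (r : {vspace 'rV[R[i]]_n}) (GH : quadratic_pair phi H B r) :
  let br := bracket phi in
  let W := weil_algebra phi B in
  let p := complement B r in
  let Wp := relative_weil phi B r in
  let Ind := ind_point phi H B r in
  let Inv := relative_invariants phi H B r in
  (* the canonical identification of (U(g) (x) Cl(p))^R with Ind *)
  exists Theta : {linear Wp -> W},
  (forall u x, Theta (weil_tensor u (generator _ x)) =
               weil_tensor u (generator _ (vsval x))) /\
  [/\ monoid_morphism Theta,
      injective Theta,
      forall w, Theta (weil_parity w) = weil_parity (Theta w)
    & Theta @` Inv = Ind]
  /\
  forall (k : nat) (pl ql : k.-tuple (subvs_of p)),
    dual_bases (pullback_form B (@vsval _ _ p)) pl ql ->
    let Dp : Wp := cubic_dirac br B (@vsval _ _ p) pl ql in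
    Inv Dp /\
    forall (m : nat) (a b : m.-tuple 'rV[R[i]]_n), dual_bases B a b ->
    let D : W := cubic_dirac br B idfun a b in
    forall w, Inv w -> odd_ad D (Theta w) = Theta (odd_ad Dp w).
Proof.
move=> br W p Wp Ind Inv.
have ch0 := @complex_natr_neq0 R.
have brl : forall y, linear (br^~ y) := bracket_linearl phi_atlas phi1.
have brr : forall x, linear (br x) := bracket_linearr phi_atlas phi1.
have brN : forall x y, br x y = - br y x := bracketN phi_atlas phi1.
have Binv : forall x y z, B (br x y) z = - B y (br x z) := form_invariant phi_atlas phi1 GH.
have r0 := qp_nondegenerate_r GH.
have brp x y : x \in r -> y \in p -> br x y \in p := @bracket_r_p _ _ _ _ phi_atlas phi1 _ _ _ GH x y.
have Al h : H h -> linear (Ad phi h) by move=> _; exact: (Ad_linear phi_atlas phi1 h).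
have Ab h : H h -> forall x y, Ad phi h (br x y) = br (Ad phi h x) (Ad phi h y).
  by move=> _; exact: (Ad_bracket phi_atlas phi1 h).
have Ai h : H h -> forall x y, B (Ad phi h x) (Ad phi h y) = B x y.
  by move=> _; exact: (qp_invariant GH h).
have Ap h : H h -> forall y, y \in p -> Ad phi h y \in p.
  by move=> Hh y; exact: (Ad_p phi_atlas phi1 GH Hh).
have Av h : H h -> exists2 h', H h' & forall x, Ad phi h (Ad phi h' x) = x.
  move=> Hh; have [_ _ HV] := qp_subgroup GH.
  by exists (h^-1)%g; [exact: HV | exact: (AdVK phi_atlas phi1 h)].
have Bl := form_linearl B.
have Br := form_linearr B.
have Bs := form_sym B.
have jl := @vsval_linear _ _ B r.
pose T0 : Wp -> W := @weil_inclusion R[i] _ br B r.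
have T0l : linear T0 by exact: (@weil_inclusion_linear _ _ br B r ch0).
pose Tm := GRing.isLinear.Build R[i] Wp W *:%R T0 T0l.
pose Theta : {linear Wp -> W} := HB.pack T0 Tm.
exists Theta; split.
  by move=> u x; exact: (@weil_inclusion_gen _ _ br B r ch0 u x).
split.
  split.
  - exact: (@weil_inclusion_morphism _ _ br B r ch0).
  - exact: (weil_inclusion_inj ch0).
  - exact: (@weil_inclusion_parity _ _ br B r ch0).
  - exact: (weil_inclusion_invariants ch0 r0 Al Ab Ai Ap).
move=> k pl ql pq Dp.
have BWl : forall y, linear_for *%R ((pullback_form B (@vsval _ _ p))^~ y) := pullback_linearl Bl jl.
have pE := dual_bases_expandl BWl pq.
have qE := dual_bases_expandr BWl (pullback_sym _ Bs) pq.
split; first by move=> h Hh; exact: (cubic_dirac_invariant ch0 brl brr brN Binv Al Ab Ai Ap Av qE pE Hh).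
move=> m a b abd D w winv.
have aE := dual_bases_expandr Bl Bs abd.
apply: (odd_ad_inclusion ch0 brl brr brN Binv r0 brp aE pE).
have lL := inf_action_linear br (@vsval _ _ p) pl ql Bl.
(* By linearity it is enough to consider velocities of one-parameter subgroups
   of H, which span r over C. *)
move=> x /(mem_Lie_span GH) [d [kk [v [Hv ->]]]].
rewrite (lin_sum lL) mulr_suml mulr_sumr; apply: eq_bigr => i _.
rewrite (linZ lL) -presented_scaleAl -presented_scaleAr; congr (_ *: _).
have [c [c0 cc cv Hc]] := real_Lie_curve (Hv i).
pose pr (f : 'rV[R[i]]_n -> 'rV[R[i]]_n) := restricted (B := B) (r := r) f.
have vE y f : f (vsval y) \in p -> vsval (pr f y) = f (vsval y) by move=> fp; exact: vsprojK.
have qE' y : y = \sum_l pullback_form B (@vsval _ _ p) (tnth ql l) y *: tnth pl l.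
  by rewrite {1}[y]pE; apply: eq_bigr => l _; rewrite (pullback_sym _ Bs).
apply: (infinitesimal_invariance (ch0 1%N) Bl Br Bs brr brN Binv jl qE qE'
  (A := fun t => Ad phi (c t)) (AW := fun t => pr (Ad phi (c t)))
  (adx := pr (br (cplx (v i))))).
- by move=> t; exact: Al.
- by move=> t z x' y; rewrite /pr /restricted linearP (Al _ (Hc t)) linearP.
- by move=> t; exact: Ab.
- move=> t y z; have inp u := Ap _ (Hc t) _ (subvsP u).
  exact: (etrans (congr2 B (vE y _ (inp y)) (vE z _ (inp z))) (Ai _ (Hc t) _ _)).
- by move=> y; rewrite c0 (Ad1 phi1).
- by move=> y; rewrite c0 /pr /restricted (Ad1 phi1); exact: vsvalK.
- by move=> y; exact: (Ad_tangent phi_atlas phi1 y c0 cc cv).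
- move=> y; apply: (tangent_linear (Phi := vsproj p)); first exact: linearP.
  exact: (Ad_tangent phi_atlas phi1 (vsval y) c0 cc cv).
- move=> y; apply: vE; apply: brp; last exact: subvsP.
  exact: (real_Lie_in_r GH (Hv i)).
- by move=> t; exact: winv.
Qed.
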